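(* Among $4$-dimensional generalized Hantzsche-Wendt manifolds, only four of them (all non-orientable) are not totally geodesic boundaries of a compact flat manifold, namely the manifolds $H\text{-}W_1$ and $H\text{-}W_2$, which have vanishing first Betti number, and the manifolds $H\text{-}W_3$ and $H\text{-}W_4$. That is, for $1\le i\le 12$, the manifold $H\text{-}W_i$ is the totally geodesic boundary of a compact flat manifold if and only if $i\notin\{1,2,3,4\}$.
   Context: All manifolds are assumed connected. A Bieberbach group in dimension $m$ is a discrete, co-compact group $\Gamma$ of affine isometries of $\mathbb{R}^m$ acting without fixed points; a Bieberbach manifold is the quotient $\mathbb{R}^m/\Gamma$ with the induced flat metric. The translations in $\Gamma$ form a lattice $\Lambda$ of $\mathbb{R}^m$, normal and of finite index in $\Gamma$, and $\Gamma/\Lambda$ is the holonomy group. A Bieberbach manifold $N$ of dimension $m$ is the totally geodesic boundary of a compact flat manifold if there is a compact flat Riemannian manifold $M$ of dimension $m+1$ with totally geodesic boundary isometric to $N$. A generalized Hantzsche-Wendt manifold of dimension $n$ is an $n$-dimensional Bieberbach manifold with holonomy group isomorphic to $\mathbb{Z}_2^{\,n-1}$. In dimension $4$ there are twelve of them up to affine equivalence, denoted $H\text{-}W_1,\dots,H\text{-}W_{12}$, described as follows. Let $(x,y,z,t)$ be the coordinates on $\mathbb{R}^4$ in the standard orthonormal basis $e_1,e_2,e_3,e_4$, and let $\Lambda$ be the orthogonal lattice generated by $ae_1,be_2,ce_3,de_4$ with $a,b,c,d>0$. $T_x,T_y,T_z,T_t$ denote the translations of vectors $\frac a2e_1,\frac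 b2e_2,\frac c2e_3,\frac d2e_4$; several indices denote composition, e.g. $T_{xy}=T_xT_y$. $S_x$ is the orthogonal reflection changing the sign of the coordinate $x$ only (the symmetry with respect to the hyperplane $yzt$), $S_{xy}$ is the symmetry with respect to the plane $zt$, changing the signs of $x$ and $y$ only, and similarly for other indices. Each $H\text{-}W_i$ is the quotient of the torus $\mathbb{R}^4/\Lambda$ by the group generated by the isometries induced by: - $H\text{-}W_1$: $T_{yt}S_z,\ T_zS_{xt},\ T_xS_{yt}$ - $H\text{-}W_2$: $T_tS_z,\ T_{yz}S_{xt},\ T_xS_{yt}$ - $H\text{-}W_3$: $T_tS_z,\ T_{yz}S_{xz},\ T_xS_{yz}$ - $H\text{-}W_4$: $T_{yt}S_z,\ T_{yz}S_{xz},\ T_xS_{yz}$ - $H\text{-}W_5$: $T_yS_z,\ T_tS_{xz},\ T_xS_{yz}$ - $H\text{-}W_6$: $T_{yz}S_z,\ T_tS_{xz},\ T_xS_{yz}$ - $H\text{-}W_7$: $T_yS_z,\ T_{yt}S_{xz},\ T_xS_{yz}$ - $H\text{-}W_8$: $T_{xz}S_z,\ T_{yt}S_{xz},\ T_xS_{yz}$ - $H\text{-}W_9$: $T_{yz}S_z,\ T_{yt}S_{xz},\ T_xS_{yz}$ - $H\text{-}W_{10}$: $T_{xyz}S_z,\ T_{yt}S_{xz},\ T_xS_{yz}$ - $H\text{-}W_{11}$: $T_yS_z,\ T_{yzt}S_{xz},\ T_xS_{yz}$ - $H\text{-}W_{12}$: $T_{yz}S_z,\ T_{yzt}S_{xz},\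 T_xS_{yz}$ *)

(* Defs.v *)
From HB Require Import structures.
From mathcomp Require Import all_boot all_order all_algebra.
From mathcomp Require Import generic_quotient.
From mathcomp Require Import all_classical all_reals all_analysis.

Set Implicit Arguments.
Unset Strict Implicit.
Unset Printing Implicit Defensive.

Import Order.TTheory GRing.Theory Num.Theory.
Import numFieldNormedType.Exports.

Local Open Scope classical_set_scope.
Local Open Scope ring_scope.
Local Open Scope quotient_scope.

(* The library norm on 'rV[R]_n is the sup norm; it induces the right topology
   but not the Euclidean distance. *)
Definition euclid_dist (R : realType) (n : nat) (x y : 'rV[R]_n) : R :=
  Num.sqrt (\sum_(i < n) (x 0 i - y 0 i) ^+ 2).

(** * Groups of isometries of R^n and their quotients *)

Definition euclid_isometry (R : realType) (n : nat) : set ('rV[R]_n -> 'rV[R]_n) :=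
  [set g | (forall x y, euclid_dist (g x) (g y) = euclid_dist x y) /\ bijective g].

Definition subgroup_closed (T : Type) (H : set (T -> T)) : Prop :=
  [/\ H id,
      forall g h, H g -> H h -> H (g \o h) &
      forall g h, H g -> cancel g h -> cancel h g -> H h].

Record isom_group (R : realType) (n : nat) := IsomGroup {
  isoms :> set ('rV[R]_n -> 'rV[R]_n);
  isoms_isometry : isoms `<=` @euclid_isometry R n;
  isoms_closed : subgroup_closed isoms
}.

Lemma euclid_isometry_closed (R : realType) (n : nat) : subgroup_closed (@euclid_isometry R n).
Proof.
split=> [|g h [dg bg] [dh bh]|g h [dg bg] gh hg].
- by split=> //; exists id.
- by split=> [x y /=|]; [rewrite dg dh | exact: bij_comp].
- by split=> [x y|]; [rewrite -dg !hg | exists g].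
Qed.

(* The subgroup of Isom(R^n) generated by a set S of isometries. *)
Definition generated_set (R : realType) (n : nat)
    (S : set ('rV[R]_n -> 'rV[R]_n)) : set ('rV[R]_n -> 'rV[R]_n) :=
  @euclid_isometry R n `&` \bigcap_(H in [set H | subgroup_closed H /\ S `<=` H]) H.

Lemma generated_closed (R : realType) (n : nat)
    (S : set ('rV[R]_n -> 'rV[R]_n)) : subgroup_closed (generated_set S).
Proof.
have [I1 IM IV] := @euclid_isometry_closed R n.
split=> [|g h [Ig Gg] [Ih Gh]|g h [Ig Gg] gh hg].
- by split=> // H [[]].
- split=> [|H HH]; first exact: IM.
  by have [[_ HM _] _] := HH; apply: HM; [exact: Gg | exact: Gh].
- split=> [|H HH]; first exact: (IV g).
  by have [[_ _ HV] _] := HH; apply: (HV g); first exact: Gg.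
Qed.

Definition generated (R : realType) (n : nat)
    (S : set ('rV[R]_n -> 'rV[R]_n)) : isom_group R n :=
  IsomGroup (@subIsetl _ _ _) (generated_closed S).

Section Quotient.
Variables (R : realType) (n : nat) (G : isom_group R n).

Definition orbit_rel : rel 'rV[R]_n :=
  fun x y => `[< exists2 g, isoms G g & g x = y >].

Lemma orbit_refl : reflexive orbit_rel.
Proof. by move=> x; apply/asboolP; exists id => //; case: (isoms_closed G). Qed.

Lemma orbit_sym : symmetric orbit_rel.
Proof.
have sub x y : orbit_rel x y -> orbit_rel y x.
  move=> /asboolP[g Gg <-]; apply/asboolP.
  have [_ [h gh hg]] := isoms_isometry Gg.
  by exists h => //; have [_ _ HV] := isoms_closed G; exact: (HV g).
by move=> x y; apply/idP/idP; exact: sub.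
Qed.

Lemma orbit_trans : transitive orbit_rel.
Proof.
move=> y x z /asboolP[g Gg <-] /asboolP[h Gh <-]; apply/asboolP.
by exists (h \o g) => //; have [_ HM _] := isoms_closed G; exact: HM.
Qed.

Definition orbit_equiv : equiv_rel 'rV[R]_n :=
  EquivRel orbit_rel orbit_refl orbit_sym orbit_trans.

(* The space R^n / G, with the quotient topology... *)
Definition quotient_space : topologicalType :=
  quotient_topology {eq_quot orbit_equiv}.

(* ... and the distance of the induced flat metric. *)
Definition quotient_dist (u v : quotient_space) : R :=
  inf [set r | exists x y : 'rV[R]_n,
    [/\ \pi_({eq_quot orbit_equiv}) x = u, \pi_({eq_quot orbit_equiv}) y = v
      & r = euclid_dist x y]].

End Quotient.

(** * Flat manifolds with totally geodesic boundary *)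

(* c maps the open ball of centre p and radius r isometrically onto the open
   ball of centre c p and radius r of the subset D of R^n. *)
Definition isometric_chart (R : realType) (X : Type) (dist : X -> X -> R)
    (n : nat) (D : set 'rV[R]_n) (p : X) (r : R) (c : X -> 'rV[R]_n) : Prop :=
  [/\ 0 < r,
      forall x y, dist p x < r -> dist p y < r -> euclid_dist (c x) (c y) = dist x y &
      c @` [set x | dist p x < r] = D `&` [set z | euclid_dist (c p) z < r]].

Definition half_space (R : realType) (m : nat) : set 'rV[R]_m.+1 :=
  [set z | 0 <= z 0 ord_max].

(* The distance is the infimum of the lengths of the curves joining two points;
   a curve of length l is parametrised here on [0, 1] as an l-Lipschitz map. *)
Definition length_space (R : realType) (M : metricType R) : Prop :=
  forall (x y : M) (e : R), 0 < e -> exists gamma : R -> M,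
    [/\ gamma 0 = x, gamma 1 = y &
        forall s t, 0 <= s <= 1 -> 0 <= t <= 1 ->
          mdist (gamma s) (gamma t) <= (mdist x y + e) * `|s - t|].

(* A Riemannian manifold is handled through its Riemannian distance. Flat means
   locally isometric to Euclidean space, and flat with totally geodesic boundary
   means modelled on closed Euclidean half-spaces (in the same way as hyperbolic
   manifolds with totally geodesic boundary are modelled on closed half-spaces
   of the hyperbolic space): in a flat chart the boundary is a piece of a totally
   geodesic hypersurface of R^(m+1), that is, of a hyperplane. The boundary may
   be empty and the dimension is m.+1. *)
Definition compact_flat_tg_manifold (R : realType) (m : nat)
    (M : metricType R) : Prop :=
  [/\ compact [set: M], connected [set: M], length_space M &
      forall p : M, exists r c,
        isometric_chart (@mdist R M) (@half_space R m) p r c].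

Definition manifold_boundary (R : realType) (m : nat) (M : metricType R) :
    set M :=
  [set p | exists r c, isometric_chart (@mdist R M) (@half_space R m) p r c /\
                       c p 0 ord_max = 0].
Arguments manifold_boundary {R} m M.

(* A Riemannian isometry preserves distances only locally when its target, here
   the boundary of M, carries the distance of M instead of its intrinsic one. *)
Definition local_isometry (R : realType) (X Y : Type) (dX : X -> X -> R)
    (dY : Y -> Y -> R) (f : X -> Y) : Prop :=
  forall p, exists2 r, 0 < r & forall x y, dX p x < r -> dX p y < r ->
    dY (f x) (f y) = dX x y.

Definition is_tg_boundary (R : realType) (m : nat) (G : isom_group R m) : Prop :=
  exists M : metricType R, compact_flat_tg_manifold m M /\
    exists f : quotient_space G -> M,
      [/\ injective f, range f = manifold_boundary m M &
          local_isometry (@quotient_dist R m G) (@mdist R M) f].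

(** * Orientability and the first Betti number *)

(* One isometric chart onto a Euclidean ball around each point, with
   orientation-preserving changes of charts. *)
Definition orientable (R : realType) (X : Type) (dist : X -> X -> R)
    (n : nat) : Prop :=
  exists (r : X -> R) (c : X -> X -> 'rV[R]_n),
    (forall p, isometric_chart dist [set: 'rV[R]_n] p (r p) (c p)) /\
    forall p q x, dist p x < r p -> dist q x < r q ->
      exists (A : 'M[R]_n) (b : 'rV[R]_n),
        0 < \det A /\
        exists2 e, 0 < e & forall y, dist x y < e -> c q y = c p y *m A + b.

Section Betti.
Variables (R : realType) (X : topologicalType).

(* Singular cohomology of X with real coefficients in degree 1. Singular
   1-simplices are maps on [0, 1] and singular 2-simplices are maps on the
   triangle 0 <= s <= t <= 1, both given by total functions whose values outside
   of these domains are irrelevant. *)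
Definition path1 : set (R -> X) :=
  [set g : R -> X | {within `[0, 1], continuous g}].

Definition triangle : set (R * R) := [set z | 0 <= z.1 <= z.2 /\ z.2 <= 1].

Definition cocycle1 (phi : (R -> X) -> R) : Prop :=
  (forall g h, (forall t, 0 <= t <= 1 -> g t = h t) -> phi g = phi h) /\
  forall sigma : R * R -> X, {within triangle, continuous sigma} ->
    phi (fun t => sigma (0, t)) + phi (fun t => sigma (t, 1)) =
    phi (fun t => sigma (t, t)).

Definition coboundary1 (phi : (R -> X) -> R) : Prop :=
  exists f : X -> R, forall g, path1 g -> phi g = f (g 1) - f (g 0).

(* The first Betti number dim H^1(X; R) is equal to k: the classes of the
   cocycles e_0, ..., e_(k-1) form a basis of H^1(X; R). *)
Definition first_betti_eq (k : nat) : Prop :=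
  exists e : 'I_k -> (R -> X) -> R,
    (forall i, cocycle1 (e i)) /\
    forall phi, cocycle1 phi ->
      exists! u : 'rV[R]_k,
        coboundary1 (fun g => phi g - \sum_(i < k) u 0 i * e i g).

End Betti.

(** * The four-dimensional generalized Hantzsche-Wendt manifolds *)

Definition ix : 'I_4 := @Ordinal 4 0 isT.
Definition iy : 'I_4 := @Ordinal 4 1 isT.
Definition iz : 'I_4 := @Ordinal 4 2 isT.
Definition it : 'I_4 := @Ordinal 4 3 isT.

(* The pair (P, Q) stands for T_P S_Q. *)
Definition HW_table (i : nat) : seq (seq 'I_4 * seq 'I_4) :=
  match i with
  | 1 => [:: ([:: iy; it], [:: iz]); ([:: iz], [:: ix; it]); ([:: ix], [:: iy; it])]
  | 2 => [:: ([:: it], [:: iz]); ([:: iy; iz], [:: ix; it]); ([:: ix], [:: iy; it])]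
  | 3 => [:: ([:: it], [:: iz]); ([:: iy; iz], [:: ix; iz]); ([:: ix], [:: iy; iz])]
  | 4 => [:: ([:: iy; it], [:: iz]); ([:: iy; iz], [:: ix; iz]); ([:: ix], [:: iy; iz])]
  | 5 => [:: ([:: iy], [:: iz]); ([:: it], [:: ix; iz]); ([:: ix], [:: iy; iz])]
  | 6 => [:: ([:: iy; iz], [:: iz]); ([:: it], [:: ix; iz]); ([:: ix], [:: iy; iz])]
  | 7 => [:: ([:: iy], [:: iz]); ([:: iy; it], [:: ix; iz]); ([:: ix], [:: iy; iz])]
  | 8 => [:: ([:: ix; iz], [:: iz]); ([:: iy; it], [:: ix; iz]); ([:: ix], [:: iy; iz])]
  | 9 => [:: ([:: iy; iz], [:: iz]); ([:: iy; it], [:: ix; iz]); ([:: ix], [:: iy; iz])]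
  | 10 => [:: ([:: ix; iy; iz], [:: iz]); ([:: iy; it], [:: ix; iz]); ([:: ix], [:: iy; iz])]
  | 11 => [:: ([:: iy], [:: iz]); ([:: iy; iz; it], [:: ix; iz]); ([:: ix], [:: iy; iz])]
  | 12 => [:: ([:: iy; iz], [:: iz]); ([:: iy; iz; it], [:: ix; iz]); ([:: ix], [:: iy; iz])]
  | _ => [::]
  end.

Section HantzscheWendt.
Variables (R : realType) (a b c d : R).

Definition period (k : 'I_4) : R := [:: a; b; c; d]`_k.

Definition lattice_translation (k : 'I_4) (p : 'rV[R]_4) : 'rV[R]_4 :=
  \row_j (p 0 j + if j == k then period k else 0).

Definition T_S (P Q : seq 'I_4) (p : 'rV[R]_4) : 'rV[R]_4 :=
  \row_j ((if j \in Q then - p 0 j else p 0 j) +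
          (if j \in P then period j / 2 else 0)).

(* H-W_i is the quotient of R^4 by this group (1 <= i <= 12). *)
Definition HW_group (i : nat) : isom_group R 4 :=
  generated ([set lattice_translation k | k in [set: 'I_4]] `|`
             [set T_S w.1 w.2 | w in [set` HW_table i]]).

End HantzscheWendt.

(* Main.v *)
(* A compact flat manifold M with connected totally geodesic boundary N = R^m / Gamma
   is developed along its inner normals: U : R^m -> N extends to a local isometry E of
   a slab R^m x [0, T), and T is taken maximal. It is finite, since a local isometry
   of a half-space onto M would have a well-defined height, which is unbounded. For
   finite T the map E extends to R^m x [0, T] and, by maximality, sends R^m x {T} to
   the boundary again; reversing the normals gives an isometry sigma of R^m that
   normalises Gamma, has its square in Gamma, and is such that sigma Gamma has no
   fixed point. For H-W_1, ..., H-W_4 the linear part of sigma is a signed permutation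
   of the coordinates and its translation part is essentially a half-period, and in
   each of the finitely many cases some element of sigma Gamma has a fixed point.
   Conversely, for H-W_5, ..., H-W_12 the half-translation T_y or T_z is such a sigma,
   and N bounds the quotient of R^4 x [-1, 1] by Gamma and (sigma, -1).

   Orientability fails since the sign of the differentials of the charts is constant
   along a path from x to g x, while g has determinant -1. A real 1-cocycle on R^n / Gamma
   has a primitive on R^n, obtained by coning paths to the origin, which is invariant
   under Gamma as soon as Gamma has no nonzero homomorphism to R. *)
From HB Require Import structures.
From mathcomp Require Import all_boot all_order all_algebra.
From mathcomp Require Import generic_quotient.
From mathcomp Require Import all_classical all_reals all_analysis.
From mathcomp Require Import ring lra zify.
Require Import Defs.

Set Implicit Arguments.
Unset Strict Implicit.
Unset Printing Implicit Defensive.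

Import Order.TTheory GRing.Theory Num.Theory.
Import numFieldNormedType.Exports.

Local Open Scope classical_set_scope.
Local Open Scope ring_scope.

(** * Euclidean geometry *)

(** [M] is given only as a metric space with isometric charts, so the developing maps are built from
    rigidity instead of an exponential map: a distance-preserving map on a set with points in all
    coordinate directions is affine, a local isometry from a convex set to a Euclidean space is
    global, and a point is determined by its distances to such a set. Compactness gives one chart
    radius [r] for all of [M], and every extension proceeds by steps comparable to [r]; real
    induction along segments does the work of open-closed arguments.

    For the groups, all that matters modulo the lattice is one sign and one half-period bit per
    axis. Conjugating by sigma an element that reverses an axis, or squaring sigma on an axis that
    it keeps with its orientation, forces the translation there to be a half-period; on an axis
    reversed by sigma and by no element of Gamma, every composite fixes a coordinate. What remains
    is a finite check on bits. The exception is the exchange of two axes, where squaring only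
    constrains a combination of two translation parts; it needs a parity argument of its own. *)

Section Dot.
Variables (R : realType) (n : nat).
Implicit Types x y z : 'rV[R]_n.
Local Notation ed := (@euclid_dist R n).

Definition dot x y : R := \sum_(i < n) x 0 i * y 0 i.

Lemma dotC x y : dot x y = dot y x.
Proof. by apply: eq_bigr => i _; rewrite mulrC. Qed.

Lemma dotDl x y z : dot (x + y) z = dot x z + dot y z.
Proof. by rewrite /dot -big_split; apply: eq_bigr => i _; rewrite mxE mulrDl. Qed.

Lemma dotZl k x y : dot (k *: x) y = k * dot x y.
Proof. by rewrite /dot mulr_sumr; apply: eq_bigr => i _; rewrite mxE mulrA. Qed.

Lemma dotNl x y : dot (- x) y = - dot x y.
Proof. by rewrite -scaleN1r dotZl mulN1r. Qed.

Lemma dotBl x y z : dot (x - y) z = dot x z - dot y z.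
Proof. by rewrite dotDl dotNl. Qed.

Lemma dotDr x y z : dot x (y + z) = dot x y + dot x z.
Proof. by rewrite !(dotC x) dotDl. Qed.

Lemma dotZr k x y : dot x (k *: y) = k * dot x y.
Proof. by rewrite !(dotC x) dotZl. Qed.

Lemma dotNr x y : dot x (- y) = - dot x y.
Proof. by rewrite !(dotC x) dotNl. Qed.

Lemma dotBr x y z : dot x (y - z) = dot x y - dot x z.
Proof. by rewrite !(dotC x) dotBl. Qed.

Lemma dot0l x : dot 0 x = 0.
Proof. by rewrite -(scale0r x) dotZl mul0r. Qed.

Definition dotE := (dotDl, dotDr, dotZl, dotZr, dotNl, dotNr).

Lemma dot_ge0 x : 0 <= dot x x.
Proof. by apply: sumr_ge0 => i _; rewrite -expr2 sqr_ge0. Qed.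

Lemma dot_eq0 x : dot x x = 0 -> x = 0.
Proof.
move=> /eqP; rewrite psumr_eq0 => [/allP x0|i _]; last by rewrite -expr2 sqr_ge0.
apply/rowP => i; rewrite mxE; apply/eqP.
by have := x0 i (mem_index_enum i); rewrite mulf_eq0 orbb.
Qed.

Lemma dot_delta x i : dot x (delta_mx 0 i) = x 0 i.
Proof.
rewrite /dot (bigD1 i) //= mxE !eqxx mulr1 big1 ?addr0// => j ji.
by rewrite mxE (negPf ji) andbF mulr0.
Qed.

Lemma cauchy_schwarz x y : dot x y ^+ 2 <= dot x x * dot y y.
Proof.
have [y0|y0] := eqVneq (dot y y) 0.
  by rewrite (dot_eq0 y0) dotC !dot0l expr0n mulr0.
have yy : 0 < dot y y by rewrite lt_neqAle eq_sym y0 dot_ge0.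
have := dot_ge0 (dot y y *: x - dot x y *: y).
rewrite !dotE (dotC y x) => h.
have : 0 <= dot y y * (dot x x * dot y y - dot x y ^+ 2) by nra.
by rewrite pmulr_rge0// subr_ge0.
Qed.

Lemma edE x y : ed x y = Num.sqrt (dot (x - y) (x - y)).
Proof. by congr Num.sqrt; apply: eq_bigr => i _; rewrite !mxE. Qed.

Lemma ed_sqr x y : ed x y ^+ 2 = dot (x - y) (x - y).
Proof. by rewrite edE sqr_sqrtr// dot_ge0. Qed.

Lemma ed_ge0 x y : 0 <= ed x y.
Proof. exact: sqrtr_ge0. Qed.

Lemma ed_sym x y : ed x y = ed y x.
Proof. by rewrite !edE -opprB dotNl dotNr opprK. Qed.

Lemma edxx x : ed x x = 0.
Proof. by rewrite edE subrr dot0l sqrtr0. Qed.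

Lemma ed_eq0 x y : ed x y = 0 -> x = y.
Proof.
move=> xy; have := ed_sqr x y; rewrite xy expr0n /= => /esym/dot_eq0/eqP.
by rewrite subr_eq0 => /eqP.
Qed.

Lemma edD x y z : ed (x + z) (y + z) = ed x y.
Proof. by rewrite !edE opprD addrACA subrr addr0. Qed.

Lemma edDl x y z : ed (z + x) (z + y) = ed x y.
Proof. by rewrite !(addrC z) edD. Qed.

Lemma ed_triangle y x z : ed x z <= ed x y + ed y z.
Proof.
have yz := ed_ge0 y z; have xy := ed_ge0 x y.
rewrite -(@ler_pXn2r _ 2)// ?nnegrE ?ed_ge0 ?addr_ge0//.
rewrite sqrrD !ed_sqr (_ : x - z = (x - y) + (y - z)); last by rewrite subrKA.
have := cauchy_schwarz (x - y) (y - z); rewrite -!ed_sqr -exprMn !ed_sqr.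
move: (x - y) (y - z) => u v h; rewrite dotDl !dotDr (dotC v u).
suff : dot u v <= ed x y * ed y z by rewrite -mulr_natl => ?; nra.
have [uv|uv] := leP (dot u v) 0; first by rewrite (le_trans uv) ?mulr_ge0.
by rewrite -(@ler_pXn2r _ 2)// ?nnegrE ?mulr_ge0// ltW.
Qed.

Lemma ed_coord x y i : `|x 0 i - y 0 i| <= ed x y.
Proof.
rewrite -(@ler_pXn2r _ 2)// ?nnegrE ?ed_ge0//.
rewrite ed_sqr /dot (bigD1 i)//= !mxE -expr2 real_normK ?num_real//.
by rewrite lerDl; apply: sumr_ge0 => j _; rewrite -expr2 sqr_ge0.
Qed.

Lemma ed_le_coord x y e : (forall i, `|x 0 i - y 0 i| <= e) -> 0 <= e ->
  ed x y <= n%:R * e.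
Proof.
move=> xy e0; have ne0 : 0 <= n%:R * e by rewrite mulr_ge0.
rewrite -(@ler_pXn2r _ 2)// ?nnegrE ?ed_ge0// ed_sqr.
apply: (@le_trans _ _ (\sum_(i < n) e ^+ 2)).
  apply: ler_sum => i _; rewrite !mxE -expr2 -real_normK ?num_real//.
  by rewrite ler_pXn2r ?nnegrE.
rewrite sumr_const card_ord -[leLHS]mulr_natl exprMn; apply: ler_wpM2r; rewrite ?sqr_ge0//.
by rewrite -natrX ler_nat; case: (n) => // k; rewrite leq_pmulr.
Qed.

Lemma edZ (k : R) x y : ed (k *: x) (k *: y) = `|k| * ed x y.
Proof.
by rewrite !edE -scalerBr dotZl dotZr mulrA -expr2 sqrtrM ?sqr_ge0// sqrtr_sqr.
Qed.

Lemma ed0Z (k : R) x : ed 0 (k *: x) = `|k| * ed 0 x.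
Proof. by rewrite -edZ scaler0. Qed.

Lemma ed0B x y : ed 0 (y - x) = ed x y.
Proof. by rewrite -(edD 0 (y - x) x) add0r subrK. Qed.

Lemma ed_add x v : ed x (x + v) = ed 0 v.
Proof. by rewrite -{1}(addr0 x) edDl. Qed.

Definition seg x y (u : R) : 'rV[R]_n := x + u *: (y - x).

Lemma seg0 x y : seg x y 0 = x.
Proof. by rewrite /seg scale0r addr0. Qed.

Lemma seg1 x y : seg x y 1 = y.
Proof. by rewrite /seg scale1r addrC subrK. Qed.

Lemma ed_seg x y u v : ed (seg x y u) (seg x y v) = `|u - v| * ed x y.
Proof.
by rewrite (ed_sym x y) edDl !edE -scalerBl dotZl dotZr mulrA -expr2 sqrtrM ?sqr_ge0// sqrtr_sqr.
Qed.

Lemma ed_seg0 x y u : 0 <= u -> ed x (seg x y u) = u * ed x y.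
Proof. by move=> u0; rewrite -{1}(seg0 x y) ed_seg sub0r normrN ger0_norm. Qed.

Lemma ed_convex x y z u r : 0 <= u <= 1 -> ed x y < r -> ed x z < r ->
  ed x (seg y z u) < r.
Proof.
move=> /andP[u0 u1] xy xz.
apply: (@le_lt_trans _ _ ((1 - u) * ed x y + u * ed x z)).
  have -> : (1 - u) * ed x y = ed 0 ((1 - u) *: (y - x)).
    by rewrite ed0Z ed0B ger0_norm ?subr_ge0.
  have -> : u * ed x z = ed 0 (u *: (z - x)).
    by rewrite ed0Z ed0B ger0_norm.
  have -> : seg y z u = x + ((1 - u) *: (y - x) + u *: (z - x)).
    by apply/rowP => i; rewrite !mxE; ring.
  rewrite ed_add (le_trans (ed_triangle ((1 - u) *: (y - x)) _ _))// lerD2l.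
  by rewrite ed_add.
have [->|u'] := eqVneq u 0; first by rewrite subr0 mul1r mul0r addr0.
have : 0 < u by rewrite lt_neqAle eq_sym u'.
nra.
Qed.

End Dot.

(* Real induction: one hypothesis covers the initial, limit and successor steps. *)
Lemma real_ind (R : realType) (P : R -> Prop) :
  (forall t, 0 <= t <= 1 -> (forall s, 0 <= s < t -> P s) ->
     exists2 e, 0 < e & forall u, t <= u < t + e -> u <= 1 -> P u) ->
  forall t, 0 <= t <= 1 -> P t.
Proof.
move=> step.
pose A := [set t : R | 0 <= t <= 1 /\ forall s, 0 <= s <= t -> P s].
have A0 : A 0.
  split; first by rewrite lexx ler01.
  move=> s s0; have {s0}-> : s = 0 by apply/eqP; rewrite eq_le andbC.
  have [| |e e0 Pe] := step 0; first by rewrite lexx ler01.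
  - by move=> v /andP[v0 /(le_lt_trans v0)]; rewrite ltxx.
  - by apply: Pe; rewrite ?ler01// lexx add0r e0.
have Aub : has_ubound A by exists 1 => t [/andP[]].
have supA : has_sup A by split => //; exists 0.
have s0 : 0 <= sup A by exact: ub_le_sup.
have s1 : sup A <= 1 by apply: ge_sup; [exists 0 | move=> t [/andP[]]].
have Ps s : 0 <= s < sup A -> P s.
  move=> /andP[ss0 ssup].
  have d0 : 0 < sup A - s by rewrite subr_gt0.
  have [t [_ At] st] := sup_adherent d0 supA.
  by apply: At; rewrite ss0 /=; move: st; rewrite opprB addrC subrK => /ltW.
have [|e e0 Pe] := step (sup A) _ Ps; first by rewrite s0.
have PsupA u : 0 <= u <= Num.min 1 (sup A + e / 2) -> P u.
  rewrite le_min => /andP[u0 /andP[u1 ue]].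
  have [us|us] := ltP u (sup A); first by apply: Ps; rewrite u0.
  by apply: Pe => //; rewrite us (le_lt_trans ue)// ltrD2l; lra.
have : Num.min 1 (sup A + e / 2) <= sup A.
  apply: ub_le_sup => //; split=> // .
  by rewrite ge_min lexx le_min ler01 addr_ge0 ?divr_ge0// ltW.
rewrite ge_min => /orP[h|]; last by rewrite gerDl; lra.
move=> t /andP[t0 t1]; apply: PsupA; rewrite t0 le_min t1/=.
by apply: (le_trans t1); apply: (le_trans h); rewrite lerDl; lra.
Qed.

(** * Rigidity: distance-preserving maps are affine *)

Section Rigid.
Variables (R : realType) (n : nat).
Implicit Types (w z u v : 'rV[R]_n) (O : 'M[R]_n).
Local Notation ed := (@euclid_dist R n).

Lemma dot_mx u v : dot u v = (u *m v^T) 0 0.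
Proof. by rewrite mxE; apply: eq_bigr => i _; rewrite mxE. Qed.

Definition orthomx O := O *m O^T = 1%:M.

Lemma orthomxV O : orthomx O -> O^T *m O = 1%:M.
Proof. exact: mulmx1C. Qed.

Lemma orthomx_tr O : orthomx O -> orthomx O^T.
Proof. by rewrite /orthomx trmxK => /mulmx1C. Qed.

Lemma orthomxM O O' : orthomx O -> orthomx O' -> orthomx (O *m O').
Proof.
by rewrite /orthomx trmx_mul mulmxA -(mulmxA O) => hO ->; rewrite mulmx1.
Qed.

Lemma dot_orthomx O u v : orthomx O -> dot (u *m O) (v *m O) = dot u v.
Proof. by move=> hO; rewrite !dot_mx trmx_mul mulmxA -(mulmxA u) hO mulmx1. Qed.

Lemma ed_orthomx O u v : orthomx O -> ed (u *m O) (v *m O) = ed u v.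
Proof. by move=> hO; rewrite !edE -mulmxBl dot_orthomx. Qed.

Definition affm w0 z0 O w := z0 + (w - w0) *m O.

Lemma affm_center w0 z0 O : affm w0 z0 O w0 = z0.
Proof. by rewrite /affm subrr mul0mx addr0. Qed.

Lemma ed_affm w0 z0 O u v : orthomx O -> ed (affm w0 z0 O u) (affm w0 z0 O v) = ed u v.
Proof. by move=> hO; rewrite edDl ed_orthomx// edD. Qed.

Lemma affm_tr w0 z0 O w : orthomx O -> affm z0 w0 O^T (affm w0 z0 O w) = w.
Proof.
by move=> hO; rewrite /affm addrAC subrr add0r -mulmxA hO mulmx1 addrC subrK.
Qed.

Lemma affm_trV w0 z0 O w : orthomx O -> affm w0 z0 O (affm z0 w0 O^T w) = w.
Proof. by move=> hO; rewrite -{1}(trmxK O) affm_tr//; exact: orthomx_tr. Qed.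

(* S is large enough around w0 to determine an affine map. *)
Definition fat_at (S : set 'rV[R]_n) w0 :=
  S w0 /\ forall i, exists2 e : R, e != 0 & S (w0 + e *: delta_mx 0 i).

Lemma fat_ball w0 r : 0 < r -> fat_at [set w | ed w0 w < r] w0.
Proof.
move=> r0; split=> [|i]; first by rewrite /= edxx.
exists (r / 2) => /=; first by rewrite gt_eqF ?divr_gt0.
rewrite ed_add ed0Z gtr0_norm ?divr_gt0// edE sub0r dotNl dotNr opprK dot_delta.
by rewrite mxE !eqxx sqrtr1 mulr1; lra.
Qed.

Lemma polar a b c a' b' c' : ed a b = ed a' b' -> ed a c = ed a' c' ->
  ed b c = ed b' c' -> dot (b - a) (c - a) = dot (b' - a') (c' - a').
Proof.
move=> ab ac bc; move: (ed_sqr a b) (ed_sqr a c) (ed_sqr b c).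
rewrite ab ac bc !ed_sqr => {ab ac bc}.
have E (x y z : 'rV[R]_n) : dot (y - z) (y - z) =
  dot (x - y) (x - y) + dot (x - z) (x - z) - 2 * dot (y - x) (z - x).
  rewrite (_ : y - z = (y - x) - (z - x)); last by rewrite opprB addrA subrK.
  rewrite -(opprB y x) -(opprB z x); move: (y - x) (z - x) => p q.
  by rewrite !(dotE, dotBl, dotBr) (dotC q p); ring.
rewrite (E a b c) (E a' b' c') => -> ->; lra.
Qed.

(** Polarisation turns preserved distances into preserved inner products. The images of the
    coordinate directions thus form an orthonormal frame, the rows of [O], and [g w - g w0] is
    recovered from its products with this frame. *)
Lemma rigid (S : set 'rV[R]_n) (g : 'rV[R]_n -> 'rV[R]_n) w0 : fat_at S w0 ->
  (forall w w', S w -> S w' -> ed (g w) (g w') = ed w w') ->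
  exists2 O, orthomx O & forall w, S w -> g w = affm w0 (g w0) O w.
Proof.
move=> [Sw0 fat] gS.
have /choice[e Pe] : forall i, exists e : R, e != 0 /\ S (w0 + e *: delta_mx 0 i).
  by move=> i; have [e e0 Se] := fat i; exists e.
pose p i := g (w0 + e i *: delta_mx 0 i) - g w0.
pose O := \matrix_i ((e i)^-1 *: p i).
have P w w' : S w -> S w' -> dot (g w - g w0) (g w' - g w0) = dot (w - w0) (w' - w0).
  by move=> Sw Sw'; apply: polar; rewrite gS.
have rowO i : row i O = (e i)^-1 *: p i by rewrite rowK.
have mO w i : S w -> dot (g w - g w0) (row i O) = (w - w0) 0 i.
  move=> Sw; have [ei Si] := Pe i.
  by rewrite rowO dotZr P// addrAC subrr add0r dotZr mulrA mulVf// mul1r dot_delta.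
have mxO (x : 'rV[R]_n) i : (x *m O^T) 0 i = dot x (row i O).
  by rewrite mxE; apply: eq_bigr => k _; rewrite !mxE.
have hO : orthomx O.
  apply/row_matrixP => i; apply/rowP => j; rewrite row_mul mxO. rewrite (rowO i) dotZl.
  have [ei Si] := Pe i; rewrite mO// addrAC subrr add0r !mxE eqxx /=.
  by rewrite mulrA mulVf// mul1r eq_sym.
exists O => // w Sw; apply/eqP; rewrite /affm addrC -subr_eq; apply/eqP.
have {1}<- : (g w - g w0) *m O^T = w - w0 by apply/rowP => i; rewrite mxO mO.
by rewrite -mulmxA orthomxV// mulmx1.
Qed.

Lemma affm_inj (S : set 'rV[R]_n) w0 z0 O O' : fat_at S w0 ->
  (forall w, S w -> affm w0 z0 O w = affm w0 z0 O' w) -> O = O'.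
Proof.
move=> [_ fat] h; apply/row_matrixP => i; have [e e0 /h] := fat i.
rewrite /affm addrAC subrr add0r => /addrI; rewrite -!scalemxAl => /(scalerI e0).
by rewrite -!rowE.
Qed.

(** Subtracting the equation at [w0] from the one at a point on a coordinate axis cancels all
    quadratic terms and leaves one linear equation per coordinate. The constant [k] leaves room for
    a height that is not yet known. *)
Lemma trilateration (S : set 'rV[R]_n) w0 z0 O z z' k : fat_at S w0 -> orthomx O ->
  (forall w, S w -> ed z (affm w0 z0 O w) ^+ 2 = ed z' (affm w0 z0 O w) ^+ 2 + k) ->
  z = z'.
Proof.
move=> [Sw0 fat] hO h.
suff : (z - z') *m O^T = 0.
  move/(congr1 (mulmx^~ O)); rewrite mul0mx -mulmxA orthomxV// mulmx1.
  by move/eqP; rewrite subr_eq0 => /eqP.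
apply/rowP => i; have -> : ((z - z') *m O^T) 0 i = dot (z - z') (row i O).
  by rewrite mxE; apply: eq_bigr => j _; rewrite !mxE.
rewrite [RHS]mxE; have [e e0 Se] := fat i.
have := h _ Sw0; have := h _ Se; rewrite affm_center /affm addrAC subrr add0r.
rewrite -scalemxAl -rowE !ed_sqr !opprD !addrA.
have -> : z - z' = (z - z0) - (z' - z0) by rewrite opprB addrA subrK.
move: (z - z0) (z' - z0) (row i O) => a a' b.
rewrite !(dotE, dotBl, dotBr) (dotC b a) (dotC b a') => h1 h2.
by apply: (mulfI e0); rewrite mulr0; lra.
Qed.

Lemma isometry_affm (g : 'rV[R]_n -> 'rV[R]_n) :
  (forall w w', ed (g w) (g w') = ed w w') ->
  exists2 O, orthomx O & forall w, g w = g 0 + w *m O.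
Proof.
move=> gI; have [||O hO gO] := @rigid setT g 0.
- by split=> // i; exists 1; rewrite ?oner_neq0.
- by move=> *; exact: gI.
by exists O => // w; rewrite gO// /affm subr0.
Qed.

End Rigid.

(** * Local isometries of convex sets *)

Section LocIsom.
Variables (R : realType).

(* Equality case of the triangle inequality. *)
Lemma collinear n (x y z : 'rV[R]_n) (l a b : R) : 0 < a -> 0 <= b ->
  euclid_dist x y = l * a -> euclid_dist y z = l * b ->
  euclid_dist x z = l * (a + b) -> z - x = ((a + b) / a) *: (y - x).
Proof.
move=> a0 b0 xy yz xz.
have := ed_sqr z x; have := ed_sqr y x; have := ed_sqr z y.
rewrite !(ed_sym z) (ed_sym y x) xy yz xz.
rewrite (_ : z - x = (y - x) + (z - y)); last by rewrite [RHS]addrC subrKA.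
move: (y - x) (z - y) => p q qq pp pq.
have {}pq : dot p q = l ^+ 2 * (a * b).
  by move: pq; rewrite !dotE (dotC q p) -qq -pp => h; nra.
suff /dot_eq0/eqP : dot (b *: p - a *: q) (b *: p - a *: q) = 0.
  rewrite subr_eq0 => /eqP bpq; apply: (@scalerI _ _ a); first by rewrite gt_eqF.
  by rewrite scalerDr -bpq scalerA mulrC divfK ?gt_eqF// scalerDl.
by rewrite !(dotE, dotBl, dotBr) (dotC q p) pq -qq -pp; ring.
Qed.

Variables (n : nat) (Y : Type) (dY : Y -> Y -> R).
Local Notation ed := (@euclid_dist R n).

Definition loc_isom (X : set 'rV[R]_n) (E : 'rV[R]_n -> Y) :=
  forall w0, X w0 -> exists2 r, 0 < r & forall w w', X w -> X w' ->
    ed w0 w < r -> ed w0 w' < r -> dY (E w) (E w') = ed w w'.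

Definition convex_set (X : set 'rV[R]_n) :=
  forall w w' u, X w -> X w' -> 0 <= u <= 1 -> X (seg w w' u).

Lemma loc_isomS (X X' : set 'rV[R]_n) E : X' `<=` X -> loc_isom X E -> loc_isom X' E.
Proof.
move=> XX h w0 /XX/h[r r0 H]; exists r => // w w' /XX Xw /XX Xw'; exact: H.
Qed.

Lemma loc_isom_seg X E w w' : convex_set X -> loc_isom X E -> X w -> X w' ->
  forall t, 0 <= t <= 1 -> exists2 e, 0 < e & forall u v, 0 <= u <= 1 -> 0 <= v <= 1 ->
    `|t - u| < e -> `|t - v| < e ->
    dY (E (seg w w' u)) (E (seg w w' v)) = `|u - v| * ed w w'.
Proof.
move=> cX lE Xw Xw' t t01; have [r r0 H] := lE _ (cX _ _ _ Xw Xw' t01).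
have d0 : 0 < 1 + ed w w' by rewrite ltr_wpDr ?ed_ge0.
have near u : `|t - u| < r / (1 + ed w w') -> ed (seg w w' t) (seg w w' u) < r.
  move=> tu; rewrite ed_seg.
  have : `|t - u| * (1 + ed w w') < r by rewrite -ltr_pdivlMr.
  by apply: le_lt_trans; rewrite ler_wpM2l// lerDr.
exists (r / (1 + ed w w')); first by rewrite divr_gt0.
by move=> u v u01 v01 tu tv; rewrite H; [exact: ed_seg|exact: cX|exact: cX|exact: near|exact: near].
Qed.

Lemma loc_isom_lip (dY0 : forall y, dY y y = 0)
    (dYt : forall y x z, dY x z <= dY x y + dY y z) X E w w' :
  convex_set X -> loc_isom X E -> X w -> X w' -> dY (E w) (E w') <= ed w w'.
Proof.
move=> cX lE Xw Xw'.
suff H : forall t, 0 <= t <= 1 -> dY (E w) (E (seg w w' t)) <= t * ed w w'.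
  by have := H 1; rewrite seg1 mul1r => -> //; rewrite ler01 lexx.
apply: real_ind => t t01 IH.
have [e e0 He] := loc_isom_seg cX lE Xw Xw' t01; move/andP: (t01) => [t0 t1].
exists e => // u /andP[tu ue] u1.
have u01 : 0 <= u <= 1 by rewrite u1 (le_trans t0).
have tue : `|t - u| < e by rewrite distrC ger0_norm ?subr_ge0// ltrBlDl.
have [t_0|tn0] := eqVneq t 0.
  have {1}-> : w = seg w w' t by rewrite t_0 seg0.
  by rewrite He// ?subrr ?normr0// t_0 sub0r normrN ger0_norm// (le_trans t0).
have tp : 0 < t by rewrite lt_neqAle eq_sym tn0.
(* The induction hypothesis stops short of [t], so the path is cut at a point [b] before [t] that
   lies in the same neighbourhood as [u]. *)
pose b := Num.max 0 (t - e / 2).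
have bt : 0 <= b < t.
  by rewrite le_max lexx gt_max tp /= ltrBlDr ltrDl divr_gt0.
have /andP[b0 b1] := bt.
have eb : t - e / 2 <= b by rewrite le_max lexx orbT.
rewrite (le_trans (dYt (E (seg w w' b)) _ _))//.
rewrite (_ : u * _ = b * ed w w' + (u - b) * ed w w'); last by ring.
rewrite lerD ?IH// He//.
- by rewrite distrC ger0_norm// subr_ge0; lra.
- by lra.
- by rewrite ger0_norm; lra.
Qed.

End LocIsom.

(** Equality in the triangle inequality makes each short piece straight, and overlapping pieces
    share their velocity; real induction spreads the velocity [V] of the first piece over the whole
    curve. *)
Lemma loc_isom_curve (R : realType) k (h : R -> 'rV[R]_k) (l : R) :
  (forall t, 0 <= t <= 1 -> exists2 e, 0 < e & forall u v, 0 <= u -> u <= v -> v <= 1 ->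
     `|t - u| < e -> `|t - v| < e -> euclid_dist (h u) (h v) = l * (v - u)) ->
  euclid_dist (h 0) (h 1) = l.
Proof.
move=> He.
have Hc a b c : 0 <= a -> a < b -> b <= c -> c <= 1 ->
    euclid_dist (h a) (h b) = l * (b - a) ->
    euclid_dist (h b) (h c) = l * (c - b) ->
    euclid_dist (h a) (h c) = l * (c - a) ->
    h c - h a = ((c - a) / (b - a)) *: (h b - h a).
  move=> a0 ab bc c1 hab hbc hac.
  have := @collinear R k (h a) (h b) (h c) l (b - a) (c - b).
  rewrite subr_gt0 subr_ge0 ab bc (_ : b - a + (c - b) = c - a); last by ring.
  by apply.
have [|e e0 {}He0] := He 0; first by rewrite lexx ler01.
pose a := Num.min 1 (e / 2).
have a0 : 0 < a by rewrite lt_min ltr01 divr_gt0.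
have a1 : a <= 1 by rewrite ge_min lexx.
have ae : a < e by rewrite gt_min; apply/orP; right; lra.
have aN u : 0 <= u <= a -> `|0 - u| < e.
  by move=> /andP[u0 ua]; rewrite sub0r normrN ger0_norm//; exact: le_lt_trans ae.
pose V := a^-1 *: (h a - h 0).
have VE t : 0 <= t <= 1 -> h t = h 0 + t *: V.
  move: t; apply: real_ind => t t01 IH; have /andP[t0 t1] := t01.
  have [t_0|tn0] := eqVneq t 0.
    exists a => // u; rewrite t_0 add0r => /andP[u0 ua] u1.
    have [->|un0] := eqVneq u 0; first by rewrite scale0r addr0.
    have up : 0 < u by rewrite lt_neqAle eq_sym un0.
    have hu : euclid_dist (h 0) (h u) = l * (u - 0).
      by apply: He0 => //; try apply: aN; try (apply/andP; split); clear -u0 ua a0 a1 up; lra.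
    have ha : euclid_dist (h 0) (h a) = l * (a - 0).
      by apply: He0 => //; try apply: aN; try (apply/andP; split); clear -u0 ua a0 a1 up; lra.
    have hua : euclid_dist (h u) (h a) = l * (a - u).
      by apply: He0 => //; try apply: aN; try (apply/andP; split); clear -u0 ua a0 a1 up; lra.
    have := Hc _ _ _ (lexx 0) up (ltW ua) a1 hu hua ha; rewrite !subr0 => E1.
    rewrite /V E1.
    rewrite !scalerA (_ : u / a * (a / u) = 1) ?scale1r; first by rewrite addrC subrK.
    by field; rewrite !gt_eqF.
  have [e1 e10 He1] := He t t01.
  have tp : 0 < t by rewrite lt_neqAle eq_sym tn0.
  pose d := Num.min t e1 / 2.
  have d0 : 0 < d by rewrite divr_gt0// lt_min tp.
  have dt : d <= t / 2 by rewrite ler_pM2r// ge_min lexx.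
  have de : d <= e1 / 2 by rewrite ler_pM2r// ge_min lexx orbT.
  exists d => // u /andP[tu ud] u1.
  have near x : t - d <= x -> x <= t + d -> `|t - x| < e1.
    by move=> x1 x2; rewrite ltr_norml; apply/andP; clear -x1 x2 d0 de; split; lra.
  have [xa xb xu] : [/\ 0 <= t - d, t - d < t - d / 2 & t - d / 2 <= u] by clear -d0 dt tu tp; split; lra.
  have hxa := IH (t - d); have hxb := IH (t - d / 2).
  have {hxa}hxa : h (t - d) = h 0 + (t - d) *: V by apply: hxa; rewrite xa; clear -d0; lra.
  have {hxb}hxb : h (t - d / 2) = h 0 + (t - d / 2) *: V by apply: hxb; rewrite (le_trans xa (ltW xb)); clear -d0; lra.
  have na : `|t - (t - d)| < e1 by apply: near; clear -d0; lra.
  have nb : `|t - (t - d / 2)| < e1 by apply: near; clear -d0; lra.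
  have nu : `|t - u| < e1 by apply: near; clear -d0 tu ud; lra.
  have b1 : t - d / 2 <= 1 by clear -d0 t1; lra.
  have b0 : 0 <= t - d / 2 by exact: le_trans xa (ltW xb).
  (* Two parameters before [t] already lie on the line, and collinearity places [h u] on it as
     well. *)
  have := Hc _ _ _ xa xb xu u1 (He1 _ _ xa (ltW xb) b1 na nb) (He1 _ _ b0 xu u1 nb nu)
    (He1 _ _ xa (le_trans (ltW xb) xu) u1 na nu).
  rewrite hxa hxb => /(canRL (subrK _)) ->.
  apply/rowP => k'; clear -d0; move: (h 0) V => h0 V'; rewrite !mxE; field; apply/eqP; lra.
have : euclid_dist (h 0) (h a) = l * (a - 0) by rewrite He0//; try apply: aN; try (apply/andP; split); clear -a0; lra.
rewrite (VE a) ?a1 ?ltW// ed_add ed0Z gtr0_norm// subr0 [RHS]mulrC => /(mulfI _) VL.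
by rewrite (VE 1) ?ler01 ?lexx// scale1r ed_add VL// gt_eqF.
Qed.

Lemma loc_isom_euclid (R : realType) n k (X : set 'rV[R]_n) (E : 'rV[R]_n -> 'rV[R]_k) w w' :
  convex_set X -> loc_isom (@euclid_dist R k) X E -> X w -> X w' ->
  euclid_dist (E w) (E w') = euclid_dist w w'.
Proof.
move=> cX lE Xw Xw'.
rewrite -[in LHS](seg0 w w') -[X in euclid_dist _ (E X) = _](seg1 w w').
apply: (@loc_isom_curve _ _ (fun u => E (seg w w' u))) => t t01.
have [e e0 H] := loc_isom_seg cX lE Xw Xw' t01; exists e => // u v u0 uv v1 tu tv.
rewrite H//.
- by rewrite distrC ger0_norm 1?mulrC// subr_ge0.
- by rewrite u0 (le_trans uv).
- by rewrite v1 (le_trans u0).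
Qed.

(** * Half-spaces and slabs *)

Section Clamp.
Variables (R : realType) (a b : R).
Hypothesis ab : a <= b.

(** The retraction onto [[a, b]]: composing with it turns a map that matters only on an interval or
    a slab into a total one. *)
Definition clamp (t : R) : R := Num.max a (Num.min b t).

Lemma clamp_bound t : a <= clamp t <= b.
Proof. by rewrite le_max lexx ge_max ab ge_min lexx. Qed.

Lemma clamp_id t : a <= t <= b -> clamp t = t.
Proof. by move=> /andP[t1 t2]; rewrite /clamp min_r// max_r. Qed.

Lemma clamp_lip s t : `|clamp s - clamp t| <= `|s - t|.
Proof.
have H x y : x <= y -> 0 <= clamp y - clamp x <= y - x.
  have ab' := ab; rewrite /clamp !maxEle !minEle => xy.
  by case: (leP b x) => h1; case: (leP b y) => h2; rewrite ?ab;
    case: (leP a x) => h3; case: (leP a y) => h4; apply/andP; split; lra.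
have [st|/ltW ts] := leP s t.
  have /andP[h1 h2] := H _ _ st.
  by rewrite distrC (distrC s) !ger0_norm// subr_ge0.
by have /andP[h1 h2] := H _ _ ts; rewrite !ger0_norm// subr_ge0.
Qed.

End Clamp.

Section Height.
Variables (R : realType) (m : nat).
Implicit Types (w z v : 'rV[R]_m.+1) (x y : 'rV[R]_m).

Definition ht w : R := w 0 ord_max.
Definition base w : 'rV[R]_m := \row_i w 0 (lift ord_max i).
Definition pt x (t : R) : 'rV[R]_m.+1 :=
  \row_j if unlift ord_max j is Some i then x 0 i else t.

Lemma ht_pt x t : ht (pt x t) = t.
Proof. by rewrite /ht mxE unlift_none. Qed.

Lemma base_pt x t : base (pt x t) = x.
Proof. by apply/rowP => i; rewrite !mxE liftK. Qed.

Lemma pt_eta w : pt (base w) (ht w) = w.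
Proof. by apply/rowP => j; rewrite !mxE; case: unliftP => [k|] ->; rewrite ?mxE. Qed.

Lemma htD w v : ht (w + v) = ht w + ht v. Proof. exact: mxE. Qed.
Lemma htN w : ht (- w) = - ht w. Proof. exact: mxE. Qed.
Lemma htB w v : ht (w - v) = ht w - ht v. Proof. by rewrite htD htN. Qed.
Lemma htZ k w : ht (k *: w) = k * ht w. Proof. exact: mxE. Qed.

Lemma ht_seg w v u : ht (seg w v u) = ht w + u * (ht v - ht w).
Proof. by rewrite /seg htD htZ htB. Qed.

Lemma ptB x y s t : pt (x - y) (s - t) = pt x s - pt y t.
Proof. by apply/rowP => j; rewrite !mxE; case: unliftP => [k|] _; rewrite ?mxE. Qed.

Lemma dot_pt x y s t : dot (pt x s) (pt y t) = dot x y + s * t.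
Proof.
rewrite /dot (bigD1_ord ord_max)//= !mxE unlift_none addrC; congr (_ + _).
by apply: eq_bigr => i _; rewrite !mxE liftK.
Qed.

Lemma ed_pt_sqr x y s t : euclid_dist (pt x s) (pt y t) ^+ 2 = euclid_dist x y ^+ 2 + (s - t) ^+ 2.
Proof. by rewrite !ed_sqr -ptB dot_pt -expr2. Qed.

Lemma ed_pt x y t : euclid_dist (pt x t) (pt y t) = euclid_dist x y.
Proof. by rewrite !edE -ptB dot_pt subrr mulr0 addr0. Qed.

Lemma ed_pt_ht x s t : euclid_dist (pt x s) (pt x t) = `|s - t|.
Proof. by rewrite edE -ptB dot_pt subrr dot0l add0r -expr2 sqrtr_sqr. Qed.

Lemma ed_base w v : euclid_dist (base w) (base v) <= euclid_dist w v.
Proof.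
rewrite -(@ler_pXn2r _ 2)// ?nnegrE ?ed_ge0//.
by rewrite -{2}(pt_eta w) -{2}(pt_eta v) ed_pt_sqr lerDl sqr_ge0.
Qed.

Lemma ed_ht w v : `|ht w - ht v| <= euclid_dist w v.
Proof. exact: ed_coord. Qed.

Definition dom (J : set R) := [set w | J (ht w)].

(** The first condition makes [dom J] convex; the second, absence of isolated points, makes it fat
    at each of its points, including those on its faces. *)
Definition thick (J : set R) :=
  (forall a b c, J a -> J c -> a <= b <= c -> J b) /\
  forall t e, J t -> 0 < e -> exists2 d, d != 0 & `|d| < e /\ J (t + d).

Lemma dom_convex J : thick J -> convex_set (dom J).
Proof.
move=> [cJ _] w w' u Jw Jw' /andP[u0 u1]; rewrite /dom /= ht_seg.
have [h|h] := leP (ht w) (ht w').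
  by apply: (cJ (ht w) _ (ht w')) => //; apply/andP; split; nra.
by apply: (cJ (ht w') _ (ht w)) => //; apply/andP; split; nra.
Qed.

Lemma ed_delta (w : 'rV[R]_m.+1) (e : R) i :
  euclid_dist w (w + e *: delta_mx 0 i) = `|e|.
Proof.
rewrite ed_add ed0Z edE sub0r dotNl dotNr opprK dot_delta mxE !eqxx.
by rewrite sqrtr1 mulr1.
Qed.

Lemma ht_delta i : ht (delta_mx 0 i) = (ord_max == i)%:R.
Proof. by rewrite /ht mxE eqxx. Qed.

Lemma dom_fat J w r : thick J -> dom J w -> 0 < r ->
  fat_at (dom J `&` [set v | euclid_dist w v < r]) w.
Proof.
move=> [_ fJ] Jw r0; split=> [|i]; first by split=> //=; rewrite edxx.
have [->|im] := eqVneq i ord_max.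
  have [d d0 [dr Jd]] := fJ _ _ Jw r0; exists d => //.
  by rewrite /dom; split=> /=; rewrite ?ed_delta// htD htZ ht_delta eqxx mulr1.
exists (r / 2); first by rewrite gt_eqF ?divr_gt0.
rewrite /dom; split=> /=; last by rewrite ed_delta gtr0_norm ?divr_gt0//; lra.
by rewrite htD htZ ht_delta eq_sym (negPf im) mulr0 addr0.
Qed.

Lemma thick_co (s : R) : 0 < s -> thick [set t | 0 <= t < s].
Proof.
move=> s0; split=> [a b c /= /andP[a0 _] /andP[_ cs] /andP[ab bc]|t e /= /andP[t0 ts] e0].
  by rewrite (le_trans a0)// (le_lt_trans bc).
pose d := Num.min e (s - t) / 2.
have d0 : 0 < d by rewrite divr_gt0// lt_min e0 subr_gt0.
have de : d <= e / 2 by rewrite ler_pM2r// ge_min lexx.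
have dt : d <= (s - t) / 2 by rewrite ler_pM2r// ge_min lexx orbT.
exists d; rewrite ?gt_eqF// gtr0_norm//; split; first lra.
by apply/andP; split; lra.
Qed.

Lemma thick_cc (s : R) : 0 < s -> thick [set t | 0 <= t <= s].
Proof.
move=> s0; split=> [a b c /= /andP[a0 _] /andP[_ cs] /andP[ab bc]|t e /= /andP[t0 ts] e0].
  by rewrite (le_trans a0)// (le_trans bc).
pose d := Num.min e s / 2.
have d0 : 0 < d by rewrite divr_gt0// lt_min e0.
have de : d <= e / 2 by rewrite ler_pM2r// ge_min lexx.
have dt : d <= s / 2 by rewrite ler_pM2r// ge_min lexx orbT.
have [h|h] := leP t (s / 2).
  exists d; rewrite ?gt_eqF// gtr0_norm//; split; first lra.
  by apply/andP; split; lra.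
exists (- d); rewrite ?oppr_eq0 ?gt_eqF// normrN gtr0_norm//; split; first lra.
by apply/andP; split; lra.
Qed.

Lemma thick_ge0 : thick [set t : R | 0 <= t].
Proof.
split=> [a b c /= a0 _ /andP[ab _]|t e /= t0 e0]; first exact: le_trans ab.
exists (e / 2); first by rewrite gt_eqF ?divr_gt0.
by rewrite gtr0_norm ?divr_gt0//; split; lra.
Qed.

(* An affine isometry maps a half-ball with centre on the bounding hyperplane
   into a half-space, its centre going to the bounding hyperplane, only if it
   matches the two hyperplanes. *)
Lemma ht_affm (O : 'M[R]_m.+1) w0 z0 (s r : R) : orthomx O -> s ^+ 2 = 1 ->
  0 < r -> ht z0 = 0 ->
  (forall w, 0 <= s * (ht w - ht w0) -> euclid_dist w0 w < r -> 0 <= ht (affm w0 z0 O w)) ->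
  forall w, ht (affm w0 z0 O w) = s * (ht w - ht w0).
Proof.
move=> hO s1 r0 hz0 h.
(* [nu] is the gradient of the height of the image. Horizontal moves in both directions stay in the
   half-ball, so its horizontal components vanish; being a unit vector, it is then vertical, with
   sign [s]. *)
pose nu : 'rV[R]_m.+1 := row ord_max O^T.
have htO v : ht (v *m O) = dot v nu.
  by rewrite /ht mxE; apply: eq_bigr => k _; rewrite !mxE.
have nu1 : dot nu nu = 1.
  by rewrite /nu rowE dot_orthomx ?dot_delta ?mxE ?eqxx//; exact: orthomx_tr.
have hd e i : `|e| < r -> 0 <= s * (e * (ord_max == i)%:R) -> 0 <= e * nu 0 i.
  move=> er se; have := h (w0 + e *: delta_mx 0 i).
  rewrite ed_delta htD htZ ht_delta [X in 0 <= s * X]addrAC subrr add0r => /(_ se er).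
  by rewrite /affm htD hz0 add0r htO addrAC subrr add0r dotZl dotC dot_delta.
have nui i : i != ord_max -> nu 0 i = 0.
  move=> im; apply/eqP; rewrite eq_le.
  have := hd (r / 2) i; have := hd (- (r / 2)) i.
  rewrite eq_sym (negPf im) !mulr0 lexx normrN gtr0_norm ?divr_gt0// => h1 h2.
  by apply/andP; split; [have := h1 ltac:(lra) isT | have := h2 ltac:(lra) isT]; nra.
have nus : nu = s *: delta_mx 0 ord_max.
  apply/rowP => i; rewrite [in RHS]mxE [in RHS]mxE eqxx.
  have [->|/nui->] := eqVneq i ord_max; last by rewrite mulr0.
  rewrite mulr1.
  have n1 : nu 0 ord_max ^+ 2 = 1.
    rewrite -[RHS]nu1 /dot (bigD1 ord_max)//= big1 ?addr0 ?expr2// => j /nui ->.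
    by rewrite mul0r.
  have := hd (s * (r / 2)) ord_max.
  rewrite eqxx mulr1 [X in 0 <= X -> _]mulrA -expr2 s1 mul1r => h1.
  have sr : `|s * (r / 2)| < r.
    rewrite -(@ltr_pXn2r _ 2)// ?nnegrE// ?ltW// real_normK ?num_real// exprMn s1; nra.
  have {}h1 := h1 sr ltac:(lra).
  have : (s - nu 0 ord_max) * (s + nu 0 ord_max) = 0 by rewrite -subr_sqr s1 n1 subrr.
  by move/eqP; rewrite mulf_eq0 => /orP[] /eqP; nra.
move=> w; rewrite /affm htD hz0 add0r htO nus dotZr dot_delta.
by rewrite !mxE.
Qed.

End Height.

(** * Half-space charts *)

Section Charts.
Variables (R : realType) (m : nat) (M : metricType R).
Local Notation md := (@mdist R M).
Local Notation chart := (isometric_chart md (@half_space R m)).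
Local Notation ed := (@euclid_dist R m.+1).
Local Notation bd := (manifold_boundary m M).
Implicit Types (p q : M) (r : R) (c : M -> 'rV[R]_m.+1).

Lemma chart_gt0 p r c : chart p r c -> 0 < r. Proof. by case. Qed.

Lemma chart_dist p r c q q' : chart p r c -> md p q < r -> md p q' < r ->
  ed (c q) (c q') = md q q'.
Proof. by case=> _ h _; exact: h. Qed.

Lemma chart_center_dist p r c q : chart p r c -> md p q < r -> ed (c p) (c q) = md p q.
Proof. by move=> h pq; rewrite (chart_dist h)// mdistxx (chart_gt0 h). Qed.

Lemma chart_ht p r c q : chart p r c -> md p q < r -> 0 <= ht (c q).
Proof.
move=> [_ _ cE] pq; have : (c @` [set x | md p x < r]) (c q) by exists q.
by rewrite cE => -[].
Qed.

Lemma chart_surj p r c z : chart p r c -> 0 <= ht z -> ed (c p) z < r ->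
  exists2 q, md p q < r & c q = z.
Proof.
move=> [_ _ cE] z0 zr.
have : (c @` [set x | md p x < r]) z by rewrite cE; split.
by case=> q pq <-; exists q.
Qed.

Lemma chart_inj p r c q q' : chart p r c -> md p q < r -> md p q' < r ->
  c q = c q' -> q = q'.
Proof.
move=> h pq pq' cq; apply: mdist_positivity.
by rewrite -(chart_dist h pq pq') cq edxx.
Qed.

Lemma chart_sub p r c q s : chart p r c -> 0 < s -> s <= r - md p q -> chart q s c.
Proof.
move=> h s0 sr.
have pq : md p q < r by rewrite -subr_gt0 (lt_le_trans s0).
have sub x : md q x < s -> md p x < r.
  move=> qx; rewrite (le_lt_trans (metric_triangle p q x))//.
  by rewrite -ltrBrDl (lt_le_trans qx).
split=> //; first by move=> x y /sub px /sub py; exact: (chart_dist h).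
apply/seteqP; split=> [z [x qx <-]|z [z0 zs]].
  by split; [exact: chart_ht (sub _ qx) | rewrite /= (chart_dist h)//; exact: sub].
have [||x px cx] := chart_surj (z := z) h; first exact: z0.
  rewrite (le_lt_trans (ed_triangle (c q) _ _))// (chart_center_dist h)//.
  by rewrite -ltrBrDl (lt_le_trans zs).
by exists x => //=; rewrite -(chart_dist h pq px) cx.
Qed.

Lemma chart_shrink p r c s : chart p r c -> 0 < s -> s <= r -> chart p s c.
Proof. by move=> h s0 sr; apply: (chart_sub h s0); rewrite mdistxx subr0. Qed.

(* The two charts differ by an isometry, which cannot map a full ball into a
   half-space with its centre on the boundary. *)
Lemma chart_boundary0 p r c : bd p -> chart p r c -> ht (c p) = 0.
Proof.
move=> [r' [c' [h' c'p]]] h; apply/eqP; rewrite eq_le.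
have pp : md p p < r by rewrite mdistxx (chart_gt0 h).
rewrite (chart_ht h pp) andbT leNgt; apply/negP => cp.
pose s := Num.min (ht (c p)) (Num.min r r').
have s0 : 0 < s by rewrite !lt_min cp (chart_gt0 h) (chart_gt0 h').
have inv z : ed (c p) z < s -> exists2 q, md p q < s & c q = z.
  rewrite !lt_min => /andP[z1 /andP[z2 z3]].
  have [||q pq cq] := chart_surj (z := z) h => //.
    have := le_lt_trans (ed_ht (c p) z) z1; rewrite ltr_norml => /andP[_]; lra.
  by exists q => //; rewrite -(chart_center_dist h pq) cq !lt_min z1 z2 z3.
have sr q : md p q < s -> md p q < r /\ md p q < r'.
  by rewrite !lt_min => /andP[_ /andP[]].
have /choice[g Pg] : forall z, exists q, ed (c p) z < s -> md p q < s /\ c q = z.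
  move=> z; have [/inv[q pq cq]|_] := ltP (ed (c p) z) s; last by exists p.
  by exists q.
have gp : g (c p) = p.
  have [|/sr[h1 _] h2] := Pg (c p); first by rewrite edxx.
  exact: (chart_inj h).
have [|w w' ws ws'|O hO gO] := @rigid R m.+1 [set z | ed (c p) z < s] (c' \o g) (c p).
- exact: fat_ball.
- have [/sr[w1 w1'] w2] := Pg _ ws; have [/sr[w3 w3'] w4] := Pg _ ws'.
  by rewrite /= (chart_dist h')// -(chart_dist h)// w2 w4.
(* On a full ball [ht_affm] applies with both signs, and the two resulting formulas contradict each
   other. *)
have H (e : R) : e ^+ 2 = 1 -> forall w,
    ht (affm (c p) (c' p) O w) = e * (ht w - ht (c p)).
  move=> e1; apply: (ht_affm (r := s)) => // w _ ws.
  have := gO w ws; rewrite /= gp => <-; have [/sr[_ w1] _] := Pg _ ws.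
  exact: (chart_ht h').
have := H 1 (expr1n _ _) (c p + delta_mx 0 ord_max).
rewrite (H (-1)) ?sqrrN ?expr1n// htD ht_delta eqxx mulr1n.
move: (ht _) => h0; lra.
Qed.

Lemma chart_boundary p r c q : chart p r c -> md p q < r -> bd q <-> ht (c q) = 0.
Proof.
move=> h pq; have h' : chart q (r - md p q) c by apply: (chart_sub h); rewrite ?subr_gt0.
by split=> [bq|cq]; [exact: chart_boundary0 bq h' | exists (r - md p q), c].
Qed.

End Charts.

(** A Lebesgue number argument, with the filter of small positive radii as the parameter in the
    covering form of compactness. *)
Lemma compact_uniform (R : realType) (T : pseudoMetricType R) (K : set T)
    (P : T -> R -> Prop) : compact K ->
  (forall x, K x -> exists r s, [/\ 0 < r, 0 < s & forall y, ball x s y -> P y r]) ->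
  (forall x r r', r' <= r -> P x r -> P x r') ->
  exists2 r, 0 < r & forall x, K x -> P x r.
Proof.
move=> /compact_near_coveringP cK loc mono.
have /(_ _ _) := cK R (0^'+) (fun r x => P x r).
case=> [x /loc[r [s [r0 s0 h]]]|d /= d0 h].
  exists (ball x s, [set r' | 0 < r' < r]) => /=.
    split; first exact: nbhsx_ballx.
    exists r => //= r' /=; rewrite sub0r normrN => r'r r'0.
    by rewrite r'0 -[ltLHS]gtr0_norm.
  move=> [y r'] /= [xy /andP[r'0 r'r]].
  by apply: (mono _ r); [exact: ltW | exact: h].
exists (d / 2); first by rewrite divr_gt0.
apply: h => /=; last by rewrite divr_gt0.
by rewrite sub0r normrN gtr0_norm ?divr_gt0//; lra.
Qed.

(** * Developing maps on slabs *)

(** The image of the vertical unit vector has height 1 and norm 1, which leaves nothing for its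
    horizontal part. *)
Lemma ht_preserving (R : realType) (m : nat) (O : 'M[R]_m.+1) : orthomx O ->
  (forall v, ht (v *m O) = ht v) -> (delta_mx 0 ord_max : 'rV[R]_m.+1) *m O = delta_mx 0 ord_max.
Proof.
move=> hO h; set q := _ *m O.
have hq : ht q = 1 by rewrite h ht_delta eqxx.
have : dot q q = 1 by rewrite dot_orthomx// dot_delta mxE !eqxx.
rewrite -(pt_eta q) dot_pt hq mulr1 => /(canRL (addrK _)); rewrite subrr => /dot_eq0 ->.
by apply/rowP => j; rewrite !mxE eqxx; case: unliftP => [k|] ->;
  rewrite ?mxE ?eqxx// eq_sym (negPf (neq_lift _ _)).
Qed.

Section Developing.
Variables (R : realType) (m : nat) (M : metricType R).
Local Notation md := (@mdist R M).
Local Notation chart := (isometric_chart md (@half_space R m)).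
Local Notation ed := (@euclid_dist R m.+1).
Local Notation bd := (manifold_boundary m M).
Implicit Types (p q : M) (J : set R) (E : 'rV[R]_m.+1 -> M) (c : M -> 'rV[R]_m.+1).

Lemma isom_lip J E w w' : thick J -> loc_isom md (dom J) E -> dom J w -> dom J w' ->
  md (E w) (E w') <= ed w w'.
Proof.
move=> tJ lE; apply: loc_isom_lip lE; [exact: mdistxx|by move=> *; exact: metric_triangle|exact: dom_convex].
Qed.

(** The points of the slab within [r] of [w0] form a convex set, on which the chart reads [E] as a
    local isometry between Euclidean spaces, hence as an affine one. The unknown local radius of [E]
    is thus replaced by the chart radius. *)
Lemma isom_chart J E w0 r c : thick J -> loc_isom md (dom J) E -> dom J w0 ->
  chart (E w0) r c -> exists2 O, orthomx O &
    forall w, dom J w -> ed w0 w < r -> md (E w0) (E w) < r /\ c (E w) = affm w0 (c (E w0)) O w.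
Proof.
move=> tJ lE Jw0 h; have r0 := chart_gt0 h.
have near w : dom J w -> ed w0 w < r -> md (E w0) (E w) < r.
  by move=> Jw; apply: le_lt_trans; exact: isom_lip lE _ _.
pose X := dom J `&` [set w | ed w0 w < r].
have cX : convex_set X.
  move=> w w' u [Jw wr] [Jw' wr'] u01; split; first exact: dom_convex.
  exact: ed_convex.
have lc : loc_isom ed X (c \o E).
  move=> w [Jw wr]; have [s s0 H] := lE w Jw; exists s => // v v' [Jv vr] [Jv' vr'] vs vs'.
  by rewrite /= (chart_dist h) ?near// H.
have [||O hO gO] := @rigid R m.+1 X (c \o E) w0.
- exact: dom_fat.
- by move=> w w' Xw Xw'; exact: (loc_isom_euclid cX).
exists O => // w Jw wr; split; first exact: near.
exact: gO.
Qed.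

Lemma isom_unif J E w0 r w w' : thick J -> loc_isom md (dom J) E -> dom J w0 ->
  (exists c, chart (E w0) r c) -> dom J w -> dom J w' -> ed w0 w < r -> ed w0 w' < r ->
  md (E w) (E w') = ed w w'.
Proof.
move=> tJ lE Jw0 [c h] Jw Jw' wr wr'.
have [ O hO H] := isom_chart tJ lE Jw0 h.
have [w1 w2] := H _ Jw wr; have [w1' w2'] := H _ Jw' wr'.
by rewrite -(chart_dist h)// w2 w2' ed_affm.
Qed.

(* The sign s tells on which side of the height of w0 the slab lies. *)
Lemma isom_ht J E w0 r c (O : 'M[R]_m.+1) (s e : R) :
  thick J -> loc_isom md (dom J) E -> dom J w0 -> chart (E w0) r c -> orthomx O ->
  (forall w, dom J w -> ed w0 w < r -> md (E w0) (E w) < r /\ c (E w) = affm w0 (c (E w0)) O w) ->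
  bd (E w0) -> s ^+ 2 = 1 -> 0 < e ->
  (forall t, `|t - ht w0| < e -> 0 <= s * (t - ht w0) -> J t) ->
  forall w, ht (affm w0 (c (E w0)) O w) = s * (ht w - ht w0).
Proof.
move=> tJ lE Jw0 h hO H bw0 s1 e0 HJ; apply: (ht_affm (r := Num.min e r)) => //.
- by rewrite lt_min e0 (chart_gt0 h).
- exact: chart_boundary0 bw0 h.
move=> w sw; rewrite lt_min => /andP[we wr].
have Jw : dom J w.
  by apply: HJ => //; rewrite (le_lt_trans _ we)// distrC; exact: ed_ht.
by have [w1 <-] := H w Jw wr; exact: chart_ht h _.
Qed.

Lemma isom_interior J E w0 e : thick J -> loc_isom md (dom J) E -> 0 < e ->
  (forall t, `|t - ht w0| < e -> J t) -> (exists r c, chart (E w0) r c) -> ~ bd (E w0).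
Proof.
move=> tJ lE e0 HJ [r [c h]] bw0.
have Jw0 : dom J w0 by apply: HJ; rewrite subrr normr0.
have [ O hO H] := isom_chart tJ lE Jw0 h.
have K s : s ^+ 2 = 1 -> forall w, ht (affm w0 (c (E w0)) O w) = s * (ht w - ht w0).
  by move=> s1; apply: (isom_ht tJ lE Jw0 h hO H bw0 s1 e0) => t te _; exact: HJ.
have := K 1 (expr1n _ _) (w0 + delta_mx 0 ord_max).
rewrite (K (-1)) ?sqrrN ?expr1n// htD ht_delta eqxx mulr1n.
move: (ht _) => h0; lra.
Qed.

Variable r : R.
Hypothesis charts : forall p, exists c, chart p r c.

Lemma isom_unique J E1 E2 w0 (rho : R) : thick J ->
  loc_isom md (dom J) E1 -> loc_isom md (dom J) E2 -> dom J w0 -> 0 < rho ->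
  (forall w, dom J w -> ed w0 w < rho -> E1 w = E2 w) ->
  forall w, dom J w -> E1 w = E2 w.
Proof.
move=> tJ l1 l2 Jw0 rho0 H0 w Jw.
suff : forall t, 0 <= t <= 1 -> exists2 rho, 0 < rho & forall v, dom J v ->
    ed (seg w0 w t) v < rho -> E1 v = E2 v.
  move=> /(_ 1)[]; first by rewrite ler01 lexx.
  by move=> s s0 /(_ w Jw); rewrite seg1 edxx => /(_ s0).
have r0 : 0 < r by have [c /chart_gt0] := charts (E1 w0).
have cJ := dom_convex tJ.
set l := ed w0 w; have l0 : 0 < 1 + l by rewrite ltr_wpDr ?ed_ge0.
have small (s a b : R) : `|a - b| * (1 + l) < s -> ed (seg w0 w a) (seg w0 w b) < s.
  by rewrite ed_seg; apply: le_lt_trans; rewrite ler_wpM2l// lerDr.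
apply: real_ind => t /andP[t0 t1] IH.
have [t_0|tn0] := eqVneq t 0.
  pose d := rho / 2 / (1 + l).
  have d0 : 0 < d by rewrite !divr_gt0.
  exists d => // u /andP[tu ue] u1; exists (rho / 2); first by rewrite divr_gt0.
  move=> v Jv uv; apply: H0 => //.
  apply: (le_lt_trans (ed_triangle (seg w0 w u) _ _)).
  rewrite -{1}(seg0 w0 w) [ltRHS]splitr ltrD// small//.
  rewrite sub0r normrN ger0_norm; last lra.
  by rewrite -ltr_pdivlMr// -/d; move: ue; rewrite t_0; lra.
have tp : 0 < t by rewrite lt_neqAle eq_sym tn0.
pose d := Num.min t (r / 4 / (1 + l)).
have d0 : 0 < d by rewrite lt_min tp !divr_gt0.
have dt : d <= t by rewrite ge_min lexx.
have dr : d <= r / 4 / (1 + l) by rewrite ge_min lexx orbT.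
pose b := t - d / 2.
have b01 : 0 <= b <= 1 by rewrite /b; apply/andP; split; lra.
have [|s s0 Hs] := IH b; first by rewrite /b; apply/andP; split; lra.
set wb := seg w0 w b in Hs.
have Jb : dom J wb by exact: cJ.
have Eb : E1 wb = E2 wb by apply: Hs; rewrite ?edxx.
have [c h1] := charts (E1 wb); have h2 := h1; rewrite Eb in h2.
have [ O1 hO1 H1] := isom_chart tJ l1 Jb h1.
have [ O2 hO2 H2] := isom_chart tJ l2 Jb h2.
(* Both maps are read in one chart at [wb]; agreement near [wb] identifies the linear parts, hence
   the maps on the whole chart ball, which reaches beyond [t]. *)
have O12 : O1 = O2.
  apply: (@affm_inj R m.+1 (dom J `&` [set v | ed wb v < Num.min s r]) wb (c (E1 wb))).
    by apply: dom_fat; rewrite // lt_min s0.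
  move=> v [Jv /=]; rewrite lt_min => /andP[vs vr].
  have [_ <-] := H1 _ Jv vr; have [_] := H2 _ Jv vr; rewrite Eb => <-.
  by rewrite Hs.
exists (d / 2); first by rewrite divr_gt0.
move=> u /andP[tu ud] u1; exists (r / 2); first by rewrite divr_gt0.
move=> v Jv uv.
have vr : ed wb v < r.
  apply: (le_lt_trans (ed_triangle (seg w0 w u) _ _)).
  rewrite [ltRHS]splitr ltrD// small// distrC ger0_norm; last by rewrite /b; lra.
  rewrite -ltr_pdivlMr//.
  have : r / 4 / (1 + l) < r / 2 / (1 + l) by rewrite ltr_pM2r ?invr_gt0//; lra.
  rewrite /b; lra.
have [v1 v2] := H1 _ Jv vr; have [v1' v2'] := H2 _ Jv vr.
apply: (chart_inj h1) => //; first by rewrite Eb.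
by rewrite v2 v2' O12 Eb.
Qed.

(* Agreement on the hyperplane t = 0 suffices: the reflection in it is excluded
   because the charts take their values in a half-space. *)
Lemma isom_unique0 J E1 E2 (e : R) : thick J ->
  loc_isom md (dom J) E1 -> loc_isom md (dom J) E2 ->
  0 < e -> (forall t, 0 <= t < e -> J t) ->
  (forall x, E1 (pt x 0) = E2 (pt x 0)) -> (forall x, bd (E1 (pt x 0))) ->
  forall w, dom J w -> E1 w = E2 w.
Proof.
move=> tJ l1 l2 e0 HJ E12 b1.
pose w0 : 'rV[R]_m.+1 := pt 0 0.
have J0 : dom J w0 by rewrite /dom/= ht_pt; apply: HJ; rewrite lexx.
have b2 : bd (E2 w0) by rewrite -E12.
have [c h1] := charts (E1 w0); have h2 := h1; rewrite E12 in h2.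
have [ O1 hO1 H1] := isom_chart tJ l1 J0 h1.
have [ O2 hO2 H2] := isom_chart tJ l2 J0 h2.
have HJ' t : `|t - ht w0| < e -> 0 <= 1 * (t - ht w0) -> J t.
  rewrite mul1r ht_pt subr0 => t1 t2; apply: HJ; rewrite t2.
  by move: t1; rewrite ger0_norm.
have K1 := isom_ht tJ l1 J0 h1 hO1 H1 (b1 0) (expr1n _ 2) e0 HJ'.
have K2 := isom_ht tJ l2 J0 h2 hO2 H2 b2 (expr1n _ 2) e0 HJ'.
have z0 : ht (c (E1 w0)) = 0 by exact: chart_boundary0 (b1 0) h1.
have K O : orthomx O -> (forall w, ht (affm w0 (c (E1 w0)) O w) = 1 * (ht w - ht w0)) ->
    (delta_mx 0 ord_max : 'rV[R]_m.+1) *m O = delta_mx 0 ord_max.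
  move=> hO hh; apply: ht_preserving => // v.
  by have := hh (w0 + v); rewrite /affm addrAC subrr add0r htD z0 add0r mul1r htD addrAC subrr add0r.
have {}K1 := K O1 hO1 K1.
have {}K2 : (delta_mx 0 ord_max : 'rV[R]_m.+1) *m O2 = delta_mx 0 ord_max by apply: K; rewrite // E12.
apply: (isom_unique tJ l1 l2 J0 (chart_gt0 h1)) => w Jw wr.
have ptw x t : pt x t - w0 = (pt x 0 - w0) + t *: delta_mx 0 ord_max.
  by apply/rowP => j; rewrite !mxE eqxx; case: unliftP => [k|] ->;
    rewrite ?mxE ?eqxx ?mulr1 1?addrAC ?subrr ?add0r// eq_sym (negPf (neq_lift _ _)) mulr0 addr0.
have Jx : dom J (pt (base w) 0) by rewrite /dom /= ht_pt; apply: HJ; rewrite lexx.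
have xr : ed w0 (pt (base w) 0) < r.
  rewrite ed_pt; apply: le_lt_trans wr; rewrite -{1}(base_pt 0 0); exact: ed_base.
have [v1 v2] := H1 _ Jw wr; have [v1' v2'] := H2 _ Jw wr.
have [_ x2] := H1 _ Jx xr; have [_ x2'] := H2 _ Jx xr.
apply: (chart_inj h1) => //; first by rewrite E12.
(* Both linear parts fix the vertical direction, so the image of [w] is the image of its foot moved
   up by the height of [w]. *)
have key z O : (delta_mx 0 ord_max : 'rV[R]_m.+1) *m O = delta_mx 0 ord_max ->
    affm w0 z O w = affm w0 z O (pt (base w) 0) + ht w *: delta_mx 0 ord_max.
  by move=> hO; rewrite -{1}(pt_eta w) /affm ptw mulmxDl -scalemxAl hO addrA.
by rewrite v2 v2' (key _ O1)// (key _ O2)// -x2 -x2' E12.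
Qed.

End Developing.

(** * Extension of developing maps: closing a slab, thickening it, collars *)

Section Extension.
Variables (R : realType) (m : nat) (M : metricType R).
Local Notation md := (@mdist R M).
Local Notation chart := (isometric_chart md (@half_space R m)).
Local Notation ed := (@euclid_dist R m.+1).
Local Notation bd := (manifold_boundary m M).
Implicit Types (p q : M) (J : set R) (E : 'rV[R]_m.+1 -> M) (c : M -> 'rV[R]_m.+1).
Variable r : R.
Hypothesis charts : forall p, exists c, chart p r c.
Hypothesis r0 : 0 < r.

(* An extension is determined by its distances to the points of the original
   domain: trilateration replaces the comparison of overlapping charts. *)
Lemma isom_ext J E (D' : set 'rV[R]_m.+1) (E' : 'rV[R]_m.+1 -> M) :
  thick J -> loc_isom md (dom J) E ->
  (forall w, D' w -> exists2 v, dom J v & ed w v < r / 8) ->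
  (forall w v, D' w -> dom J v -> ed w v < r / 2 -> md (E v) (E' w) = ed v w) ->
  loc_isom md D' E'.
Proof.
have rp := r0; move=> tJ lE cl ext w0 /cl[v Jv w0v]; exists (r / 8); first by rewrite divr_gt0.
have [c h] := charts (E v); have [ O hO H] := isom_chart tJ lE Jv h.
(* A point within r/8 of [w0] is within r/4 of [v], so all points within r/8 of [v] are within r/2
   of it, where the distances to its image are prescribed. *)
have K w : D' w -> ed w0 w < r / 8 -> md (E v) (E' w) < r /\ c (E' w) = affm v (c (E v)) O w.
  move=> D'w w0w.
  have vw : ed w v < r / 4.
    by have := ed_triangle w0 w v; rewrite (ed_sym w w0); lra.
  have vE : md (E v) (E' w) < r by rewrite ext// 1?(ed_sym v); lra.
  split=> //.
  apply: (@trilateration R m.+1 (dom J `&` [set u | ed v u < r / 8]) v (c (E v)) O _ _ 0) => //.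
    by apply: dom_fat; rewrite // divr_gt0.
  move=> u [Ju /= vu]; rewrite addr0; congr (_ ^+ 2).
  have vur : ed v u < r by lra.
  have [u1 u2] := H u Ju vur.
  rewrite -u2 (chart_dist h)// metric_sym ext//; first by rewrite u2 ed_affm// ed_sym.
  by have := ed_triangle v w u; lra.
move=> w w' D'w D'w' w0w w0w'.
have [w1 w2] := K w D'w w0w; have [w1' w2'] := K w' D'w' w0w'.
by rewrite -(chart_dist h)// w2 w2' ed_affm.
Qed.

Lemma isom_close E (T : R) : 0 < T -> loc_isom md (dom [set t | 0 <= t < T]) E ->
  exists2 E', loc_isom md (dom [set t | 0 <= t <= T]) E' &
    forall w, dom [set t | 0 <= t < T] w -> E' w = E w.
Proof.
have rp := r0; move=> T0 lE; set J := [set t | _] in lE; have tJ : thick J by exact: thick_co.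
pose e := Num.min T (r / 8) / 2.
have e0 : 0 < e by rewrite divr_gt0// lt_min T0 divr_gt0.
have eT : e <= T / 2 by rewrite ler_pM2r// ge_min lexx.
have er : e <= r / 16.
  have : Num.min T (r / 8) <= r / 8 by rewrite ge_min lexx orbT.
  by rewrite /e; lra.
have ex w : exists q, (dom J w -> q = E w) /\ (ht w = T -> forall v, dom J v ->
    ed w v < r / 2 -> md (E v) q = ed v w).
  have [wT|wT] := eqVneq (ht w) T; last first.
    by exists (E w); split=> // wT'; move/eqP: wT.
  pose v0 := pt (base w) (T - e).
  have Jv0 : dom J v0 by rewrite /dom/= ht_pt; apply/andP; split; lra.
  have [c h] := charts (E v0); have [ O hO H] := isom_chart tJ lE Jv0 h.
  have v0w : ed v0 w = e by rewrite -(pt_eta w) ed_pt_ht wT; rewrite distrC gtr0_norm; lra.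
  have [||q vq cq] := chart_surj (z := affm v0 (c (E v0)) O w) h.
  (* The height of the affine image is an affine function of the position on the segment from [v0]
     to [w], nonnegative before the end because those points lie in the open slab; hence it is
     nonnegative at the end too. *)
  - rewrite leNgt; apply/negP => neg.
    pose f u := ht (affm v0 (c (E v0)) O (seg v0 w u)).
    pose k := ht ((w - v0) *m O).
    have fE u : f u = ht (c (E v0)) + u * k.
      by rewrite /f /affm htD; congr (_ + _); rewrite /seg addrAC subrr add0r -scalemxAl htZ.
    have f1 : f 1 < 0 by rewrite /f seg1.
    have fpos u : 0 <= u < 1 -> 0 <= f u.
      move=> /andP[u0 u1].
      have Ju : dom J (seg v0 w u).
        rewrite /dom/= ht_seg wT ht_pt.
        by apply/andP; split; nra.
      have ur : ed v0 (seg v0 w u) < r by rewrite ed_seg0// v0w; nra.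
      by have [u2 u3] := H _ Ju ur; rewrite /f -u3; exact: chart_ht h _.
    have f0 : 0 <= f 0 by apply: fpos; rewrite lexx ltr01.
    move: f1 f0 fpos; rewrite !fE mul1r mul0r addr0; set h0 := ht _ => f1 f0 fpos.
    have hk : h0 < - k by lra.
    have kp : 0 < - k by lra.
    (* The midpoint between 1 and the zero [h0 / - k] of the height, where the height is already
       negative. *)
    have := fpos ((1 + h0 / - k) / 2).
    have hk1 : h0 / - k < 1 by rewrite ltr_pdivrMr// mul1r.
    have hk0 : 0 <= h0 / - k by rewrite divr_ge0// ltW.
    rewrite fE -/h0 => /(_ _).
    have -> : (1 + h0 / - k) / 2 * k = (k - h0) / 2 by field; rewrite lt_eqF; lra.
    have -> : 0 <= (1 + h0 / - k) / 2 < 1 by apply/andP; split; lra.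
    by move=> /(_ isT); lra.
  - by rewrite -[X in ed X _](affm_center v0 _ O) ed_affm// v0w; lra.
  exists q; split.
    by rewrite /dom/J/= wT ltxx andbF.
  move=> _ v Jv wv.
  have v0v : ed v0 v < r by have := ed_triangle w v0 v; rewrite v0w; lra.
  have [v1 v2] := H _ Jv v0v.
  by rewrite -(chart_dist h)// v2 cq ed_affm.
have /choice[E' PE] := ex.
exists E'; last by move=> w Jw; have [->] := PE w.
apply: (isom_ext tJ lE).
  move=> w /andP[w0 wT]; have [wT'|] := ltP (ht w) T.
    by exists w; rewrite ?edxx ?divr_gt0// /dom/J/= w0.
  move=> Tw; exists (pt (base w) (T - e)); first by rewrite /dom/= ht_pt; apply/andP; split; lra.
  rewrite -{1}(pt_eta w) ed_pt_ht ger0_norm; lra.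
move=> w v /andP[w0 wT] Jv wv; have [wT'|Tw] := ltP (ht w) T.
  have Jw : dom J w by rewrite /dom/J/= w0.
  have [->//] := PE w; rewrite (isom_unif tJ lE Jw (charts _))// ?edxx//; lra.
by have [_ ->//] := PE w; apply/eqP; rewrite eq_le wT.
Qed.

(** A uniform distance [eta] from the boundary leaves the same vertical room in every chart centred
    at height [T]. *)
Lemma isom_open E (T eta : R) : 0 < T -> 0 < eta ->
  loc_isom md (dom [set t | 0 <= t <= T]) E ->
  (forall x q, md (E (pt x T)) q < eta -> ~ bd q) ->
  exists T' E', [/\ T < T', loc_isom md (dom [set t | 0 <= t < T']) E' &
    forall w, dom [set t | 0 <= t <= T] w -> E' w = E w].
Proof.
have rp := r0; move=> T0 eta0 lE far; set J := [set t | _] in lE; have tJ : thick J by exact: thick_cc.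
pose e := Num.min eta (r / 8) / 2.
have e0 : 0 < e by rewrite divr_gt0// lt_min eta0 divr_gt0.
have eT : e <= eta / 2 by rewrite ler_pM2r// ge_min lexx.
have er : e <= r / 16.
  have : Num.min eta (r / 8) <= r / 8 by rewrite ge_min lexx orbT.
  by rewrite /e; lra.
have ex w : exists q, (dom J w -> q = E w) /\ (T < ht w < T + e -> forall v, dom J v ->
    ed w v < r / 2 -> md (E v) q = ed v w).
  have [/andP[wT we]|wT] := boolP (T < ht w < T + e); last by exists (E w).
  pose v0 := pt (base w) T.
  have Jv0 : dom J v0 by rewrite /dom/J/= ht_pt lexx ltW.
  have [c h] := charts (E v0); have [ O hO H] := isom_chart tJ lE Jv0 h.
  have v0w : ed v0 w = ht w - T by rewrite -{1}(pt_eta w) ed_pt_ht distrC gtr0_norm; lra.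
  (* Otherwise the foot of the perpendicular from the chart centre would be a boundary point at
     distance at most [e], which is less than [eta]. *)
  have c0 : e < ht (c (E v0)).
    rewrite ltNge; apply/negP => ce.
    have p0 : md (E v0) (E v0) < r by rewrite mdistxx.
    have ch := chart_ht h p0.
    have zd : ed (c (E v0)) (pt (base (c (E v0))) 0) = ht (c (E v0)).
      by rewrite -{1}(pt_eta (c (E v0))) ed_pt_ht subr0 ger0_norm.
    have [||q vq cq] := chart_surj (z := pt (base (c (E v0))) 0) h.
    + by rewrite ht_pt.
    + by rewrite zd; lra.
    have bq : bd q by apply/(chart_boundary h vq); rewrite cq ht_pt.
    apply: (far (base w) q) bq.
    by rewrite -/v0 -(chart_center_dist h vq) cq zd; lra.
  have zd : ed (c (E v0)) (affm v0 (c (E v0)) O w) = ht w - T.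
    by rewrite -[X in ed X _](affm_center v0 _ O) ed_affm.
  have [||q vq cq] := chart_surj (z := affm v0 (c (E v0)) O w) h.
  - have := ed_ht (c (E v0)) (affm v0 (c (E v0)) O w).
    by rewrite zd ler_norml => /andP[]; lra.
  - by rewrite zd; lra.
  exists q; split.
    by rewrite /dom/J/= => /andP[_]; rewrite leNgt wT.
  move=> _ v Jv wv.
  have v0v : ed v0 v < r by have := ed_triangle w v0 v; rewrite v0w; lra.
  have [v1 v2] := H _ Jv v0v.
  by rewrite -(chart_dist h)// v2 cq ed_affm.
have /choice[E' PE] := ex.
exists (T + e), E'; split; first by rewrite ltrDl.
  apply: (isom_ext tJ lE).
    move=> w /andP[w0 wT]; have [wT'|Tw] := leP (ht w) T.
      by exists w; rewrite ?edxx ?divr_gt0// /dom/J/= w0.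
    exists (pt (base w) T); first by rewrite /dom/J/= ht_pt lexx ltW.
    rewrite -{1}(pt_eta w) ed_pt_ht ger0_norm; lra.
  move=> w v /andP[w0 wT] Jv wv; have [wT'|Tw] := leP (ht w) T.
    have Jw : dom J w by rewrite /dom/J/= w0.
    have [->//] := PE w; rewrite (isom_unif tJ lE Jw (charts _))// ?edxx//; lra.
  by have [_ ->//] := PE w; rewrite Tw.
by move=> w Jw; have [->] := PE w.
Qed.

Variable U : 'rV[R]_m -> M.
Hypothesis U_isom : loc_isom md setT U.
Hypothesis U_bd : forall x, bd (U x).

(** Boundary points have height 0 in every chart, so a chart reads [U] as an isometry into the
    bounding hyperplane. *)
Lemma boundary_chart x c : chart (U x) r c -> exists2 B : 'M[R]_m, orthomx B &
  forall y, euclid_dist x y < r ->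
    md (U x) (U y) < r /\ c (U y) = pt (affm x (base (c (U x))) B y) 0.
Proof.
move=> h.
have near y : euclid_dist x y < r -> md (U x) (U y) < r.
  apply: le_lt_trans; apply: (@loc_isom_lip _ _ _ md _ _ setT) => //.
  - exact: mdistxx.
  - by move=> *; exact: metric_triangle.
pose X := [set y | euclid_dist x y < r].
have cX : convex_set X by move=> w w' u Xw Xw' u01; exact: ed_convex.
have lc : loc_isom ed X (c \o U).
  move=> w wr; have [s s0 H] := U_isom (w0 := w) I; exists s => // v v' vr vr' vs vs'.
  by rewrite /= (chart_dist h) ?near// H.
have h0 y : euclid_dist x y < r -> ht (c (U y)) = 0.
  by move=> yr; apply/(chart_boundary h (near _ yr)).
have [||B hB gB] := @rigid R m X (fun y => base (c (U y))) x.
- exact: fat_ball.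
- move=> w w' Xw Xw'; rewrite -[RHS](loc_isom_euclid cX lc Xw Xw') /=.
  by rewrite -{2}(pt_eta (c (U w))) -{2}(pt_eta (c (U w'))) !h0// ed_pt.
exists B => // y yr; split; first exact: near.
by rewrite -[LHS](pt_eta (c (U y))) h0//; congr pt; exact: gB.
Qed.

(** The point at height t above [U x] satisfies the Pythagorean relation with all nearby boundary
    points. This condition is intrinsic, so points chosen in different charts fit together. *)
Lemma isom_collar : exists2 E, loc_isom md (dom [set t | 0 <= t < r / 4]) E &
  forall x, E (pt x 0) = U x.
Proof.
have rp := r0.
have ex w : exists q, 0 <= ht w < r / 4 -> forall y, euclid_dist (base w) y < r ->
    md (U y) q ^+ 2 = euclid_dist (base w) y ^+ 2 + ht w ^+ 2.
  have [/andP[w0 wr]|wr] := boolP (0 <= ht w < r / 4); last by exists (U 0).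
  have [c h] := charts (U (base w)); have [B hB H] := boundary_chart h.
  have xx : euclid_dist (base w) (base w) < r by rewrite edxx.
  have [_ cx] := H _ xx; rewrite affm_center in cx.
  have [||q vq cq] := chart_surj (z := pt (base (c (U (base w)))) (ht w)) h.
  - by rewrite ht_pt.
  - by rewrite {1}cx ed_pt_ht sub0r normrN ger0_norm//; lra.
  exists q => _ y xy; have [y1 y2] := H _ xy.
  rewrite -(chart_dist h)// cq y2 ed_pt_sqr sub0r sqrrN; congr (_ ^+ 2 + _).
  by rewrite -{2}(affm_center (base w) (base (c (U (base w)))) B) ed_affm// ed_sym.
have /choice[E PE] := ex; exists E; last first.
  move=> x; have := PE (pt x 0); rewrite ht_pt base_pt lexx divr_gt0// => /(_ isT x).
  rewrite edxx => /(_ r0); rewrite expr0n addr0 => /eqP.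
  by rewrite sqrf_eq0 => /eqP/mdist_positivity.
move=> w0 Jw0; exists (r / 4); first by rewrite divr_gt0.
have [c h] := charts (U (base w0)); have [B hB H] := boundary_chart h.
have K w : dom [set t | 0 <= t < r / 4] w -> ed w0 w < r / 4 ->
    md (U (base w0)) (E w) < r /\ c (E w) = pt (affm (base w0) (base (c (U (base w0)))) B (base w)) (ht w).
  move=> Jw wr; have /andP[hw0 hwr] := Jw.
  have b0 : euclid_dist (base w) (base w0) < r / 4.
    by rewrite ed_sym; apply: le_lt_trans wr; exact: ed_base.
  have P := PE w Jw.
  have e1 : md (U (base w0)) (E w) < r.
    rewrite -(@ltr_pXn2r _ 2)// ?nnegrE ?mdist_ge0 ?(ltW r0)// P; last by lra.
    have := ed_ge0 (base w) (base w0); nra.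
  split=> //.
  (* In the chart at [base w0] the relation determines the base of [E w] by trilateration, the
     unknown height being absorbed by the constant; it then gives the square of the height, whose
     sign is known. *)
  have E0 : forall y, euclid_dist (base w0) y < r / 2 ->
     euclid_dist (base (c (E w))) (affm (base w0) (base (c (U (base w0)))) B y) ^+ 2 =
     euclid_dist (affm (base w0) (base (c (U (base w0)))) B (base w)) (affm (base w0) (base (c (U (base w0)))) B y) ^+ 2 + (ht w ^+ 2 - ht (c (E w)) ^+ 2).
    move=> y yr; have yr' : euclid_dist (base w0) y < r by lra.
    have [y1 y2] := H _ yr'.
    have wy : euclid_dist (base w) y < r by have := ed_triangle (base w0) (base w) y; lra.
    have := P _ wy; rewrite metric_sym -(chart_dist h)// y2 -{1}(pt_eta (c (E w))) ed_pt_sqr.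
    by rewrite ed_affm// subr0; lra.
  have bE : base (c (E w)) = affm (base w0) (base (c (U (base w0)))) B (base w).
    apply: (trilateration _ hB E0); apply: fat_ball; lra.
  have hE : ht (c (E w)) = ht w.
    have := E0 (base w0); rewrite edxx bE => /(_ ltac:(lra)) hh.
    apply/eqP; rewrite -(@eqrXn2 _ 2)// ?(chart_ht h)//; apply/eqP; lra.
  by rewrite -[LHS]pt_eta bE hE.
move=> w w' Jw Jw' wr wr'.
have [w1 w2] := K w Jw wr; have [w1' w2'] := K w' Jw' wr'.
rewrite -(chart_dist h)// w2 w2'; apply/eqP; rewrite -(@eqrXn2 _ 2)// ?ed_ge0//.
by rewrite ed_pt_sqr ed_affm// -ed_pt_sqr !pt_eta.
Qed.

End Extension.

(** * Quotients by discrete groups of isometries *)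

Local Open Scope quotient_scope.

Section Group.
Variables (R : realType) (n : nat) (G : isom_group R n).
Implicit Types (x y z : 'rV[R]_n) (g h : 'rV[R]_n -> 'rV[R]_n).
Local Notation ed := (@euclid_dist R n).

Lemma group_id : isoms G id. Proof. by case: (isoms_closed G). Qed.

Lemma group_comp g h : isoms G g -> isoms G h -> isoms G (g \o h).
Proof. by have [_ hM _] := isoms_closed G; exact: hM. Qed.

Lemma group_inv g : isoms G g -> exists h, [/\ isoms G h, cancel g h & cancel h g].
Proof.
move=> Gg; have [_ [h gh hg]] := isoms_isometry Gg.
by exists h; split=> //; have [_ _ hV] := isoms_closed G; exact: hV Gg gh hg.
Qed.

Lemma group_ed g x y : isoms G g -> ed (g x) (g y) = ed x y.
Proof. by move=> Gg; have [] := isoms_isometry Gg. Qed.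

Definition proj x : quotient_space G := \pi_({eq_quot orbit_equiv G}) x.

Lemma projP x y : proj x = proj y <-> exists2 g, isoms G g & g x = y.
Proof.
split; first by move=> /eqmodP /= /asboolP [g Gg gx]; exists g.
by move=> [g Gg gx]; apply/eqmodP; apply/asboolP; exists g.
Qed.

Lemma proj_surj (u : quotient_space G) : exists x, proj x = u.
Proof. by exists (repr u); rewrite /proj reprK. Qed.

Lemma proj_group g x : isoms G g -> proj (g x) = proj x.
Proof. by move=> Gg; apply/esym/projP; exists g. Qed.

Local Notation qd := (@quotient_dist R n G).

Let S (u v : quotient_space G) := [set r | exists x y : 'rV[R]_n,
    [/\ proj x = u, proj y = v & r = ed x y]].

Lemma quotient_distE u v : qd u v = inf (S u v). Proof. by []. Qed.

Let S_lb u v : has_lbound (S u v).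
Proof. by exists 0 => r [x [y [_ _ ->]]]; exact: ed_ge0. Qed.

Let S0 u v : S u v !=set0.
Proof.
by have [x xu] := proj_surj u; have [y yv] := proj_surj v; exists (ed x y), x, y.
Qed.

Lemma qd_le x y : qd (proj x) (proj y) <= ed x y.
Proof. by apply: (ge_inf (S_lb _ _)); exists x, y. Qed.

Lemma qd_ge0 u v : 0 <= qd u v.
Proof. by apply: lb_le_inf; [exact: S0 | move=> r [x [y [_ _ ->]]]; exact: ed_ge0]. Qed.

Lemma qd_lt x y r : qd (proj x) (proj y) < r -> exists2 g, isoms G g & ed x (g y) < r.
Proof.
move=> /inf_lt[|_ [x' [y' [/projP[g Gg gx] /esym/projP[h Gh hy] ->]]] lt_r]; first exact: S0.
exists (g \o h); first exact: group_comp.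
by rewrite /= hy -gx (group_ed _ _ Gg).
Qed.

Lemma qd_sym u v : qd u v = qd v u.
Proof.
rewrite !quotient_distE; congr inf; apply/seteqP.
by split=> r [x [y [xu yv ->]]]; exists y, x; rewrite ed_sym.
Qed.

Lemma qd_triangle v u w : qd u w <= qd u v + qd v w.
Proof.
have [x <-] := proj_surj u; have [y <-] := proj_surj v; have [z <-] := proj_surj w.
apply/ler_addgt0Pl => e e0.
have [g Gg gy] := @qd_lt x y (qd (proj x) (proj y) + e / 2) ltac:(by rewrite ltrDl divr_gt0).
have [h Gh hz] := @qd_lt y z (qd (proj y) (proj z) + e / 2) ltac:(by rewrite ltrDl divr_gt0).
rewrite -(proj_group z Gh) -(proj_group (h z) Gg) (le_trans (qd_le _ _))//.
have := ed_triangle (g y) x (g (h z)); rewrite (group_ed _ _ Gg) proj_group// proj_group//; lra.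
Qed.

Lemma qdxx u : qd u u = 0.
Proof.
have [x <-] := proj_surj u; apply/eqP; rewrite eq_le qd_ge0 andbT.
by rewrite (le_trans (qd_le _ _))// edxx.
Qed.

(** Freeness and discreteness in one quantitative condition; the projection then preserves distances
    below d/2. *)
Definition displaces (d : R) := forall g, isoms G g -> g <> id -> forall x, d <= ed x (g x).

Variable d : R.
Hypotheses (d0 : 0 < d) (dG : displaces d).

Lemma displaces_inj g h x : isoms G g -> isoms G h -> ed (g x) (h x) < d -> g = h.
Proof.
move=> Gg Gh gh; have [h' [Gh' hh' h'h]] := group_inv Gh.
have [e|ne] := pselect (h' \o g = id).
  by apply/funext => y; rewrite -[LHS]h'h; have := congr1 (@^~ y) e => /= ->.
have := dG (group_comp Gh' Gg) ne x.
rewrite -(group_ed _ _ Gh) /= h'h ed_sym => dgh.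
by have := lt_le_trans gh dgh; rewrite ltxx.
Qed.

Lemma qd_small x y : ed x y < d / 2 -> qd (proj x) (proj y) = ed x y.
Proof.
have dp := d0.
move=> xy; apply/eqP; rewrite eq_le qd_le /= leNgt; apply/negP => /qd_lt[g Gg xgy].
suff gid : g = id by rewrite gid ltxx in xgy.
apply: (@displaces_inj g id y) => //; first exact: group_id.
have := ed_triangle x (g y) y; rewrite (ed_sym (g y) x) /=; lra.
Qed.

Lemma qd_eq0 u v : qd u v = 0 -> u = v.
Proof.
have [x <-] := proj_surj u; have [y <-] := proj_surj v => xy0.
have dp : 0 < d / 2 by rewrite divr_gt0.
have [|g Gg xgy] := @qd_lt x y (d / 2); first by rewrite xy0.
apply/esym/projP; exists g => //; apply/esym/ed_eq0/eqP; rewrite eq_le ed_ge0 andbT.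
(* A zero infimum provides an element [h] bringing [y] strictly closer to [x] than [g] does; by
   discreteness it equals [g]. *)
rewrite leNgt; apply/negP => pos.
have [|h Gh xhy] := @qd_lt x y (Num.min (d / 2) (ed x (g y))).
  by rewrite xy0 lt_min dp.
move: xhy; rewrite lt_min => /andP[h1 h2].
suff gh : g = h by rewrite gh ltxx in h2.
apply: (@displaces_inj g h y) => //.
by have := ed_triangle x (g y) (h y); rewrite (ed_sym (g y) x); lra.
Qed.

End Group.

(** * Half-spaces do not develop onto compact manifolds *)

Lemma affm_recenter (R : realType) n (w0 z0 w1 w : 'rV[R]_n) O :
  affm w1 (affm w0 z0 O w1) O w = affm w0 z0 O w.
Proof. by rewrite /affm -addrA -mulmxDl [_ - _ + (_ - _)]addrC addrA subrK. Qed.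

Lemma loc_isom_comp (R : realType) n k (Y : Type) (dY : Y -> Y -> R) (X : set 'rV[R]_n)
    (X' : set 'rV[R]_k) (E : 'rV[R]_n -> Y) (h : 'rV[R]_k -> 'rV[R]_n) :
  loc_isom dY X E -> (forall w, X' w -> X (h w)) ->
  (forall w w', euclid_dist (h w) (h w') = euclid_dist w w') ->
  loc_isom dY X' (fun w => E (h w)).
Proof.
move=> lE hX hI w0 /hX/lE[r r0 H]; exists r => // w w' Xw Xw' wr wr'.
by rewrite H ?hI//; exact: hX.
Qed.

Lemma ed_sup_ball (R : realType) n (x y : 'rV[R]_n) s : 0 < s -> ball x s y ->
  euclid_dist x y <= n%:R * s.
Proof.
move=> s0 xy; apply: ed_le_coord; last exact: ltW.
by move=> i; apply/ltW; have := xy.2 0 i.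
Qed.

Section HalfSpace.
Variables (R : realType) (m : nat) (M : metricType R).
Local Notation md := (@mdist R M).
Local Notation chart := (isometric_chart md (@half_space R m)).
Local Notation ed := (@euclid_dist R m.+1).
Local Notation bd := (manifold_boundary m M).
Implicit Types (p q : M) (J : set R) (c : M -> 'rV[R]_m.+1).
Variable r : R.
Hypothesis charts : forall p, exists c, chart p r c.
Hypothesis r0 : 0 < r.
Variable E : 'rV[R]_m.+1 -> M.
Let D := dom (m := m) [set t : R | 0 <= t].
Hypothesis E_isom : loc_isom md D E.
Hypothesis E_bd : forall x, bd (E (pt x 0)).

Lemma half_space_lift w0 q : D w0 -> md (E w0) q < r ->
  exists w, [/\ D w, ed w0 w = md (E w0) q & E w = q].
Proof.
move=> Dw0 qr; have tJ : thick [set t : R | 0 <= t] := @thick_ge0 R.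
have [c h] := charts (E w0); have [ O hO H] := isom_chart tJ E_isom Dw0 h.
pose w := affm (c (E w0)) w0 O^T (c q).
have wq : affm w0 (c (E w0)) O w = c q by rewrite affm_trV.
have w0w : ed w0 w = md (E w0) q.
  by rewrite -(chart_center_dist h qr) -(ed_affm w0 (c (E w0)) w0 w hO) affm_center wq.
suff Dw : D w.
  exists w; split=> //; have [|w1 w2] := H w Dw; first by rewrite w0w.
  by apply: (chart_inj h) => //; rewrite w2.
rewrite /D /dom /= leNgt; apply/negP => hw.
have hw0 : 0 <= ht w0 := Dw0.
(* [w1] is the point where the segment crosses the bounding hyperplane. It is sent to the boundary,
   so the chart height equals the height around it, and [q] would have a negative chart height. *)
pose u := ht w0 / (ht w0 - ht w).
have den : 0 < ht w0 - ht w by lra.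
have u0 : 0 <= u by rewrite divr_ge0// ltW.
have u1 : u <= 1 by rewrite ler_pdivrMr// mul1r; lra.
pose w1 := seg w0 w u.
have hw1 : ht w1 = 0 by rewrite ht_seg /u; field; rewrite gt_eqF.
have Dw1 : D w1 by rewrite /D /dom/= hw1.
have bw1 : bd (E w1) by rewrite -(pt_eta w1) hw1.
have w01 : ed w0 w1 < r.
  by rewrite ed_seg0// w0w; apply: le_lt_trans qr; rewrite ler_piMl// mdist_ge0.
have E01 : md (E w0) (E w1) = ed w0 w1.
  by rewrite (isom_unif tJ E_isom Dw0 (charts _)) ?edxx.
pose s := r - md (E w0) (E w1).
have s0 : 0 < s by rewrite /s subr_gt0 E01.
have h1 : chart (E w1) s c by exact: chart_sub h _ _.
have [_ c1] := H _ Dw1 w01.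
have H1 v : D v -> ed w1 v < s -> md (E w1) (E v) < s /\ c (E v) = affm w1 (c (E w1)) O v.
  move=> Dv vs; split; first by apply: le_lt_trans vs; exact: isom_lip tJ E_isom _ _.
  have vr : ed w0 v < r by have := ed_triangle w1 w0 v; rewrite -E01 /s in vs *; lra.
  by have [_ ->] := H _ Dv vr; rewrite c1 affm_recenter.
have := isom_ht tJ E_isom Dw1 h1 hO H1 bw1 (expr1n _ 2) ltr01 _ w.
rewrite c1 affm_recenter wq hw1 subr0 mul1r => hcq.
have := chart_ht h qr; rewrite hcq ?leNgt ?hw// => t _.
by rewrite subr0 mul1r.
Qed.

Lemma half_space_boundary w : D w -> bd (E w) -> ht w = 0.
Proof.
move=> Dw bw; apply/eqP; rewrite eq_le [X in _ && X]Dw andbT leNgt; apply/negP => w0.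
have [c h] := charts (E w).
apply: (isom_interior (@thick_ge0 R) E_isom w0 _ _ bw).
  by move=> t; rewrite ltr_norml => /andP[] /=; lra.
by exists r, c.
Qed.

(* Follow the vertical segment from w down to the boundary and lift it from w'. *)
Lemma half_space_level w w' : D w -> D w' -> E w = E w' -> ht w' <= ht w.
Proof.
have rp := r0.
suff H n : forall w w', D w -> D w' -> E w = E w' -> ht w < n%:R * (r / 2) -> ht w' <= ht w.
  move=> Dw Dw' ww'; apply: (H (Num.truncn (ht w / (r / 2))).+1) => //.
  by rewrite -ltr_pdivrMr ?divr_gt0// truncnS_gt.
elim: n => [|n IH] {}w {}w' Dw Dw' ww' wn; first by have hw : 0 <= ht w := Dw; move: wn; rewrite mul0r; lra.
have step k : 0 <= k <= r / 2 -> k <= ht w -> exists v', [/\ D v',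
    E (pt (base w) (ht w - k)) = E v' & ht w' <= ht v' + k].
  move=> /andP[k0 kr] kw; set v := pt _ _.
  have Dv : D v by rewrite /D /dom/= ht_pt subr_ge0.
  have wv : ed w v = k.
    by rewrite -{1}(pt_eta w) ed_pt_ht opprB addrC subrK ger0_norm.
  have vr : md (E w') (E v) < r.
    by rewrite -ww'; apply: (le_lt_trans (isom_lip (@thick_ge0 R) E_isom Dw Dv)); rewrite wv; lra.
  have [v' [Dv' w'v' Ev']] := half_space_lift Dw' vr.
  exists v'; split=> //.
  have : ed w' v' <= k.
    by rewrite w'v' -ww' -wv; exact: isom_lip (@thick_ge0 R) E_isom Dw Dv.
  have := ed_ht w' v'; rewrite ler_norml => /andP[]; lra.
have hw : 0 <= ht w := Dw.
have [wr|wr] := leP (ht w) (r / 2).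
  have [|v' [Dv' Ev' w'v']] := step (ht w) _ (lexx _); first by rewrite hw.
  rewrite subrr in Ev'.
  have hv' : ht v' = 0 by apply: half_space_boundary => //; rewrite -Ev'.
  by rewrite hv' add0r in w'v'.
have [||v' [Dv' Ev' w'v']] := step (r / 2); [by rewrite lexx divr_ge0// ltW|exact: ltW|].
have := IH _ _ _ Dv' Ev'.
rewrite /D /dom/= ht_pt subr_ge0 => /(_ (ltW wr)).
have : ht w - r / 2 < n%:R * (r / 2) by move: wn; rewrite -natr1 mulrDl mul1r; lra.
by move=> h1 /(_ h1) h2; lra.
Qed.

(* The points of heights 2 k r stay at distance at least r from each other. *)
Lemma half_space_noncompact : ~ compact [set: M].
Proof.
have rp := r0.
move=> cM; pose p k := E (pt 0 (k%:R * (2 * r))).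
have Dp k : D (pt 0 (k%:R * (2 * r))).
  by rewrite /D /dom/= ht_pt mulr_ge0// mulr_ge0// ltW.
have [|p0 [_ clp]] := cM (p @ \oo) _.
  exact: filterT.
have near n : exists2 k, (n <= k)%N & md p0 (p k) < r / 2.
  have [||q [[k nk <-] pq]] := clp [set p k | k in [set k | (n <= k)%N]] (ball p0 (r / 2)).
  - by exists n => // k nk; exists k.
  - by apply: nbhsx_ballx; rewrite divr_gt0.
  by exists k => //; move: pq; rewrite ballEmdist.
have [i _ pi] := near 0%N; have [j ij pj] := near i.+1.
have pij : md (p i) (p j) < r.
  by have := metric_triangle (p i) p0 (p j); rewrite (metric_sym (p i) p0); lra.
have [w [Dw wi Ew]] := half_space_lift (Dp i) pij.
have := half_space_level Dw (Dp j) Ew; rewrite ht_pt.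
have := ed_ht (pt 0 (i%:R * (2 * r))) w; rewrite wi ht_pt ler_norml => /andP[h1 h2].
have : i%:R + 1 <= j%:R :> R by rewrite natr1 ler_nat.
nra.
Qed.

End HalfSpace.

(** * The involution of the boundary *)

Section Slab.
Variables (R : realType) (m : nat) (M : metricType R).
Local Notation md := (@mdist R M).
Local Notation chart := (isometric_chart md (@half_space R m)).
Local Notation ed := (@euclid_dist R m.+1).
Local Notation bd := (manifold_boundary m M).
Implicit Types (p q : M) (J : set R) (c : M -> 'rV[R]_m.+1) (E : 'rV[R]_m.+1 -> M).
Variable r : R.
Hypothesis charts : forall p, exists c, chart p r c.
Hypothesis r0 : 0 < r.
Hypothesis M_compact : compact [set: M].
Variable U : 'rV[R]_m -> M.
Hypothesis U_isom : loc_isom md setT U.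
Hypothesis U_bd : forall x, bd (U x).

Definition isometric_deck (g : 'rV[R]_m -> 'rV[R]_m) :=
  (forall x y, euclid_dist (g x) (g y) = euclid_dist x y) /\ forall x, U (g x) = U x.

Let S := [set s : R | 0 < s /\ exists2 E, loc_isom md (dom [set t | 0 <= t < s]) E &
  forall x, E (pt x 0) = U x].

(** Developing maps of different thickness agree where both are defined, since their values on t = 0
    determine them. The interval [J] is the half-line when [S] is unbounded, and the interval below
    the supremum of [S] otherwise. *)
Lemma isom_glue J : (forall t, J t -> 0 <= t) -> (forall t, J t -> exists2 s, S s & t < s) ->
  exists2 E, loc_isom md (dom J) E & (J 0 -> forall x, E (pt x 0) = U x).
Proof.
move=> Jpos Jlt.
have /choice[F PF] : forall s, exists E, S s ->
    loc_isom md (dom [set t | 0 <= t < s]) E /\ forall x, E (pt x 0) = U x.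
  move=> s; have [[s0 [E lE EU]]|nS] := pselect (S s); first by exists E.
  by exists (fun=> U 0).
have /choice[k Pk] : forall t, exists s, J t -> S s /\ t < s.
  move=> t; have [/Jlt[s Ss ts]|nJ] := pselect (J t); first by exists s.
  by exists 0.
have agree s s' w : S s -> S s' -> 0 <= ht w -> ht w < s -> ht w < s' -> F s w = F s' w.
  move=> Ss Ss' w0 ws ws'; have [l1 u1] := PF s Ss; have [l2 u2] := PF s' Ss'.
  have sp := Ss.1; have sp' := Ss'.1.
  pose s1 := Num.min s s'; have s10 : 0 < s1 by rewrite lt_min sp.
  apply: (@isom_unique0 R m M r charts [set t | 0 <= t < s1] _ _ s1) => //.
  - exact: thick_co.
  - apply: loc_isomS l1 => v; rewrite /dom/= lt_min => /andP[v0 /andP[v1 _]].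
    by rewrite v0.
  - apply: loc_isomS l2 => v; rewrite /dom/= lt_min => /andP[v0 /andP[_ v1]].
    by rewrite v0.
  - by move=> x; rewrite u1 u2.
  - by move=> x; rewrite u1.
  - by rewrite /dom/= lt_min w0 ws.
exists (fun w => F (k (ht w)) w); last first.
  move=> J0 x; rewrite ht_pt; have [Sk _] := Pk _ J0.
  by have [_ ->] := PF _ Sk.
move=> w0 Jw0; have [Sk ks] := Pk _ Jw0; have [l1 u1] := PF _ Sk.
have w00 := Jpos _ Jw0.
have [|rho rho0 H] := l1 w0; first by rewrite /dom/= w00.
exists (Num.min rho (k (ht w0) - ht w0)); first by rewrite lt_min rho0 subr_gt0.
have K w : dom J w -> ed w0 w < k (ht w0) - ht w0 -> 0 <= ht w < k (ht w0).
  move=> Jw wr; rewrite Jpos//=.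
  by have := le_lt_trans (ed_ht w0 w) wr; rewrite ltr_norml => /andP[]; lra.
move=> w w' Jw Jw'; rewrite !lt_min => /andP[wr /(K w Jw)wk] /andP[wr' /(K w' Jw')wk'].
have /andP[h0 h1] := wk; have /andP[h0' h1'] := wk'.
have [Sw sw] := Pk _ Jw; have [Sw' sw'] := Pk _ Jw'.
by rewrite (agree _ _ _ Sw Sk)// (agree _ _ _ Sw' Sk)// H.
Qed.

Lemma maximal_slab : exists (T : R) E, [/\ 0 < T, loc_isom md (dom [set t | 0 <= t <= T]) E,
  forall x, E (pt x 0) = U x & ~ exists T' : R, T < T' /\ S T'].
Proof.
have Sr : S (r / 4).
  by split; [rewrite divr_gt0 | exact: isom_collar charts r0 U U_isom U_bd].
have Sub : has_ubound S.
  apply: contrapT => nub.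
  have [|t _|E lE EU] := @isom_glue [set t | 0 <= t]; first by [].
    apply: contrapT => h; apply: nub; exists t => s Ss.
    by rewrite leNgt; apply/negP => ts; apply: h; exists s.
  apply: (@half_space_noncompact R m M r charts r0 E lE) => // x.
  by rewrite EU//=.
have supS : has_sup S by split => //; exists (r / 4).
have T0 : 0 < sup S.
  have rp := r0.
  by rewrite (@lt_le_trans _ _ (r / 4)) ?divr_gt0//; exact: ub_le_sup.
have [|t /= /andP[_ ts]|E lE EU] := @isom_glue [set t | 0 <= t < sup S].
- by move=> t /andP[].
- by have [s Ss] := sup_gt supS.1 ts; exists s.
have [E' lE' EE'] := isom_close charts r0 T0 lE.
exists (sup S), E'; split=> //.
  by move=> x; rewrite EE' ?EU//= ?lexx// /dom/= ht_pt lexx.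
by move=> [T' [TT' ST']]; have := ub_le_sup Sub ST'; rewrite leNgt TT'.
Qed.

Lemma hat_isom (g : 'rV[R]_m -> 'rV[R]_m) (k : R -> R) w w' :
  (forall x y, euclid_dist (g x) (g y) = euclid_dist x y) ->
  (forall s t, (k s - k t) ^+ 2 = (s - t) ^+ 2) ->
  ed (pt (g (base w)) (k (ht w))) (pt (g (base w')) (k (ht w'))) = ed w w'.
Proof.
move=> gI kI; apply/eqP; rewrite -(@eqrXn2 _ 2)// ?ed_ge0//.
by rewrite ed_pt_sqr gI kI -ed_pt_sqr !pt_eta.
Qed.

(** [E] and its composite with [g] are developments with the same boundary values, so they coincide
    at every height. *)
Lemma isom_deck (T : R) E g : 0 < T -> loc_isom md (dom [set t | 0 <= t <= T]) E ->
  (forall x, E (pt x 0) = U x) -> isometric_deck g ->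
  forall x t, 0 <= t <= T -> E (pt (g x) t) = E (pt x t).
Proof.
move=> T0 lE EU [gI gU] x t tT.
set J := [set t | 0 <= t <= T] in lE; have tJ : thick J by exact: thick_cc.
have lg : loc_isom md (dom J) (fun w => E (pt (g (base w)) (ht w))).
  apply: (loc_isom_comp lE); first by move=> w; rewrite /dom/J/= ht_pt.
  by move=> w w'; exact: (@hat_isom g id).
have Jt : dom J (pt x t) by rewrite /dom/J/= ht_pt.
suff /(_ _ Jt) : forall w, dom J w -> E (pt (g (base w)) (ht w)) = E w.
  by rewrite base_pt ht_pt.
apply: (@isom_unique0 R m M r charts J _ _ T tJ lg lE T0).
- by move=> s /andP[s0 sT]; rewrite /J/= s0 ltW.
- by move=> y; rewrite ht_pt base_pt !EU.
- by move=> y; rewrite ht_pt base_pt EU.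
Qed.

Variable K : set 'rV[R]_m.
Hypothesis K_compact : compact K.
Hypothesis K_cover : forall x, exists2 g, isometric_deck g & K (g x).

Lemma slab_boundary : exists (T : R) E, [/\ 0 < T, loc_isom md (dom [set t | 0 <= t <= T]) E,
  forall x, E (pt x 0) = U x & forall x, bd (E (pt x T))].
Proof.
have rp := r0.
have [T [E [T0 lE EU noext]]] := maximal_slab; exists T, E; split=> //.
set J := [set t | 0 <= t <= T] in lE; have tJ : thick J by exact: thick_cc.
have JT (x : 'rV[R]_m) : dom J (pt x T) by rewrite /dom/J/= ht_pt lexx ltW.
(* Seen from the top hyperplane the slab lies below, hence the sign -1. A boundary point on this
   hyperplane forces height 0 on a whole ball of it, of radius independent of the point. *)
have near x x' : euclid_dist x x' < r -> bd (E (pt x T)) -> bd (E (pt x' T)).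
  move=> xx' bx; have [c h] := charts (E (pt x T)).
  have [ O hO H] := isom_chart tJ lE (JT x) h.
  have xx'r : ed (pt x T) (pt x' T) < r by rewrite ed_pt.
  have [x1 x2] := H _ (JT x') xx'r.
  apply/(chart_boundary h x1); rewrite x2.
  rewrite (isom_ht (s := -1) tJ lE (JT x) h hO H bx _ T0) ?ht_pt ?subrr ?mulr0//.
    by rewrite sqrrN expr1n.
  by move=> t; rewrite ltr_norml /J/= => /andP[t1 t2] t3; apply/andP; split; lra.
suff [x0 bx0] : exists x0, bd (E (pt x0 T)).
  move=> x; suff : forall u, 0 <= u <= 1 -> bd (E (pt (seg x0 x u) T)).
    by move=> /(_ 1); rewrite seg1; apply; rewrite ler01 lexx.
  set l := euclid_dist x0 x; have l0 : 0 < 1 + l by rewrite ltr_wpDr ?ed_ge0.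
  have small (a b : R) : `|a - b| * (1 + l) < r -> euclid_dist (seg x0 x a) (seg x0 x b) < r.
    by rewrite ed_seg; apply: le_lt_trans; rewrite ler_wpM2l// lerDr.
  apply: real_ind => t /andP[t0 t1] IH.
  pose d := r / (1 + l); have d0 : 0 < d by rewrite divr_gt0.
  have dsmall (a b : R) : `|a - b| < d -> euclid_dist (seg x0 x a) (seg x0 x b) < r.
    by move=> ab; apply: small; rewrite -ltr_pdivlMr.
  exists (d / 2); first by rewrite divr_gt0.
  move=> u /andP[tu ud] u1; have [t_0|tn0] := eqVneq t 0.
    apply: near bx0; rewrite -{1}(seg0 x0 x); apply: dsmall.
    by rewrite sub0r normrN ger0_norm; lra.
  have tp : 0 < t by rewrite lt_neqAle eq_sym tn0.
  pose b := Num.max 0 (t - d / 4).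
  have b0 : 0 <= b by rewrite le_max lexx.
  have bt : b < t by rewrite gt_max tp/=; lra.
  have db : t - d / 4 <= b by rewrite le_max lexx orbT.
  apply: near (IH b _); last by rewrite b0.
  by apply: dsmall; rewrite distrC ger0_norm; lra.
(* If no top point meets the boundary, the distance to it is bounded below over the compact [K],
   hence everywhere by deck invariance, and the slab extends beyond its maximal thickness. *)
apply: contrapT => /forallNP nbd; apply: noext.
have deck g := isom_deck (g := g) T0 lE EU.
pose P x (e : R) := forall q, md (E (pt x T)) q < e -> ~ bd q.
have [||e e0 HK] := @compact_uniform R _ K P K_compact.
- move=> x Kx; have [c h] := charts (E (pt x T)).
  have pp : md (E (pt x T)) (E (pt x T)) < r by rewrite mdistxx.
  have cpos : 0 < ht (c (E (pt x T))).
    rewrite lt_neqAle (chart_ht h pp) andbT eq_sym; apply/eqP => hc.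
    by apply: (nbd x); apply/(chart_boundary h pp).
  pose e := Num.min r (ht (c (E (pt x T)))).
  have e0 : 0 < e by rewrite lt_min r0.
  (* Balls are those of the sup norm; division by m + 1 makes the Euclidean distance less than
     e/2. *)
  exists (e / 2), (e / 2 / (m.+1)%:R); split; [by rewrite divr_gt0|by rewrite !divr_gt0|].
  move=> y xy q yq bq.
  have mp : 0 < m.+1%:R :> R by [].
  have ey : euclid_dist x y < e / 2.
    apply: (le_lt_trans (ed_sup_ball _ xy)); first by rewrite !divr_gt0.
    by rewrite mulrCA gtr_pMr ?divr_gt0// ltr_pdivrMr// mul1r ltr_nat.
  have xq : md (E (pt x T)) q < e.
    have := isom_lip tJ lE (JT x) (JT y); rewrite ed_pt => h1.
    by have := metric_triangle (E (pt x T)) (E (pt y T)) q; lra.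
  move: xq; rewrite lt_min => /andP[qr qh].
  have := (chart_boundary h qr).1 bq.
  have := ed_ht (c (E (pt x T))) (c q); rewrite (chart_center_dist h qr) => h1 h2.
  by move: (le_lt_trans h1 qh); rewrite h2 subr0 ltr_norml => /andP[]; lra.
- by move=> x e e' ee' Px q qe; apply: Px; exact: lt_le_trans ee'.
have [|T' [E' [TT' lE' EE']]] := isom_open charts r0 T0 e0 lE.
  move=> x q; have [g dg Kg] := K_cover x.
  by rewrite -(deck g dg) ?lexx ?ltW//; exact: HK.
exists T'; split=> //; split; first exact: lt_trans TT'.
exists E' => // x; rewrite EE'; first exact: EU.
by rewrite /dom/= ht_pt lexx ltW.
Qed.

Hypothesis U_onto : forall p, bd p -> exists x, U x = p.

(* sigma x is the foot of the second end of the normal segment issued from x; a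
   fixed point would make this segment coincide with its own reverse. *)
Lemma boundary_involution : exists sigma : 'rV[R]_m -> 'rV[R]_m,
  [/\ forall x y, euclid_dist (sigma x) (sigma y) = euclid_dist x y,
      forall g x, isometric_deck g -> U (sigma (g x)) = U (sigma x),
      forall x, U (sigma (sigma x)) = U x &
      forall g x, isometric_deck g -> sigma x <> g x].
Proof.
have rp := r0.
have [T [E [T0 lE EU bT]]] := slab_boundary.
set J := [set t | 0 <= t <= T] in lE; have tJ : thick J by exact: thick_cc.
pose E' w := E (pt (base w) (T - ht w)).
have lE' : loc_isom md (dom J) E'.
  apply: (loc_isom_comp lE) => [w|w w'].
    by rewrite /dom/J/= ht_pt => /andP[h1 h2]; apply/andP; split; lra.
  by apply: (@hat_isom id (fun t => T - t)) => // s t; ring.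
have E'0 x : E' (pt x 0) = E (pt x T) by rewrite /E' base_pt ht_pt subr0.
have [y0 Uy0] := U_onto (bT 0).
pose w0 : 'rV[R]_m.+1 := pt 0 0; pose w1 : 'rV[R]_m.+1 := pt y0 0.
have E01 : E' w0 = E w1 by rewrite E'0 -Uy0 EU.
have J0 (x : 'rV[R]_m) : dom J (pt x 0) by rewrite /dom/J/= ht_pt lexx ltW.
have [c h] := charts (E' w0); have h1 := h; rewrite E01 in h1.
have [ O1 hO1 H1] := isom_chart tJ lE' (J0 0) h.
have [ O2 hO2 H2] := isom_chart tJ lE (J0 y0) h1.
have HJ t : `|t - 0| < T -> 0 <= 1 * (t - 0) -> J t.
  rewrite subr0 mul1r /J/= => h2 h3; rewrite h3 /=.
  by move: h2; rewrite ger0_norm// => /ltW.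
have b0 : bd (E' w0) by rewrite E'0.
have b1 : bd (E w1) by rewrite -E01.
have K1 : forall w, ht (affm w0 (c (E' w0)) O1 w) = ht w.
  move=> w; rewrite (isom_ht (s := 1) tJ lE' (J0 0) h hO1 H1 b0 _ T0) ?expr1n//.
    by rewrite mul1r ht_pt subr0.
  by move=> t; rewrite ht_pt; exact: HJ.
have K2 : forall w, ht (affm w1 (c (E w1)) O2 w) = ht w.
  move=> w; rewrite (isom_ht (s := 1) tJ lE (J0 y0) h1 hO2 H2 b1 _ T0) ?expr1n//.
    by rewrite mul1r ht_pt subr0.
  by move=> t; rewrite ht_pt; exact: HJ.
(* [E'] is the development issued from the other face. It and [E] share the boundary point [E' w0];
   comparing both in one chart there yields an affine isometry [F] with [E'] equal to [E] after [F],
   first near [w0] and then by unique continuation. *)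
pose O := O1 *m O2^T.
have hO : orthomx O by apply: orthomxM => //; exact: orthomx_tr.
pose F := affm w0 w1 O.
have FI w w' : ed (F w) (F w') = ed w w' by exact: ed_affm.
have F2 w : affm w1 (c (E w1)) O2 (F w) = affm w0 (c (E' w0)) O1 w.
  by rewrite /F /affm addrAC subrr add0r -mulmxA -(mulmxA O1) orthomxV// mulmx1 E01.
have htF w : ht (F w) = ht w by rewrite -(K2 (F w)) F2 K1.
have lF : loc_isom md (dom J) (fun w => E (F w)).
  by apply: (loc_isom_comp lE) => // w; rewrite /dom/= htF.
have key : forall w, dom J w -> E' w = E (F w).
  apply: (isom_unique charts tJ lE' lF (J0 0) r0) => w Jw wr.
  have [v1 v2] := H1 _ Jw wr.
  have JF : dom J (F w) by rewrite /dom/= htF.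
  have Fr : ed w1 (F w) < r by rewrite -(affm_center w0 w1 O) FI.
  have [v1' v2'] := H2 _ JF Fr.
  apply: (chart_inj h) => //; first by rewrite E01.
  by rewrite v2 v2' F2.
pose sigma x := base (F (pt x 0)).
have Fpt x t : F (pt x t) = pt (sigma x) t.
  rewrite -[LHS]pt_eta htF ht_pt /sigma; congr pt.
  have -> : pt x t = pt x 0 + t *: delta_mx 0 ord_max.
    apply/rowP => j; rewrite !mxE eqxx; case: unliftP => [k|] ->;
      by rewrite ?mxE ?eqxx ?mulr1 ?add0r// eq_sym (negPf (neq_lift _ _)) mulr0 addr0.
  have dO : (delta_mx 0 ord_max : 'rV[R]_m.+1) *m O = delta_mx 0 ord_max.
    apply: ht_preserving => // v.
    have := htF (w0 + v); rewrite /F /affm addrAC subrr add0r !htD !ht_pt.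
    by rewrite !add0r.
  have -> : F (pt x 0 + t *: delta_mx 0 ord_max) = F (pt x 0) + t *: delta_mx 0 ord_max.
    by rewrite /F /affm addrAC mulmxDl -scalemxAl dO addrA.
  move: (F (pt x 0)) => f; apply/rowP => i.
  by rewrite !mxE eqxx eq_sym (negPf (neq_lift _ _)) mulr0 addr0.
have {}key x t : 0 <= t <= T -> E (pt x (T - t)) = E (pt (sigma x) t).
  move=> tT; have := key (pt x t); rewrite Fpt /E' base_pt ht_pt; apply.
  by rewrite /dom/J/= ht_pt.
have deck g := isom_deck (g := g) T0 lE EU.
have T00 : 0 <= (0 : R) <= T by apply/andP; split; lra.
have TTT : 0 <= (T : R) <= T by apply/andP; split; lra.
have sU x : U (sigma x) = E (pt x T) by rewrite -EU -key// subr0.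
exists sigma; split.
- by move=> x y; rewrite -[RHS](ed_pt x y 0) -FI !Fpt ed_pt.
- by move=> g x dg; rewrite !sU deck.
- by move=> x; rewrite sU -key// subrr EU.
move=> g x dg sg.
(* The heights T/2 + e and T/2 - e above [x] would have the same image, although [E] preserves
   distances at this scale. *)
pose e := Num.min T r / 4.
have e0 : 0 < e by rewrite divr_gt0// lt_min T0.
have eT : e <= T / 4 by rewrite ler_pM2r// ge_min lexx.
have er : e <= r / 4 by rewrite ler_pM2r// ge_min lexx orbT.
have t1 : 0 <= T / 2 - e <= T by apply/andP; split; lra.
have := key x _ t1; rewrite sg deck// => EE.
have Jw : dom J (pt x (T / 2)) by rewrite /dom/J/= ht_pt; apply/andP; split; lra.
have Jw1 : dom J (pt x (T - (T / 2 - e))) by rewrite /dom/J/= ht_pt; apply/andP; split; lra.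
have Jw2 : dom J (pt x (T / 2 - e)) by rewrite /dom/J/= ht_pt.
have d1 : `|T / 2 - (T - (T / 2 - e))| < r by rewrite ltr_norml; apply/andP; split; lra.
have d2 : `|T / 2 - (T / 2 - e)| < r by rewrite ltr_norml; apply/andP; split; lra.
have := isom_unif tJ lE Jw (charts _) Jw1 Jw2; rewrite !ed_pt_ht => /(_ d1 d2).
rewrite EE mdistxx => /esym/eqP; rewrite normr_eq0 => /eqP; lra.
Qed.

End Slab.

Lemma compact_chart_radius (R : realType) (m : nat) (M : metricType R) :
  compact [set: M] ->
  (forall p : M, exists r c, isometric_chart (@mdist R M) (@half_space R m) p r c) ->
  exists2 r : R, 0 < r &
    forall p : M, exists c, isometric_chart (@mdist R M) (@half_space R m) p r c.
Proof.
move=> cM chM.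
pose P (p : M) (r : R) := 0 < r -> exists c, isometric_chart (@mdist R M) (@half_space R m) p r c.
have [||r r0 H] := @compact_uniform R M setT P cM.
- move=> p _; have [r [c h]] := chM p; have r0 := chart_gt0 h.
  exists (r / 2), (r / 2); split; rewrite ?divr_gt0// => q.
  rewrite ballEmdist /= => pq _; exists c; apply: (chart_sub h); rewrite ?divr_gt0//.
  by rewrite lerBrDr -lerBrDl (le_trans (ltW pq))//; lra.
- move=> p r r' rr Pr r'0; have [c h] := Pr (lt_le_trans r'0 rr).
  by exists c; exact: chart_shrink h _ _.
by exists r => // p; exact: H.
Qed.

(** Injectivity of [f] turns equality of images under [U] into equality of orbits. The element [h]
    still depends on the point here; [pointwise_group] removes this dependence. *)
Theorem tg_boundary_involution (R : realType) (m : nat) (G : isom_group R m) (d : R)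
    (K : set 'rV[R]_m) : 0 < d -> displaces G d -> compact K ->
  (forall x, exists2 g, isoms G g & K (g x)) -> is_tg_boundary G ->
  exists sigma : 'rV[R]_m -> 'rV[R]_m,
  [/\ forall x y, euclid_dist (sigma x) (sigma y) = euclid_dist x y,
      forall g x, isoms G g -> exists2 h, isoms G h & sigma (g x) = h (sigma x),
      forall x, exists2 h, isoms G h & sigma (sigma x) = h x &
      forall g x, isoms G g -> sigma x <> g x].
Proof.
move=> d0 dG cK Kcov [M [[cM _ _ chM] [f [f_inj f_range f_isom]]]].
have [r r0 charts] := compact_chart_radius cM chM.
pose U x := f (proj G x).
have lU : loc_isom (@mdist R M) setT U.
  move=> w0 _; have [s s0 H] := f_isom (proj G w0).
  exists (Num.min s (d / 4)); first by rewrite lt_min s0 divr_gt0.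
  move=> w w' _ _; rewrite !lt_min => /andP[ws wd] /andP[ws' wd'].
  rewrite /U H; [|exact: le_lt_trans (qd_le G w0 w) ws|exact: le_lt_trans (qd_le G w0 w') ws'].
  apply: (qd_small d0 dG); have := ed_triangle w0 w w'; rewrite (ed_sym w w0); lra.
have bU x : manifold_boundary m M (U x) by rewrite -f_range; exists (proj G x).
have deck g : isoms G g -> isometric_deck U g.
  move=> Gg; split=> [x y|x]; first by rewrite (group_ed _ _ Gg).
  by rewrite /U proj_group.
have [||sigma [sI sG s2 sF]] := @boundary_involution R m M r charts r0 cM U lU bU K cK.
- by move=> x; have [g Gg Kg] := Kcov x; exists g => //; exact: deck.
- move=> p; rewrite -f_range => -[u _ <-]; have [x <-] := proj_surj u.
  by exists x.
have UP x y : U x = U y -> exists2 h, isoms G h & x = h y.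
  by move=> /f_inj/esym/projP[h Gh <-]; exists h.
exists sigma; split=> //.
- by move=> g x Gg; apply: UP; rewrite sG//; exact: deck.
- by move=> x; apply: UP; rewrite s2.
- by move=> g x Gg; apply: sF; exact: deck.
Qed.

(** * Half-lattice groups *)

(* A pair (D, v) of 4-bit words stands for the isometries of R^4 whose linear part
   changes the signs of the coordinates in D and whose translation part is, modulo
   the lattice, the sum of the half-periods in v. As a change of sign fixes every
   half-period modulo the lattice, composition is addition modulo 2. *)
Definition bxor (u v : seq bool) : seq bool := mkseq (fun j => nth false u j (+) nth false v j) 4.
Definition exor (e f : seq bool * seq bool) := (bxor e.1 f.1, bxor e.2 f.2).
Definition ezero : seq bool * seq bool := (nseq 4 false, nseq 4 false).

Fixpoint espan (s : seq (seq bool * seq bool)) : seq (seq bool * seq bool) :=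
  if s is e :: s' then espan s' ++ map (exor e) (espan s') else [:: ezero].

Definition eclosed (W : seq (seq bool * seq bool)) :=
  (ezero \in W) && all (fun e => all (fun f => exor e f \in W) W) W.

(* Freeness: some coordinate is translated by a half-period and keeps its sign. *)
Definition efree (W : seq (seq bool * seq bool)) :=
  all (fun e => (e == ezero) || has (fun j => ~~ nth false e.1 j && nth false e.2 j) (iota 0 4)) W.

Lemma nth_bxor u v (j : 'I_4) : nth false (bxor u v) j = nth false u j (+) nth false v j.
Proof. by rewrite nth_mkseq. Qed.

Lemma nth_ezero (j : nat) : (nth false ezero.1 j = false) * (nth false ezero.2 j = false).
Proof. by split; case: j => [|[|[|[|[|j]]]]]. Qed.

Section HalfLattice.
Variables (R : realType) (p : 'I_4 -> R).
Local Notation ed := (@euclid_dist R 4).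

Definition hl_map (e : seq bool * seq bool) (k : 'rV[int]_4) (x : 'rV[R]_4) : 'rV[R]_4 :=
  \row_j ((if nth false e.1 j then - x 0 j else x 0 j) +
          ((nth false e.2 j)%:R / 2 + (k 0 j)%:~R) * p j).

Definition half_lattice (W : seq (seq bool * seq bool)) : set ('rV[R]_4 -> 'rV[R]_4) :=
  [set g | exists2 e, e \in W & exists k, g = hl_map e k].

(** Integer part of a composite: on an axis kept by [e], two half-periods carry over to a period; on
    a reversed axis, the translation -1/2 is rewritten as 1/2 - 1. *)
Definition hl_compk (e f : seq bool * seq bool) (k l : 'rV[int]_4) : 'rV[int]_4 :=
  \row_j if nth false e.1 j then k 0 j - l 0 j - (~~ nth false e.2 j && nth false f.2 j)%:R
         else k 0 j + l 0 j + (nth false e.2 j && nth false f.2 j)%:R.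

Lemma hl_map_comp e f k l : hl_map e k \o hl_map f l = hl_map (exor e f) (hl_compk e f k l).
Proof.
apply/funext => x; apply/rowP => j; rewrite !mxE !nth_bxor.
case: (nth false e.1 j); case: (nth false f.1 j); case: (nth false e.2 j);
  case: (nth false f.2 j) => /=; rewrite ?(mulr0n, mulr1n, rmorphD, rmorphB, rmorph1, rmorph0) /=; by field.
Qed.

Lemma hl_map0 : hl_map ezero 0 = id.
Proof.
apply/funext => x; apply/rowP => j; rewrite !mxE !nth_ezero /=.
by rewrite mulr0n mulr0z !(mul0r, addr0).
Qed.

Definition hl_invk (e : seq bool * seq bool) (k : 'rV[int]_4) : 'rV[int]_4 :=
  \row_j if nth false e.1 j then k 0 j else - k 0 j - (nth false e.2 j)%:R.

Lemma hl_map_inv e k : cancel (hl_map e k) (hl_map e (hl_invk e k)).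
Proof.
move=> x; apply/rowP => j; rewrite !mxE.
case: (nth false e.1 j); case: (nth false e.2 j) => /=;
  rewrite ?(mulr0n, mulr1n, rmorphD, rmorphB, rmorphN, rmorph1, rmorph0) /=; by field.
Qed.

Lemma hl_invkK e k : hl_invk e (hl_invk e k) = k.
Proof.
by apply/rowP => j; rewrite !mxE; case: (nth false e.1 j) => //; rewrite opprB opprK addrAC subrr add0r.
Qed.

Lemma hl_map_ed e k x y : ed (hl_map e k x) (hl_map e k y) = ed x y.
Proof.
congr Num.sqrt; apply: eq_bigr => j _; rewrite !mxE.
by case: (nth false e.1 j); ring.
Qed.

Lemma hl_map_isometry e k : euclid_isometry (hl_map e k).
Proof.
split=> [x y|]; first exact: hl_map_ed.
exists (hl_map e (hl_invk e k)); first exact: hl_map_inv.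
by rewrite -{2}(hl_invkK e k); exact: hl_map_inv.
Qed.

Lemma half_lattice_isometry W : half_lattice W `<=` @euclid_isometry R 4.
Proof. by move=> _ [e _ [k ->]]; exact: hl_map_isometry. Qed.

Lemma half_lattice_closed W : eclosed W -> subgroup_closed (half_lattice W).
Proof.
move=> /andP[W0 /allP WD]; split.
- by exists ezero => //; exists 0; rewrite hl_map0.
- move=> _ _ [e We [k ->]] [f Wf [l ->]]; exists (exor e f).
    by have /allP := WD _ We; apply.
  by exists (hl_compk e f k l); rewrite hl_map_comp.
- move=> _ h [e We [k ->]] gh hg; exists e => //; exists (hl_invk e k).
  apply/funext => x; rewrite -{2}(hg x); apply/esym; exact: hl_map_inv.
Qed.

Lemma hl_map_trans k e l : hl_map ezero k \o hl_map e l = hl_map e (k + l).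
Proof.
apply/funext => x; apply/rowP => j; rewrite !mxE !nth_ezero rmorphD /=.
by case: (nth false e.1 j); field.
Qed.

Hypothesis p0 : forall j, 0 < p j.

Definition min_half_period : R := \big[Num.min/p ord0]_j p j / 2.

Lemma min_half_period_le j : min_half_period <= p j / 2.
Proof. by rewrite ler_pM2r//; apply: bigmin_le_cond. Qed.

Lemma min_half_period_gt0 : 0 < min_half_period.
Proof. by rewrite divr_gt0//; apply: lt_bigmin => //. Qed.

(** A nonzero lattice vector moves some coordinate by at least a period. Otherwise freeness gives a
    coordinate that keeps its sign and moves by an odd number of half-periods, hence by at least
    one. *)
Lemma hl_displaces W e k x : efree W -> e \in W -> hl_map e k <> id ->
  min_half_period <= ed x (hl_map e k x).
Proof.
move=> /allP fW We ne.
suff [j hj] : exists j, p j / 2 <= `|x 0 j - hl_map e k x 0 j|.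
  by rewrite (le_trans (min_half_period_le j))// (le_trans hj)// ed_coord.
have hint (z : int) : z != 0 -> 1 <= `|z%:~R : R|.
  by move=> z0; rewrite -intr_norm ler1z -gtz0_ge1 normr_gt0.
have /orP[/eqP e0|/hasP[i]] := fW _ We.
  have [k0|k0] := pselect (k = 0); first by case: ne; rewrite e0 k0 hl_map0.
  have /existsNP[j kj] : ~ forall j, k 0 j = 0.
    by move=> h; apply: k0; apply/rowP => j; rewrite h mxE.
  exists j; rewrite mxE e0 !nth_ezero mulr0n.
  rewrite mul0r add0r opprD addrA subrr add0r normrN normrM (gtr0_norm (p0 j)).
  have := hint _ (introN eqP kj); have := p0 j; nra.
rewrite mem_iota /= add0n => i4 /andP[Dj vj]; exists (Ordinal i4); set j := Ordinal i4.
rewrite mxE (negPf Dj) vj opprD addrA subrr add0r normrN normrM (gtr0_norm (p0 j)).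
have : 1 / 2 <= `|1 / 2 + (k 0 j)%:~R : R|.
  have : 1 <= `|(2 * k 0 j + 1)%:~R : R|.
    apply: hint; apply/eqP => h; have := congr1 (fun z => (z %% 2)%Z) h.
    by rewrite mulrC modzMDl.
  rewrite rmorphD rmorphM /= => h.
  by rewrite (_ : 1 / 2 + _ = (2 * (k 0 j)%:~R + 1) / 2) ?normrM ?(gtr0_norm (x := 2^-1)) ?invr_gt0//; [lra|field].
by have := p0 j; rewrite mul1r; nra.
Qed.

Definition hl_box : set 'rV[R]_4 := [set x | forall j, `[0, p j]%classic (x 0 j)].

Lemma hl_box_compact : compact hl_box.
Proof. exact: (rV_compact (fun j => @segment_compact R 0 (p j))). Qed.

Lemma hl_box_cover x : exists k, hl_box (hl_map ezero k x).
Proof.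
exists (\row_j - Num.floor (x 0 j / p j)) => j /=.
rewrite in_itv /= !mxE !nth_ezero mulr0n mul0r add0r rmorphN /= mulNr.
have /andP[f1 f2] := floor_itv (x 0 j / p j).
rewrite ler_pdivlMr// in f1; rewrite ltr_pdivrMr// rmorphD mulrDl mul1r in f2.
by apply/andP; split; lra.
Qed.

End HalfLattice.

(** * From pointwise relations to relations in the group *)

Section SigmaExtend.
Variables (R : realType) (n : nat) (G : isom_group R n) (d : R).
Hypotheses (d0 : 0 < d) (dG : displaces G d).
Local Notation ed := (@euclid_dist R n).

Lemma isometry_eq (f g : 'rV[R]_n -> 'rV[R]_n) (r : R) : 0 < r ->
  (forall x y, ed (f x) (f y) = ed x y) -> (forall x y, ed (g x) (g y) = ed x y) ->
  (forall x, ed 0 x < r -> f x = g x) -> forall x, f x = g x.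
Proof.
move=> r0 fI gI fg.
have [Of hf ef] := isometry_affm fI; have [Og hg eg] := isometry_affm gI.
have fg0 : f 0 = g 0 by apply: fg; rewrite edxx.
suff OO : Of = Og by move=> x; rewrite ef eg OO fg0.
apply: (affm_inj (z0 := f 0) (@fat_ball R n 0 r r0)) => x xr.
by rewrite /affm subr0 -ef fg// eg fg0.
Qed.

(* By discreteness, the element that realises a pointwise relation with an
   isometry is locally constant. *)
Lemma pointwise_group (f s : 'rV[R]_n -> 'rV[R]_n) :
  (forall x y, ed (f x) (f y) = ed x y) -> (forall x y, ed (s x) (s y) = ed x y) ->
  (forall x, exists2 h, isoms G h & f x = h (s x)) ->
  exists2 h, isoms G h & forall x, f x = h (s x).
Proof.
have dp := d0.
move=> fI sI fs; have [h0 Gh0 fh0] := fs 0; exists h0 => //.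
apply: (@isometry_eq _ (fun x => h0 (s x)) (d / 4)) => //; first by rewrite divr_gt0.
  by move=> x y; rewrite (group_ed _ _ Gh0).
move=> x xd; have [h Gh fh] := fs x.
suff -> : h0 = h by [].
apply: (displaces_inj dG (x := s x)) => //; rewrite -fh.
have := ed_triangle (f 0) (h0 (s x)) (f x).
rewrite {1}fh0 (group_ed _ _ Gh0) sI fI (ed_sym x); lra.
Qed.

End SigmaExtend.

(** * The groups of the table as half-lattice groups *)

Definition sgn_mask (P : seq 'I_4) : seq bool := [seq j \in map (@nat_of_ord 4) P | j <- iota 0 4].

Lemma nth_sgn_mask P (j : 'I_4) : nth false (sgn_mask P) j = (j \in P).
Proof.
by rewrite (nth_map 0%N) ?size_iota// nth_iota// add0n mem_map//; exact: val_inj.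
Qed.

Definition HW_gens i : seq (seq bool * seq bool) :=
  [seq (sgn_mask w.2, sgn_mask w.1) | w <- HW_table i].
Definition HW_elts i := espan (HW_gens i).

Section HW.
Variables (R : realType) (a b c d : R).
Hypotheses (a0 : 0 < a) (b0 : 0 < b) (c0 : 0 < c) (d0 : 0 < d).
Local Notation p := (period a b c d).

Lemma period_gt0 j : 0 < p j.
Proof. by case: j => [[|[|[|[|j]]]] //= _]. Qed.

Lemma T_SE P Q : T_S a b c d P Q = hl_map p (sgn_mask Q, sgn_mask P) 0.
Proof.
apply/funext => x; apply/rowP => j; rewrite !mxE !nth_sgn_mask.
by congr (_ + _); rewrite mulr0z addr0; case: ifP => _; rewrite ?mulr0n ?mul0r// mulr1n mulrC mul1r.
Qed.

Lemma lattice_translationE k : lattice_translation a b c d k = hl_map p ezero (delta_mx 0 k).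
Proof.
apply/funext => x; apply/rowP => j; rewrite !mxE !nth_ezero mulr0n mul0r add0r eqxx /=.
by congr (_ + _); case: eqP => [->|_]; rewrite ?mulr1z ?mul1r ?mulr0z ?mul0r.
Qed.

Definition egood i := eclosed (HW_elts i) && all (fun e => e \in HW_elts i) (HW_gens i).

Lemma HW_good i : (1 <= i <= 12)%N -> egood i.
Proof.
have : all egood (iota 1 12) by vm_compute.
by move=> /allP h i12; apply: h; rewrite mem_iota.
Qed.

Lemma HW_isoms i : (1 <= i <= 12)%N ->
  isoms (HW_group a b c d i) = half_lattice p (HW_elts i).
Proof.
move=> /HW_good/andP[Wc /allP Wg]; apply/seteqP; split=> [g [Ig Hg]|g].
  apply: Hg; split; first exact: half_lattice_closed.
  move=> h [[k _ <-]|[w wi <-]].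
    rewrite lattice_translationE; exists ezero; first by have /andP[] := Wc.
    by exists (delta_mx 0 k).
  rewrite T_SE; exists (sgn_mask w.2, sgn_mask w.1); last by exists 0.
  by apply: Wg; apply/mapP; exists w.
move=> [e We [k ->]]; split; first exact: hl_map_isometry.
move=> H [[Hid HM HV] HS].
have HT l : H (hl_map p ezero l).
  have Hadd u v : H (hl_map p ezero u) -> H (hl_map p ezero v) -> H (hl_map p ezero (u + v)).
    by rewrite -hl_map_trans; exact: HM.
  have Hopp u : H (hl_map p ezero u) -> H (hl_map p ezero (- u)).
    move=> Hu; apply: (HV _ _ Hu) => x.
      by have := congr1 (@^~ x) (hl_map_trans p (- u) ezero u); rewrite /= addNr hl_map0.
    by have := congr1 (@^~ x) (hl_map_trans p u ezero (- u)); rewrite /= addrN hl_map0.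
  have H0 : H (hl_map p ezero 0) by rewrite hl_map0.
  rewrite [l]row_sum_delta; elim/big_ind: _ => // j _.
  have Hd : H (hl_map p ezero (delta_mx 0 j)).
    by apply: HS; left; exists j => //; rewrite lattice_translationE.
  have Hn (m : nat) : H (hl_map p ezero (m%:Z *: delta_mx 0 j)).
    elim: m => [|m IH]; first by rewrite scale0r.
    by rewrite intS scalerDl scale1r; exact: Hadd.
  case: (l 0 j) => m; first exact: Hn.
  by rewrite NegzE scaleNr; apply: Hopp; exact: Hn.
(* All lattice translations lie in [H], so it is enough to reach the class [e] with some integer
   part. *)
suff [l Hl] : exists l, H (hl_map p e l).
  by rewrite -(subrK l k) -hl_map_trans; exact: HM.
have : all (fun e => e \in HW_gens i) (HW_gens i) by apply/allP.
(* The induction is on a list whose span contains [e]; the membership of its entries in the full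
   list of generators is kept aside. *)
move: We; rewrite /HW_elts; elim: {1 3}(HW_gens i) e => [|f s IH] e /=.
  by rewrite inE => /eqP -> _; exists 0.
rewrite mem_cat => /orP[es|/mapP[e' e's ->]] /andP[fs ss]; first exact: IH.
have [l Hl] := IH _ e's ss.
exists (hl_compk f e' 0 l); rewrite -hl_map_comp; apply: HM => //.
apply: HS; right; have /mapP[w wi ->] := fs; exists w => //.
by rewrite T_SE.
Qed.

Lemma HW_free i : (1 <= i <= 12)%N -> efree (HW_elts i).
Proof.
have : all (fun i => efree (HW_elts i)) (iota 1 12) by vm_compute.
by move=> /allP h i12; apply: h; rewrite mem_iota.
Qed.

Lemma HW_displaces i : (1 <= i <= 12)%N -> displaces (HW_group a b c d i) (min_half_period p).
Proof.
move=> i12 g; rewrite HW_isoms// => -[e We [k ->]] ne x.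
exact: (hl_displaces period_gt0 _ (HW_free i12) We ne).
Qed.

Lemma HW_cover i : (1 <= i <= 12)%N ->
  forall x, exists2 g, isoms (HW_group a b c d i) g & hl_box p (g x).
Proof.
move=> i12 x; have [k hk] := hl_box_cover period_gt0 x.
exists (hl_map p ezero k) => //; rewrite HW_isoms//; exists ezero; last by exists k.
by have /andP[/andP[]] := HW_good i12.
Qed.

End HW.

(** * H-W_1 to H-W_4 are not boundaries *)

Notation chi e j := (nth false e.1 j).
Notation vee e j := (nth false e.2 j).
Notation elt := (seq bool * seq bool)%type.

Fixpoint words (T : Type) (A : seq T) n : seq (seq T) :=
  if n is n'.+1 then [seq x :: s | x <- A, s <- words A n'] else [:: [::]].

Lemma mem_words (T : eqType) (A s : seq T) : {subset s <= A} -> s \in words A (size s).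
Proof.
elim: s => [|x s IH] sA //=; apply/allpairsP; exists (x, s); split => //=.
  by apply: sA; rewrite mem_head.
by apply: IH => y ys; apply: sA; rewrite inE ys orbT.
Qed.

Lemma mem_bool_words (s : seq bool) : s \in words [:: true; false] (size s).
Proof. by apply: mem_words; case. Qed.

(* The coordinates carry distinct characters of the holonomy group, so that the
   linear part of an isometry normalising the group is a signed permutation. *)
Definition edistinct (W : seq elt) :=
  all (fun j => all (fun j' => (j == j') || has (fun e => chi e j != chi e j') W) (iota 0 4)) (iota 0 4).

(** The holonomy determines the half-periods, so a class is recognised from its signs alone. *)
Definition efaithful (W : seq elt) :=
  all (fun e => all (fun f => all (fun j => chi e j == chi f j) (iota 0 4) ==> (e == f)) W) W.

(* Necessary conditions for an isometry whose linear part sends the coordinate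
   ps j to the coordinate j, up to signs, to normalise the group. *)
Definition ecompat (W : seq elt) (ps : seq nat) :=
  all (fun e => has (fun f => all (fun j => (chi f j == chi e (nth 0 ps j)%N) &&
    (chi e (nth 0 ps j)%N || (vee f j == vee e (nth 0 ps j)%N))) (iota 0 4)) W) W.

Definition einvol (ps : seq nat) := all (fun j => nth 0%N ps (nth 0%N ps j) == j) (iota 0 4).

(* If sigma preserves the coordinate axes, with signs s and with a translation part
   that is a half-period vector b, then some element of sigma Gamma fixes a point:
   on each axis, either the sign of the composite is -1 or its translation part
   is a period. *)
Definition efixes (W : seq elt) :=
  all (fun s => all (fun b => has (fun e =>
    all (fun j => (chi e j != nth false s j) || (nth false b j == vee e j)) (iota 0 4)) W)
    (words [:: true; false] 4)) (words [:: true; false] 4).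

(* The case where sigma exchanges the coordinates y and t (it occurs for H-W_1
   only, when b = d): the first and third clauses force the sign of sigma on the
   x axis, the second one then yields an element of sigma Gamma with a fixed point. *)
Definition eswap (W : seq elt) :=
  all (fun f => [&& ~~ chi f 0%N, ~~ chi f 2%N & chi f 1%N == chi f 3%N] ==>
    [&& vee f 0%N == chi f 1%N, ~~ vee f 1%N & ~~ vee f 3%N]) W &&
  all (fun s => (nth false s 0%N != (nth false s 1%N (+) nth false s 3%N)) ==>
    has (fun e => [&& chi e 0%N != nth false s 0%N, chi e 2%N != nth false s 2%N,
       ~~ chi e 1%N, chi e 3%N == (nth false s 1%N (+) nth false s 3%N) & vee e 1%N == vee e 3%N]) W)
    (words [:: true; false] 4) &&
  has (fun e => ~~ vee e 0%N && chi e 0%N && all (fun f => [&& chi f 0%N, chi f 1%N == chi e 3%N, chi f 2%N == chi e 2%N & chi f 3%N == chi e 1%N] ==> vee f 0%N) W) W.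

(** All 256 words are tested: [einvol] already forces a word to be a permutation. *)
Definition eobstructed (W : seq elt) := [&& edistinct W, efaithful W, efixes W &
  all (fun ps => ecompat W ps && einvol ps ==>
    ((ps == [:: 0; 1; 2; 3]%N) || ((ps == [:: 0; 3; 2; 1]%N) && eswap W))) (words (iota 0 4) 4)].

Lemma HW_obstructed i : i \in [:: 1; 2; 3; 4]%N -> eobstructed (HW_elts i).
Proof.
have : all (fun i => eobstructed (HW_elts i)) [:: 1; 2; 3; 4]%N by vm_compute.
by move=> /allP; apply.
Qed.

(** * Fixed points from a normalising isometry *)

Section Obstruction.
Variables (R : realType) (p : 'I_4 -> R).
Hypothesis p0 : forall j, 0 < p j.
Local Notation ed := (@euclid_dist R 4).

Lemma hl_mapE e k x j : hl_map p e k x 0 j =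
  (-1) ^+ (chi e j) * x 0 j + ((vee e j)%:R / 2 + (k 0 j)%:~R) * p j.
Proof. by rewrite mxE; case: (chi e j); rewrite ?expr1 ?expr0 ?mulN1r ?mul1r. Qed.

(** In units of q/2 both sides are integers, of parities [v] and [w]; a sign does not change
    parity. *)
Lemma half_int_parity (s v w : bool) (k l : int) (q : R) : 0 < q ->
  (-1) ^+ s * ((v%:R / 2 + k%:~R) * q) = (w%:R / 2 + l%:~R) * q -> v = w.
Proof.
move=> q0 h.
have {h} : (-1) ^+ s * (v%:R + 2 * k%:~R) = w%:R + 2 * l%:~R :> R.
  by apply: (mulIf (lt0r_neq0 q0)); lra.
have -> : (-1) ^+ s * (v%:R + 2 * k%:~R) = ((-1) ^+ s * (v%:R + 2 * k) : int)%:~R :> R.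
  by rewrite !(rmorphM, rmorphD, rmorphXn, rmorphN1) /=; case: (v).
have -> : w%:R + 2 * l%:~R = (w%:R + 2 * l : int)%:~R :> R.
  by rewrite rmorphD rmorphM /=; case: (w).
move=> /intr_inj; case: s; case: v; case: w => //=;
  rewrite ?(expr1, expr0) ?mulN1r ?mul1r ?mulr0n ?mulr1n; lia.
Qed.

Lemma int_half (n : int) : exists (b : bool) (q : int), n = q * 2 + b%:R.
Proof.
case: n => m; first by exists (odd m), (m./2 : int); case: odd (odd_double_half m); lia.
exists (odd m.+1), (- ((m.+1)./2 + odd m.+1)%N%:Z).
by have := odd_double_half m.+1; case: odd; lia.
Qed.

(** Serves to turn an inequality between periods along a permutation into equalities. *)
Lemma sumr_eq_le (F H : 'I_4 -> R) : (forall j, F j <= H j) ->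
  \sum_j F j = \sum_j H j -> forall j, F j = H j.
Proof.
move=> FH S j; apply/eqP; rewrite eq_sym -subr_eq0.
have : \sum_j (H j - F j) = 0 by rewrite sumrB S subrr.
move/eqP; rewrite psumr_eq0 => [/allP h|i _]; last by rewrite subr_ge0.
exact: h (mem_index_enum j).
Qed.

Lemma obstructed (W : seq elt) (sigma : 'rV[R]_4 -> 'rV[R]_4) :
  ezero \in W -> eobstructed W ->
  (forall x y, ed (sigma x) (sigma y) = ed x y) ->
  (forall (e : elt) k, e \in W -> exists2 f, f \in W & exists l, forall x,
     sigma (hl_map p e k x) = hl_map p f l (sigma x)) ->
  (exists2 f : elt, f \in W & exists l, forall x, sigma (sigma x) = hl_map p f l x) ->
  exists2 e : elt, e \in W & exists k x, sigma x = hl_map p e k x.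
Proof.
move=> W0 /and4P[dW fW xW pW] sI sN sS.
have [ O hO sE] := isometry_affm sI; set s0 := sigma 0 in sE.
have hOt := orthomxV hO.
have idx (j : 'I_4) : (j : nat) \in iota 0 4 by rewrite mem_iota /=.
(* Conjugation by sigma, read axis by axis: comparison at the origin gives the translation parts,
   comparison at the basis vectors the linear parts. *)
have N (e : elt) (k : 'rV[int]_4) : e \in W -> exists2 f, f \in W &
    exists l : 'rV[int]_4, forall i : 'I_4,
    (forall j : 'I_4, (-1) ^+ (chi e j) * O j i = (-1) ^+ (chi f i) * O j i) /\
    s0 0 i + \sum_(j < 4) ((vee e j)%:R / 2 + (k 0 j)%:~R) * p j * O j i =
    (-1) ^+ (chi f i) * s0 0 i + ((vee f i)%:R / 2 + (l 0 i)%:~R) * p i.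
  move=> We; have [f Wf [l H]] := sN e k We; exists f => //; exists l => i.
  have C : s0 0 i + \sum_(j < 4) ((vee e j)%:R / 2 + (k 0 j)%:~R) * p j * O j i =
    (-1) ^+ (chi f i) * s0 0 i + ((vee f i)%:R / 2 + (l 0 i)%:~R) * p i.
    have := congr1 (fun z : 'rV[R]_4 => z 0 i) (H 0); rewrite hl_mapE -/s0 => <-.
    rewrite sE [RHS]mxE [X in _ = _ + X]mxE; congr (_ + _); apply: eq_bigr => j _.
    by rewrite hl_mapE mxE mulr0 add0r.
  split=> // j.
  have := congr1 (fun z : 'rV[R]_4 => z 0 i) (H (delta_mx 0 j)).
  rewrite hl_mapE !sE ![(s0 + _) 0 i]mxE -rowE [row j O 0 i]mxE.
  rewrite (_ : (hl_map p e k (delta_mx 0 j) *m O) 0 i = (-1) ^+ (chi e j) * O j i +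
    \sum_(j < 4) ((vee e j)%:R / 2 + (k 0 j)%:~R) * p j * O j i); first lra.
  rewrite mxE; under eq_bigr do rewrite hl_mapE mulrDl.
  rewrite big_split /= (bigD1 j)//= mxE !eqxx mulr1 big1 ?addr0// => j' jj'.
  by rewrite mxE (negPf jj') andbF mulr0 mul0r.
have sgnI (u v : bool) (z : R) : (-1) ^+ u * z = (-1) ^+ v * z -> z != 0 -> u = v.
  move=> h z0; move: h; case: u; case: v => //=; rewrite ?expr0 ?expr1 => h;
  by case/eqP: z0; lra.
(* Two nonzero entries in column i would give the axes j and j' the same character. *)
have uniq (i j j' : 'I_4) : O j i != 0 -> O j' i != 0 -> j = j'.
  move=> Oj Oj'; apply/val_inj/eqP; apply: contraT => jj'.
  have := allP (allP dW _ (idx j)) _ (idx j'); rewrite (negPf jj') /= => /hasP[e We].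
  have [f _ [l H]] := N e 0 We; have [H1 _] := H i.
  by rewrite (sgnI _ _ _ (H1 j) Oj) (sgnI _ _ _ (H1 j') Oj') eqxx.
have colnorm (i : 'I_4) : \sum_j O j i ^+ 2 = 1.
  have := congr1 (fun A : 'M[R]_4 => A i i) hOt; rewrite !mxE eqxx mulr1n => <-.
  by apply: eq_bigr => j _; rewrite mxE expr2.
have /choice[pi Ppi] : forall i : 'I_4, exists j : 'I_4, O j i != 0.
  move=> i; apply: contrapT => /forallNP h; have := colnorm i.
  rewrite big1 => [/eqP|j _]; first by rewrite eq_sym oner_eq0.
  by have /negP := h j; rewrite negbK => /eqP ->; rewrite expr0n.
have O0 i j : j != pi i -> O j i = 0.
  move=> jp; apply/eqP; apply: contraT => Oj; case/negP: jp; apply/eqP.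
  exact: uniq Oj (Ppi i).
have O1 i : O (pi i) i ^+ 2 = 1.
  rewrite -[RHS](colnorm i) (bigD1 (pi i))//= big1 ?addr0// => j jp.
  by rewrite O0// expr0n.
have /choice[sb Psb] : forall i : 'I_4, exists b : bool, O (pi i) i = (-1) ^+ b.
  move=> i; have := O1 i; move/eqP; rewrite -subr_eq0 subr_sqr_1 mulf_eq0.
  move=> /orP[/eqP h|/eqP h]; [exists false|exists true]; rewrite ?expr0 ?expr1; lra.
have sumO i (F : 'I_4 -> R) : \sum_j F j * O j i = (-1) ^+ (sb i) * F (pi i).
  rewrite (bigD1 (pi i))//= big1 ?addr0 ?Psb 1?mulrC// => j jp.
  by rewrite O0// mulr0.
have piI : injective pi.
  move=> i i' ii'; apply/eqP; apply: contraT => ne.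
  have := congr1 (fun A : 'M[R]_4 => A i i') hOt; rewrite !mxE (negPf ne) mulr0n.
  under eq_bigr do rewrite mxE.
  rewrite sumO -ii' => /eqP; rewrite mulf_eq0 signr_eq0 /= => /eqP O0'.
  by have := Ppi i; rewrite O0' eqxx.
have sigE x i : sigma x 0 i = s0 0 i + (-1) ^+ (sb i) * x 0 (pi i).
  by rewrite sE !mxE sumO.
have {}N (e : elt) (k : 'rV[int]_4) : e \in W -> exists2 f, f \in W &
    exists l : 'rV[int]_4, forall i : 'I_4,
    chi f i = chi e (pi i) /\
    s0 0 i + (-1) ^+ (sb i) * (((vee e (pi i))%:R / 2 + (k 0 (pi i))%:~R) * p (pi i)) =
    (-1) ^+ (chi f i) * s0 0 i + ((vee f i)%:R / 2 + (l 0 i)%:~R) * p i.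
  move=> We; have [f Wf [l H]] := N e k We; exists f => //; exists l => i.
  have [H1 H2] := H i; split; last by rewrite -H2 sumO.
  by apply/esym/(sgnI _ _ _ (H1 _)).
have faith (e f : elt) : e \in W -> f \in W -> (forall j : 'I_4, chi e j = chi f j) -> e = f.
  move=> We Wf ef; have := allP (allP fW _ We) _ Wf; move=> /implyP h.
  apply/eqP/h/allP => j; rewrite mem_iota /= add0n => j4.
  by rewrite (ef (Ordinal j4)).
(* Conjugating the translation by one period along [pi j] gives a nonzero lattice translation along
   j, so [p j] is at most [p (pi j)]; summing over the permutation forces equality. *)
have per i : p (pi i) = p i.
  have le j : p j <= p (pi j).
    have [f Wf [l H]] := N ezero (delta_mx 0 (pi j)) W0.
    have fz : f = ezero.
      by apply: faith => // t; have [-> _] := H t; rewrite !nth_ezero.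
    have [_] := H j; rewrite fz !nth_ezero mulr0n mul0r !add0r expr0 mul1r mxE !eqxx.
    rewrite mulr1z mul1r => /addrI hj.
    have l0 : l 0 j != 0.
      apply/eqP => l0; move: hj; rewrite l0 mulr0z mul0r => /eqP.
      by rewrite mulf_eq0 signr_eq0 /= gt_eqF.
    have : 1 <= `|(l 0 j)%:~R : R| by rewrite -intr_norm ler1z -gtz0_ge1 normr_gt0.
    have -> : p (pi j) = `|(l 0 j)%:~R : R| * p j.
      by rewrite -(gtr0_norm (p0 (pi j))) -[X in _ * X](gtr0_norm (p0 j)) -normrM -hj normrM normrX normrN1 expr1n mul1r.
    by have := p0 j; nra.
  apply/esym/(@sumr_eq_le p (fun i => p (pi i))) => //.
  by rewrite [LHS](reindex_inj piI).
have [fs Wfs [ls Hs]] : exists2 f, f \in W & exists l : 'rV[int]_4, forall i : 'I_4, [/\ pi (pi i) = i,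
    sb i (+) sb (pi i) = chi f i &
    s0 0 i + (-1) ^+ (sb i) * s0 0 (pi i) = ((vee f i)%:R / 2 + (l 0 i)%:~R) * p i].
  have [f Wf [l H]] := sS; exists f => //; exists l => i.
  have C : s0 0 i + (-1) ^+ (sb i) * s0 0 (pi i) = ((vee f i)%:R / 2 + (l 0 i)%:~R) * p i.
    have := congr1 (fun z : 'rV[R]_4 => z 0 i) (H 0).
    by rewrite sigE sigE hl_mapE !mxE !mulr0 addr0 add0r.
  have := congr1 (fun z : 'rV[R]_4 => z 0 i) (H (delta_mx 0 (pi (pi i)))).
  rewrite sigE sigE hl_mapE !mxE !eqxx mulr1 mulrDr addrA C addrC => /addIr.
  have [ii|ne] := eqVneq i (pi (pi i)); last first.
    by rewrite mulr0 -signr_addb => /eqP; rewrite signr_eq0.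
  rewrite mulr1 -signr_addb => h; split=> //.
  by apply: (@sgnI _ _ 1); rewrite ?oner_eq0// !mulr1.
pose ps := [seq (pi (inord j) : nat) | j <- iota 0 4].
have psE (j : 'I_4) : nth 0%N ps j = pi j.
  by rewrite (nth_map 0%N) ?size_iota// nth_iota// add0n inord_val.
have psm : ps \in words (iota 0 4) 4.
  by apply: (@mem_words _ _ ps) => j /mapP[j' _ ->]; exact: idx.
have compat : ecompat W ps.
  apply/allP => e We; have [f Wf [l H]] := N e 0 We; apply/hasP; exists f => //.
  apply/allP => j'; rewrite mem_iota /= add0n => j4; set j := Ordinal j4.
  have -> : j' = j :> nat by [].
  rewrite psE; have [ch co] := H j; rewrite ch eqxx /=.
  case: (boolP (chi e (pi j))) => //= ce; apply/eqP/esym.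
  move: co; rewrite ch (negPf ce) expr0 mul1r per => /addrI; exact: half_int_parity.
have invol : einvol ps.
  apply/allP => j'; rewrite mem_iota /= add0n => j4; set j := Ordinal j4.
  have -> : j' = j :> nat by [].
  by rewrite psE psE; have [-> _ _] := Hs j.
have := allP pW _ psm; rewrite compat invol /= => /orP[/eqP psid|/andP[/eqP psw swW]].
  have pid i : pi i = i.
    apply/val_inj; rewrite /= -psE psid.
    by case: i => [[|[|[|[|]]]]].
  have half i (n : int) : 2 * s0 0 i = n%:~R * p i ->
      exists (b : bool) (q : int), s0 0 i = (b%:R / 2 + q%:~R) * p i.
    have [b [q ->]] := int_half n => h; exists b, q.
    move: h; rewrite rmorphD rmorphM /=; case: b; rewrite ?mulr1n ?mulr0n ?rmorph1 ?rmorph0; lra.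
  have fs0 : fs = ezero.
    by apply: faith => // i; have [_ <- _] := Hs i; rewrite pid addbb nth_ezero.
  (* If some class reverses axis i, its conjugate gives the half-period; if none does and sigma
     keeps the axis, the square of sigma gives it. Otherwise every composite reverses the axis and
     [false] is a mere default. *)
  have /choice[be Pbe] : forall i : 'I_4, exists b : bool,
      (sb i /\ forall e, e \in W -> ~~ chi e i) \/ exists n : int, s0 0 i = (b%:R / 2 + n%:~R) * p i.
    move=> i; have [[e [We ce]]|ne] := pselect (exists e, e \in W /\ chi e i).
      have [f Wf [l H]] := N e 0 We.
      have fe : f = e by apply: faith => // j; have [-> _] := H j; rewrite pid.
      have [_] := H i; rewrite pid fe ce expr1 mxE mulr0z addr0 => h.
      suff [n /half[b bn]] : exists n : int, 2 * s0 0 i = n%:~R * p i by exists b; right.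
      case: (sb i) h; rewrite ?expr0 ?expr1; case: (vee e i); rewrite ?mulr1n ?mulr0n => h.
      - by exists (l 0 i + 1); rewrite rmorphD /=; lra.
      - by exists (l 0 i); lra.
      - by exists (l 0 i); lra.
      - by exists (l 0 i); lra.
    have nch e : e \in W -> ~~ chi e i.
      by move=> We; apply/negP => ce; apply: ne; exists e.
    case: (boolP (sb i)) => [si|nsi]; first by exists false; left.
    have [_ _] := Hs i; rewrite pid fs0 nth_ezero (negPf nsi) expr0 mulr0n => h.
    have [|b bn] := half i (ls 0 i); first by lra.
    by exists b; right.
  pose ss := [seq sb (inord j) | j <- iota 0 4].
  pose bs := [seq be (inord j) | j <- iota 0 4].
  have ssE (j : 'I_4) : nth false ss j = sb j.
    by rewrite (nth_map 0%N) ?size_iota// nth_iota// add0n inord_val.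
  have bsE (j : 'I_4) : nth false bs j = be j.
    by rewrite (nth_map 0%N) ?size_iota// nth_iota// add0n inord_val.
  have := allP xW ss (mem_bool_words ss) => /allP/(_ bs (mem_bool_words bs))/hasP[e We /allP He].
  exists e => //.
  (* The fixed point equation splits by axes. Opposite signs make it solvable in [u] with k = 0; for
     equal signs the half-period bits agree and [k] absorbs the integral difference, with u = 0. *)
  have /choice[k /choice[u Pu]] : forall i : 'I_4, exists (k : int) (u : R),
      s0 0 i + (-1) ^+ (sb i) * u = (-1) ^+ (chi e i) * u + ((vee e i)%:R / 2 + k%:~R) * p i.
    move=> i; have := He _ (idx i); rewrite ssE bsE.
    have [ce|/negPn/eqP ce] := boolP (chi e i != sb i).
      by move=> _; exists 0; exists ((-1) ^+ (chi e i) * (s0 0 i - (vee e i)%:R / 2 * p i) / 2);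
        move: ce; case: (chi e i); case: (sb i); rewrite // ?expr0 ?expr1 mulr0z => _; field.
    rewrite ce /= => /eqP bv; have [[si nch]|[n hn]] := Pbe i.
      by have := nch e We; rewrite ce si.
    by exists n; exists 0; rewrite !mulr0 addr0 add0r -bv.
  exists (\row_j k j), (\row_j u j); apply/rowP => i.
  by rewrite sigE hl_mapE !mxE pid Pu.
pose i0 : 'I_4 := @Ordinal 4 0 isT; pose i1 : 'I_4 := @Ordinal 4 1 isT.
pose i2 : 'I_4 := @Ordinal 4 2 isT; pose i3 : 'I_4 := @Ordinal 4 3 isT.
have [q0 q1 q2 q3] : [/\ pi i0 = i0, pi i1 = i3, pi i2 = i2 & pi i3 = i1].
  by split; apply/val_inj; rewrite /= -psE psw.
move: swW => /andP[/andP[/allP A /allP B] /hasP[g Wg /andP[/andP[g0 g0'] /allP C]]].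
have [_ c0 h0] := Hs i0; have [_ c1 h1] := Hs i1; have [_ c2 h2] := Hs i2.
have [_ c3 h3] := Hs i3.
rewrite q0 addbb in c0; rewrite q2 addbb in c2; rewrite q1 in c1; rewrite q3 in c3.
have := A _ Wfs; rewrite -c0 -c2 -c1 -c3 addbC eqxx /= => /and3P[/eqP v0 v1 v3].
(* [g] reverses x without a half-translation there, while its conjugate has one: twice the x
   translation of sigma is an odd multiple of half the period. *)
have [f Wf [l H]] := N g 0 Wg.
have [f0 fh0] := H i0; have [f1 _] := H i1; have [f2 _] := H i2; have [f3 _] := H i3.
rewrite q0 in f0 fh0; rewrite q1 in f1; rewrite q2 in f2; rewrite q3 in f3.
have := C _ Wf; rewrite f0 f1 f2 f3 !eqxx g0' /= => vf0.
move: fh0; rewrite f0 g0' expr1 (negPf g0) mulr0n vf0 mulr1n mxE mulr0z => fh0.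
(* Otherwise the square of sigma contradicts parity on the x axis: if sigma reverses x, then 0 is an
   odd number of half-periods; if not, twice its x translation is also a whole number of periods. *)
have sbu : sb i0 != (sb i1 (+) sb i3).
  apply/eqP => h; suff : false = true by [].
  move: h0 fh0; rewrite q0 v0 addbC -h; case: (sb i0);
    rewrite ?expr0 ?expr1 ?mulr0n ?mulr1n => h0 fh0.
    by apply: (@half_int_parity false false true 0 (ls 0 i0) _ (p0 i0));
      rewrite expr0 mulr0z mulr0n mulr1n; lra.
  by apply: (@half_int_parity false false true (ls 0 i0) (l 0 i0) _ (p0 i0));
    rewrite expr0 mulr0n mulr1n; lra.
pose ss := [:: sb i0; sb i1; sb i2; sb i3].
have := B ss (mem_bool_words ss); rewrite /= sbu /= => /hasP[e We /and5P[e0 e2 e1 /eqP e3 /eqP ev]].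
exists e => //.
(* On x and z the signs differ and [sol] solves the equation. On the exchanged axes the coordinate t
   is set to 0, the y equation then gives y, and the t equation, by the square of sigma, holds for
   the integer [k3]. *)
pose v : R := (vee e 1%N)%:R / 2.
pose k3 : int := ls 0 i3 - (if sb i3 then 0 else (vee e 1%N)%:R).
exists (\row_j nth 0 [:: 0; 0; 0; k3] j).
pose sol (j : 'I_4) := (-1) ^+ (chi e j) * (s0 0 j - (vee e j)%:R / 2 * p j) / 2.
exists (\row_j nth 0 [:: sol i0; s0 0 i1 - v * p i1; sol i2; 0] j).
have flip (j : 'I_4) : chi e j != sb j -> s0 0 j + (-1) ^+ (sb j) * sol j =
    (-1) ^+ (chi e j) * sol j + ((vee e j)%:R / 2 + 0) * p j.
  by rewrite /sol; case: (chi e j); case: (sb j); rewrite // ?expr0 ?expr1 => _; field.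
have p13 : p i1 = p i3 by rewrite -(per i1) q1.
apply/rowP => j; have /or4P : [|| j == i0, j == i1, j == i2 | j == i3].
  by case: j => [[|[|[|[|]]]]].
rewrite sigE hl_mapE; case=> /eqP->; rewrite ?q0 ?q1 ?q2 ?q3 !mxE /= ?mulr0z.
- exact: (flip i0).
- by rewrite (negPf e1) expr0 mulr0 addr0 mul1r addr0 subrK.
- exact: (flip i2).
have v3' : vee fs i3 = false by apply/negbTE.
move: h3; rewrite q3 v3' mulr0n mul0r add0r mulr0 add0r -ev /k3 /v p13 => h3.
rewrite rmorphB /=; move: h3; case: (sb i3); rewrite ?expr0 ?expr1 => h3.
  rewrite rmorph0 subr0; lra.
have -> : ((vee e 1%N)%:R : int)%:~R = (vee e 1%N)%:R :> R by case: (vee e 1%N).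
lra.
Qed.

End Obstruction.

Theorem HW_not_boundary (R : realType) (a b c d : R) (i : nat) :
  0 < a -> 0 < b -> 0 < c -> 0 < d -> i \in [:: 1; 2; 3; 4]%N ->
  ~ is_tg_boundary (HW_group a b c d i).
Proof.
move=> a0 b0 c0 d0 i4 bG.
have i12 : (1 <= i <= 12)%N by move: i4; rewrite !inE => /or4P[] /eqP ->.
have p0 := period_gt0 a0 b0 c0 d0.
have dG := HW_displaces a0 b0 c0 d0 i12.
have m0 := min_half_period_gt0 p0.
have [sigma [sI sG ss sF]] := tg_boundary_involution m0 dG (@hl_box_compact _ _)
  (HW_cover a0 b0 c0 d0 i12) bG.
have ssI x y : euclid_dist (sigma (sigma x)) (sigma (sigma y)) = euclid_dist x y.
  by rewrite !sI.
have [h Gh hE] := pointwise_group m0 dG ssI (fun x y => erefl) ss.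
have /andP[/andP[W0 _] _] := HW_good i12.
have [|| e We [k [x sx]]] := obstructed p0 W0 (HW_obstructed i4) sI.
- move=> e k We.
  have Ge : isoms (HW_group a b c d i) (hl_map (period a b c d) e k).
    by rewrite HW_isoms//; exists e => //; exists k.
  have [||g Gg gE] := @pointwise_group _ _ _ _ m0 dG (fun x => sigma (hl_map (period a b c d) e k x)) sigma _ sI.
  + by move=> x y; rewrite sI hl_map_ed.
  + by move=> x; exact: sG.
  move: Gg; rewrite HW_isoms// => -[f Wf [l gl]]; exists f => //; exists l => x.
  by rewrite gE gl.
- move: Gh; rewrite HW_isoms// => -[f Wf [l hl]]; exists f => //; exists l => x.
  by rewrite hE hl.
apply: (sF (hl_map (period a b c d) e k) x _ sx).
by rewrite HW_isoms//; exists e => //; exists k.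
Qed.

(** * Orientability *)

Section Orientation.
Variables (R : realType) (n : nat) (G : isom_group R n) (d : R).
Hypotheses (d0 : 0 < d) (dG : displaces G d).
Local Notation ed := (@euclid_dist R n).
Local Notation qd := (@quotient_dist R n G).
Variables (r : quotient_space G -> R) (c : quotient_space G -> quotient_space G -> 'rV[R]_n).
Hypothesis charts : forall p, isometric_chart qd [set: 'rV[R]_n] p (r p) (c p).
Hypothesis transitions : forall p q x, qd p x < r p -> qd q x < r q ->
  exists (A : 'M[R]_n) (b : 'rV[R]_n), 0 < \det A /\
    exists2 e, 0 < e & forall y, qd x y < e -> c q y = c p y *m A + b.

(* The differential at x of the chart at q composed with the projection is O. *)
Definition chart_germ x q (O : 'M[R]_n) (e : R) := forall v, ed 0 v < e ->
  qd q (proj G (x + v)) < r q /\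
  c q (proj G (x + v)) = c q (proj G x) + v *m O.

(** Only the sign of [s] counts: it tells whether the charts around the projection of [x] preserve
    the orientation of R^n. *)
Definition orient_sign x (s : R) := exists q O e,
  [/\ 0 < e, 0 < s * \det O & chart_germ x q O e].

Lemma det_orthomx (O : 'M[R]_n) : orthomx O -> \det O ^+ 2 = 1.
Proof. by move=> hO; rewrite expr2 -{2}(det_tr O) -det_mulmx hO det1. Qed.

Lemma orient_sign_ex x : orient_sign x 1 \/ orient_sign x (-1).
Proof.
have dp := d0.
have [rq _ _] := charts (proj G x).
have [_ cI _] := charts (proj G x).
set q := proj G x in rq cI *.
pose e := Num.min (d / 4) (r q).
have e0 : 0 < e by rewrite lt_min rq divr_gt0.
have near v : ed 0 v < e -> qd q (proj G (x + v)) < r q.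
  rewrite lt_min => /andP[_]; apply: le_lt_trans; rewrite -(ed_add x).
  exact: qd_le.
have [|v v' ve ve'|O hO gO] := @rigid R n [set v | ed 0 v < e] (fun v => c q (proj G (x + v))) 0.
- exact: fat_ball.
- rewrite cI ?near// (qd_small d0 dG) ?edDl//.
  move: ve ve'; rewrite /= !lt_min => /andP[ve _] /andP[ve' _].
  by have := ed_triangle 0 v v'; rewrite (ed_sym v 0); lra.
have germ : chart_germ x q O e.
  move=> v ve; split; first exact: near.
  by rewrite (gO v ve) /affm subr0 addr0.
have := det_orthomx hO; move/eqP; rewrite -subr_eq0 subr_sqr_1 mulf_eq0.
move=> /orP[/eqP h|/eqP h]; [left|right]; exists q, O, e; split=> //; lra.
Qed.

(** Two germs at [x] differ by the linear part of a change of charts, whose determinant is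
    positive. *)
Lemma orient_sign_unique x s s' : orient_sign x s -> orient_sign x s' -> 0 < s * s'.
Proof.
move=> [q [ O [e [e0 sO gO]]]] [q' [ O' [e' [e'0 sO' gO']]]].
have z0 : ed 0 0 < e by rewrite edxx.
have z0' : ed 0 0 < e' by rewrite edxx.
have [xq _] := gO 0 z0; have [xq' _] := gO' 0 z0'; rewrite addr0 in xq xq'.
have [A [b [dA [e2 e20 tA]]]] := transitions xq xq'.
pose e3 := Num.min e2 (Num.min e e').
have e30 : 0 < e3 by rewrite !lt_min e20 e0.
suff OA : O' = O *m A.
  move: sO'; rewrite OA det_mulmx => sO'.
  have : 0 < (s * \det O) * (s' * (\det O * \det A)) by exact: mulr_gt0.
  have -> : (s * \det O) * (s' * (\det O * \det A)) = (s * s') * (\det O ^+ 2 * \det A) by ring.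
  have detO : 0 < \det O ^+ 2.
    rewrite lt_neqAle sqr_ge0 andbT eq_sym expf_eq0 /=; apply/eqP => h.
    by move: sO; rewrite h mulr0 ltxx.
  by rewrite pmulr_lgt0// mulr_gt0.
apply: (affm_inj (z0 := c q' (proj G x)) (@fat_ball R n 0 e3 e30)) => v.
rewrite /= !lt_min => /and3P[v2 ve ve'].
have [_ c1] := gO v ve; have [_ c2] := gO' v ve'.
have x2 : qd (proj G x) (proj G x) < e2 by rewrite qdxx.
have xv : qd (proj G x) (proj G (x + v)) < e2.
  by apply: le_lt_trans v2; rewrite -(ed_add x); exact: qd_le.
rewrite /affm subr0 -c2 (tA _ xv) (tA _ x2) c1 mulmxDl mulmxA.
by rewrite addrAC.
Qed.

Lemma orient_sign_near x s : orient_sign x s ->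
  exists2 e, 0 < e & forall y, ed x y < e -> orient_sign y s.
Proof.
move=> [q [ O [e [e0 sO gO]]]]; exists e => // y xy.
exists q, O, (e - ed x y); split=> //; first by rewrite subr_gt0.
have xyv : ed 0 (y - x) < e by rewrite ed0B.
have [_ cy] := gO _ xyv; rewrite [x + _]addrC subrK in cy.
move=> v ve; have yv : ed 0 (y - x + v) < e.
  have := ed_triangle (y - x) 0 (y - x + v); rewrite ed_add ed0B; lra.
have [h1 h2] := gO _ yv.
have E : x + (y - x + v) = y + v by rewrite addrA [x + _]addrC subrK.
rewrite E in h1 h2; split=> //.
by rewrite h2 cy mulmxDl addrA.
Qed.

Lemma orient_sign_const x y s : s = 1 \/ s = -1 -> orient_sign x s -> orient_sign y s.
Proof.
move=> s1 xs; suff H : forall t, 0 <= t <= 1 -> orient_sign (seg x y t) s.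
  by rewrite -(seg1 x y); apply: H; rewrite ler01 lexx.
set l := ed x y; have l0 : 0 < 1 + l by rewrite ltr_wpDr ?ed_ge0.
have small e (a b : R) : `|a - b| < e / (1 + l) -> ed (seg x y a) (seg x y b) < e.
  rewrite ltr_pdivlMr// ed_seg; apply: le_lt_trans; rewrite ler_wpM2l// lerDr//.
apply: real_ind => t /andP[t0 t1] IH.
suff st : orient_sign (seg x y t) s.
  have [e e0 He] := orient_sign_near st; exists (e / (1 + l)); first by rewrite divr_gt0.
  move=> u /andP[tu ue] u1; apply/He/small.
  by rewrite distrC ger0_norm ?subr_ge0// ltrBlDl.
have [->|tn0] := eqVneq t 0; first by rewrite seg0.
have tp : 0 < t by rewrite lt_neqAle eq_sym tn0.
(* A sign at [t] persists slightly before [t], where the induction hypothesis gives the sign [s]. *)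
have key s' : orient_sign (seg x y t) s' -> 0 < s * s'.
  move=> st; have [e e0 He] := orient_sign_near st.
  pose k := Num.min t (e / (1 + l)) / 2.
  have kp : 0 < k by rewrite divr_gt0// lt_min tp divr_gt0.
  have kt : k <= t / 2 by rewrite ler_pM2r// ge_min lexx.
  have ke : k <= e / (1 + l) / 2 by rewrite ler_pM2r// ge_min lexx orbT.
  have b1 : 0 <= t - k < t by apply/andP; split; lra.
  apply: (orient_sign_unique (IH _ b1)); apply/He/small.
  by rewrite ger0_norm; lra.
have [st|st] := orient_sign_ex (seg x y t); have := key _ st; case: s1 => -> //; lra.
Qed.

Lemma orient_sign_group g (A : 'M[R]_n) x s : isoms G g -> (forall y, g y = g 0 + y *m A) ->
  orthomx A -> \det A < 0 -> orient_sign (g x) s -> orient_sign x (- s).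
Proof.
move=> Gg gA hA dA [q [ O [e [e0 sO gO]]]]; exists q, (A *m O), e; split=> //.
  by rewrite det_mulmx; nra.
move=> v ve; have vA : ed 0 (v *m A) < e by rewrite -(mul0mx _ A) ed_orthomx.
have [h1 h2] := gO _ vA.
have E : g x + v *m A = g (x + v) by rewrite (gA x) (gA (x + v)) mulmxDl addrA.
rewrite E in h1 h2; split; first by rewrite -(proj_group _ Gg).
by rewrite -(proj_group (x + v) Gg) h2 (proj_group _ Gg) mulmxA.
Qed.

End Orientation.

Lemma not_orientable (R : realType) n (G : isom_group R n) (d : R) g (A : 'M[R]_n) :
  0 < d -> displaces G d -> isoms G g -> (forall y, g y = g 0 + y *m A) ->
  orthomx A -> \det A < 0 -> ~ orientable (@quotient_dist R n G) n.
Proof.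
move=> d0 dG Gg gA hA dA [r [c [charts trans]]].
have key s : s = 1 \/ s = -1 -> orient_sign r c 0 s -> False.
  move=> s1 s0.
  have s2 := orient_sign_group Gg gA hA dA (orient_sign_const d0 dG charts trans (g 0) s1 s0).
  have := orient_sign_unique trans s0 s2; case: s1 => ->; lra.
have [|] := orient_sign_ex d0 dG charts 0; apply: key; [left|right]; by [].
Qed.

Section HWOrientation.
Variables (R : realType) (a b c d : R).
Hypotheses (a0 : 0 < a) (b0 : 0 < b) (c0 : 0 < c) (d0 : 0 < d).

Lemma HW_not_orientable i : i \in [:: 1; 2; 3; 4]%N ->
  ~ orientable (quotient_dist (G := HW_group a b c d i)) 4.
Proof.
move=> i4; have i12 : (1 <= i <= 12)%N by move: i4; rewrite !inE => /or4P[] /eqP ->.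
have : all (fun i => has (fun e => chi e 0 (+) chi e 1 (+) chi e 2 (+) chi e 3)%N (HW_elts i))
  [:: 1; 2; 3; 4]%N by vm_compute.
move=> /allP/(_ _ i4)/hasP[e We oe].
have p0 := period_gt0 a0 b0 c0 d0.
pose A : 'M[R]_4 := diag_mx (\row_j (-1) ^+ (chi e j)).
have hA : orthomx A.
  rewrite /orthomx tr_diag_mx mulmx_diag; apply/matrixP => i' j'; rewrite !mxE.
  by rewrite -signr_addb addbb expr0.
apply: (not_orientable (min_half_period_gt0 p0) (HW_displaces a0 b0 c0 d0 i12)
  (g := hl_map (period a b c d) e 0) (A := A)) => //.
- by rewrite HW_isoms//; exists e => //; exists 0.
- move=> y; apply/rowP => j; rewrite [RHS]mxE !hl_mapE mul_mx_diag !mxE.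
  by rewrite mulr0 add0r addrC mulrC.
- rewrite det_diag !big_ord_recl big_ord0 !mxE mulr1 -!signr_addb.
  by rewrite /bump /= !addbA oe expr1 ltrN10.
Qed.

End HWOrientation.

(** * Quotients of R^m x [-1, 1] *)

Local Open Scope quotient_scope.

Section SlabQuotient.
Variables (R : realType) (m : nat).

(** The hypotheses on [d] are arguments of the type because the metric structure attached to it
    depends on them. The height is tested on a representative, which is harmless for groups
    preserving its absolute value. *)
Definition slab_quotient (Gh : isom_group R m.+1) (d : R) (d0 : 0 < d)
  (dG : displaces Gh d) : Type := {u : quotient_space Gh | `|ht (repr u)| <= 1}.

Section Metric.
Variables (Gh : isom_group R m.+1) (d : R) (d0 : 0 < d) (dG : displaces Gh d).
Local Notation M := (slab_quotient d0 dG).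
Let dist (u v : M) : R := quotient_dist (val u) (val v).

HB.instance Definition _ := Choice.copy M {u : quotient_space Gh | `|ht (repr u)| <= 1}.

Let distxx u : dist u u = 0. Proof. exact: qdxx. Qed.
Let dist_eq0 u v : dist u v = 0 -> u = v.
Proof. by move=> /(qd_eq0 d0 dG)/val_inj. Qed.
Let dist_sym u v : dist u v = dist v u. Proof. exact: qd_sym. Qed.
Let dist_triangle v u w : dist u w <= dist u v + dist v w.
Proof. exact: qd_triangle. Qed.

HB.instance Definition _ := isMetric.Build R M distxx dist_eq0 dist_sym dist_triangle.

Lemma slab_mdist (u v : M) : mdist u v = quotient_dist (val u) (val v).
Proof. by []. Qed.

End Metric.

Section Slab.
Variables (Gh : isom_group R m.+1) (d : R) (d0 : 0 < d) (dG : displaces Gh d).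
Hypothesis Gh_ht : forall g w, isoms Gh g -> `|ht (g w)| = `|ht w|.
Local Notation M := (slab_quotient d0 dG).
Local Notation ed := (@euclid_dist R m.+1).
Local Notation md := (@mdist R M).

Lemma le_N1_1 : -1 <= 1 :> R. Proof. by lra. Qed.

(** Clamping the height makes the projection onto the quotient slab a total 1-Lipschitz map. *)
Definition clampw (w : 'rV[R]_m.+1) := pt (base w) (clamp (-1) 1 (ht w)).

Lemma clampw_id w : `|ht w| <= 1 -> clampw w = w.
Proof. by rewrite ler_norml => w1; rewrite /clampw clamp_id// pt_eta. Qed.

Lemma clampw_lip w v : ed (clampw w) (clampw v) <= ed w v.
Proof.
rewrite -(@ler_pXn2r _ 2)// ?nnegrE ?ed_ge0//.
rewrite -[in leRHS](pt_eta w) -[in leRHS](pt_eta v) !ed_pt_sqr lerD2l.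
by rewrite -real_normK ?num_real// -[leRHS]real_normK ?num_real// ler_pXn2r ?nnegrE// clamp_lip ?le_N1_1.
Qed.

Lemma slab_proof w : `|ht (repr (proj Gh (clampw w)))| <= 1.
Proof.
have : proj Gh (repr (proj Gh (clampw w))) = proj Gh (clampw w) by rewrite /proj reprK.
move=> /esym/projP[g Gg <-].
by rewrite Gh_ht// /clampw ht_pt ler_norml clamp_bound ?le_N1_1.
Qed.

Definition slab_proj w : M := exist _ (proj Gh (clampw w)) (slab_proof w).

Lemma slab_proj_surj (u : M) : exists2 w, `|ht w| <= 1 & slab_proj w = u.
Proof.
case: u => u hu; exists (repr u) => //; apply: val_inj.
by rewrite /= clampw_id// /proj reprK.
Qed.

Lemma slab_dist w v : `|ht w| <= 1 -> `|ht v| <= 1 ->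
  md (slab_proj w) (slab_proj v) = quotient_dist (proj Gh w) (proj Gh v).
Proof. by move=> w1 v1; rewrite slab_mdist /= !clampw_id. Qed.

Lemma slab_dist_le w v : md (slab_proj w) (slab_proj v) <= ed w v.
Proof. by rewrite slab_mdist (le_trans (qd_le _ _ _))// clampw_lip. Qed.

Lemma slab_dist_small w v : `|ht w| <= 1 -> `|ht v| <= 1 -> ed w v < d / 2 ->
  md (slab_proj w) (slab_proj v) = ed w v.
Proof. by move=> w1 v1 wv; rewrite slab_dist// (qd_small d0 dG). Qed.

Lemma slab_projP w v : `|ht w| <= 1 -> `|ht v| <= 1 ->
  slab_proj w = slab_proj v <-> exists2 g, isoms Gh g & g w = v.
Proof.
move=> w1 v1; rewrite -projP; split=> [/(congr1 val)|h]; first by rewrite /= !clampw_id.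
by apply: val_inj; rewrite /= !clampw_id.
Qed.

Lemma slab_lift w q rho : `|ht w| <= 1 -> md (slab_proj w) q < rho ->
  exists v, [/\ `|ht v| <= 1, ed w v < rho & slab_proj v = q].
Proof.
have [v v1 <-] := slab_proj_surj q; move=> w1; rewrite slab_dist// => /qd_lt[g Gg wg].
exists (g v); rewrite Gh_ht//; split=> //.
apply/slab_projP; rewrite ?Gh_ht//.
by have [h [Gh' gh hg]] := group_inv Gg; exists h.
Qed.

Lemma slab_proj_continuous : continuous slab_proj.
Proof.
move=> w A /metricType_numDomainType.nbhs_mdistP[e /= e0 eA].
have m0 : 0 < m.+2%:R :> R by [].
change (nbhs w (slab_proj @^-1` A)); apply/nbhs_ballP.
have s0 : 0 < e / m.+2%:R by rewrite divr_gt0.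
exists (e / m.+2%:R) => //= v wv; apply: eA => /=.
apply: (le_lt_trans (slab_dist_le w v)); apply: (le_lt_trans (ed_sup_ball s0 wv)).
by rewrite mulrCA gtr_pMr// ltr_pdivrMr// mul1r ltr_nat.
Qed.

(** The group only bounds horizontal coordinates, hence the maximum with the height; on the slab the
    latter is at most 1, hence at most [B]. *)
Lemma slab_compact (B : R) : 1 <= B ->
  (forall w, exists2 g, isoms Gh g & forall j, `|g w 0 j| <= Num.max B `|ht w|) ->
  compact [set: M].
Proof.
move=> B1 cov.
have -> : [set: M] = slab_proj @` [set w : 'rV[R]_m.+1 | forall j, `[-B, B]%classic (w 0 j)].
  apply/seteqP; split=> // q _; have [w w1 <-] := slab_proj_surj q.
  have [g Gg gB] := cov w; exists (g w).
    move=> j /=; rewrite in_itv /= -ler_norml (le_trans (gB j))//.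
    by rewrite ge_max lexx (le_trans w1).
  apply/slab_projP; rewrite ?Gh_ht//.
  by have [h [Gh' gh hg]] := group_inv Gg; exists h.
apply: continuous_compact; last exact: (rV_compact (fun=> @segment_compact R (- B) B)).
by apply: continuous_subspaceT => x; exact: slab_proj_continuous.
Qed.

Lemma slab_seg_lip w v s t : md (slab_proj (seg w v s)) (slab_proj (seg w v t)) <=
  ed w v * `|s - t|.
Proof. by rewrite (le_trans (slab_dist_le _ _))// ed_seg mulrC. Qed.

Lemma slab_seg_continuous w v : continuous (fun t => slab_proj (seg w v t)).
Proof.
move=> t A /metricType_numDomainType.nbhs_mdistP[e /= e0 eA].
change (nbhs t ((fun t => slab_proj (seg w v t)) @^-1` A)); apply/nbhs_ballP.
have l0 : 0 < 1 + ed w v by rewrite ltr_wpDr ?ed_ge0.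
exists (e / (1 + ed w v)); first by rewrite /= divr_gt0.
move=> u; rewrite /ball /= ltr_pdivlMr// => tu; apply: eA => /=.
apply: le_lt_trans (slab_seg_lip _ _ _ _) _; apply: le_lt_trans tu.
by rewrite mulrC ler_wpM2l// lerDr.
Qed.

Lemma slab_connected : connected [set: M].
Proof.
have -> : [set: M] = \bigcup_(w in [set w : 'rV[R]_m.+1 | `|ht w| <= 1])
    ((fun t => slab_proj (seg 0 w t)) @` `[0, 1]%classic).
  apply/seteqP; split=> // q _; have [w w1 <-] := slab_proj_surj q.
  exists w => //; exists 1; rewrite ?seg1//=.
  by rewrite in_itv /= lexx ler01.
apply: bigcup_connected.
  exists (slab_proj 0) => w _; exists 0; rewrite ?seg0//=.
  by rewrite in_itv /= lexx ler01.
move=> w _; apply: connected_continuous_connected; first exact: segment_connected.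
by apply: continuous_subspaceT => t; exact: slab_seg_continuous.
Qed.

Lemma slab_length_space : length_space M.
Proof.
move=> x y e e0; have [w w1 <-] := slab_proj_surj x.
have [|v [v1 wv vy]] := @slab_lift w y (md (slab_proj w) y + e) w1.
  by rewrite ltrDl.
exists (fun t => slab_proj (seg w v t)); rewrite seg0 seg1 vy; split=> // s t _ _.
apply: (le_trans (slab_seg_lip w v s t)); apply: ler_wpM2r => //; exact: (ltW wv).
Qed.

Lemma slab_lift_unique w v v' : ed w v < d / 2 -> ed w v' < d / 2 ->
  `|ht v| <= 1 -> `|ht v'| <= 1 -> slab_proj v = slab_proj v' -> v = v'.
Proof.
move=> wv wv' v1 v1' /(slab_projP v1 v1')[g Gg gv].
have vv' : ed v v' < d.
  by have := ed_triangle w v v'; rewrite (ed_sym v w); lra.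
suff gid : g = id by rewrite -gv gid.
apply: (displaces_inj dG (x := v)) => //; first exact: group_id.
by rewrite gv ed_sym.
Qed.

(** Heights are measured from the face on the side of [w]: [s] is the sign of its height, and [F]
    sends that face to the bounding hyperplane. *)
Lemma slab_chart w : `|ht w| <= 1 -> exists r c,
  isometric_chart md (@half_space R m) (slab_proj w) r c /\ ht (c (slab_proj w)) = 1 - `|ht w|.
Proof.
have dp := d0.
move=> w1; pose s : R := if 0 <= ht w then 1 else -1.
have ss : s * s = 1 by rewrite /s; case: ifP; rewrite ?mulrNN mul1r.
have sw : s * ht w = `|ht w|.
  rewrite /s; case: ifP => [h|/negbT]; first by rewrite mul1r ger0_norm.
  by rewrite -ltNge => h; rewrite mulN1r ltr0_norm.
pose F (v : 'rV[R]_m.+1) := pt (base v) (1 - s * ht v).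
pose F' (v : 'rV[R]_m.+1) := pt (base v) (s * (1 - ht v)).
have FI u v : ed (F u) (F v) = ed u v.
  apply/eqP; rewrite -(@eqrXn2 _ 2)// ?ed_ge0// ed_pt_sqr.
  rewrite (_ : (1 - s * ht u - (1 - s * ht v)) ^+ 2 = s * s * (ht u - ht v) ^+ 2); last by ring.
  by rewrite ss mul1r -ed_pt_sqr !pt_eta.
have FF' v : F (F' v) = v.
  rewrite /F /F' base_pt ht_pt mulrA ss mul1r opprB addrC subrK; exact: pt_eta.
(* The bound d/4 makes lifts unique and distances exact; the bound 1 prevents the ball from crossing
   the opposite face. *)
pose r := Num.min (d / 4) 1.
have r0 : 0 < r by rewrite lt_min divr_gt0// ltr01.
have rd : r <= d / 4 by rewrite ge_min lexx.
have r1 : r <= 1 by rewrite ge_min lexx orbT.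
have /choice[L PL] : forall q, exists v, md (slab_proj w) q < r ->
    [/\ `|ht v| <= 1, ed w v < r & slab_proj v = q].
  move=> q; have [h|h] := pselect (md (slab_proj w) q < r); last by exists w.
  by have [v hv] := slab_lift w1 h; exists v.
have Lw : L (slab_proj w) = w.
  have [|v1 wv vE] := PL (slab_proj w); first by rewrite mdistxx.
  by apply: (@slab_lift_unique w) => //; rewrite ?edxx ?divr_gt0//; lra.
exists r, (fun q => F (L q)); split; last by rewrite Lw ht_pt sw.
split=> //.
  move=> q q' /PL[v1 wv vE] /PL[v1' wv' vE'].
  rewrite FI -[in RHS]vE -[in RHS]vE' slab_dist_small//.
  by have := ed_triangle w (L q) (L q'); rewrite (ed_sym (L q) w); lra.
apply/seteqP; split=> [z [q /PL[v1 wv vE] <-]|z [z0 zr]].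
  split; last by rewrite /= FI Lw.
  rewrite /half_space /= -/(ht _) ht_pt.
  by move: v1; rewrite ler_norml => /andP[]; rewrite /s; case: ifP; lra.
rewrite /half_space /= -/(ht z) in z0; rewrite /= Lw in zr.
have wz : ed w (F' z) < r by rewrite -FI FF'.
have z1 : `|ht (F' z)| <= 1.
  have zw := le_lt_trans (ed_ht (F w) z) zr.
  rewrite ht_pt sw in zw; have w0 := normr_ge0 (ht w).
  have n1 : `|s| = 1 by rewrite /s; case: ifP => _; rewrite ?normrN normr1.
  rewrite /F' ht_pt normrM n1 mul1r.
  by move: zw; rewrite ltr_norml => /andP[h1 h2]; rewrite ler_norml; apply/andP; split; lra.
have qr : md (slab_proj w) (slab_proj (F' z)) < r by exact: le_lt_trans (slab_dist_le _ _) wz.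
exists (slab_proj (F' z)) => //.
have [v1 wv vE] := PL _ qr.
have -> : L (slab_proj (F' z)) = F' z by apply: (@slab_lift_unique w) => //; lra.
exact: FF'.
Qed.

Lemma slab_boundaryP w : `|ht w| <= 1 ->
  manifold_boundary m M (slab_proj w) <-> `|ht w| = 1.
Proof.
move=> w1; have [r [c [h hc]]] := slab_chart w1; split=> [bw|hw].
  by have := chart_boundary0 bw h; rewrite hc => /eqP; rewrite subr_eq0 => /eqP.
by exists r, c; split=> //; rewrite -/(ht _) hc hw subrr.
Qed.

End Slab.
End SlabQuotient.

(** * The twisted interval bundle over a quotient *)

Section Coset.
Variables (R : realType) (m : nat) (G : isom_group R m).
Variable T : set ('rV[R]_m -> 'rV[R]_m).
Variables (d B : R).
Local Notation ed := (@euclid_dist R m).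
Hypothesis T_isom : T `<=` @euclid_isometry R m.
Hypothesis GT : forall g t, isoms G g -> T t -> T (g \o t).
Hypothesis TG : forall g t, isoms G g -> T t -> T (t \o g).
Hypothesis TT : forall t t', T t -> T t' -> isoms G (t \o t').
Hypothesis TV : forall t h, T t -> cancel t h -> cancel h t -> T h.
Hypotheses (d0 : 0 < d) (dG : displaces G d) (dT : forall t x, T t -> d <= ed x (t x)).
Hypothesis T0 : exists t, T t.
Hypothesis B_cover : forall x, exists2 g, isoms G g & forall j, `|g x 0 j| <= B.

Definition twist (g : 'rV[R]_m -> 'rV[R]_m) (s : R) (w : 'rV[R]_m.+1) :=
  pt (g (base w)) (s * ht w).

(** [T] plays the role of the coset of sigma: it is stable under [G] on both sides and its products
    lie in [G], which matches the rule of signs on the interval and makes this set a group. *)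
Definition twisted_set : set ('rV[R]_m.+1 -> 'rV[R]_m.+1) :=
  [set k | exists g, (isoms G g /\ k = twist g 1) \/ (T g /\ k = twist g (-1))].

Lemma twist_comp g h s t : twist g s \o twist h t = twist (g \o h) (s * t).
Proof. by apply/funext => w; rewrite /twist /= base_pt ht_pt mulrA. Qed.

Lemma twist_id : twist id 1 = id.
Proof. by apply/funext => w; rewrite /twist mul1r pt_eta. Qed.

Lemma twist_cancel g h s : s * s = 1 -> cancel g h -> cancel (twist g s) (twist h s).
Proof.
by move=> s1 gh w; rewrite /twist base_pt ht_pt gh mulrA s1 mul1r pt_eta.
Qed.

Lemma twist_isometry g s : s * s = 1 -> euclid_isometry g -> euclid_isometry (twist g s).
Proof.
move=> s1 [gI [h gh hg]]; split; last by exists (twist h s); exact: twist_cancel.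
move=> w v; apply: (hat_isom (k := fun t => s * t)) => // a b.
by rewrite -mulrBr exprMn expr2 s1 mul1r.
Qed.

Lemma sqrN1 : -1 * -1 = 1 :> R. Proof. by rewrite mulrNN mul1r. Qed.

Lemma twisted_isometry : twisted_set `<=` @euclid_isometry R m.+1.
Proof.
move=> _ [g [[Gg ->]|[Tg ->]]]; apply: twist_isometry; rewrite ?mul1r ?sqrN1//.
- exact: (isoms_isometry Gg).
- exact: (T_isom Tg).
Qed.

Lemma twisted_closed : subgroup_closed twisted_set.
Proof.
split.
- by exists id; left; split; [exact: group_id | rewrite twist_id].
- move=> k1 k2 [g gP] [h hP].
  case: gP => -[Gg ->]; case: hP => -[Gh ->]; exists (g \o h); rewrite twist_comp.
  + by left; split; [exact: group_comp | rewrite mul1r].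
  + by right; split; [exact: GT | rewrite mul1r].
  + by right; split; [exact: TG | rewrite mulr1].
  + by left; split; [exact: TT | rewrite sqrN1].
- move=> k h [g gP] kh hk.
  have uniq h' : cancel k h' -> cancel h' k -> h = h'.
    by move=> kh' h'k; apply/funext => w; rewrite -{1}(h'k w) kh.
  case: gP => -[Gg kE].
    have [g' [Gg' gg' g'g]] := group_inv Gg; exists g'; left; split=> //.
    by apply: uniq; rewrite kE; apply: twist_cancel => //; rewrite mul1r.
  have [_ [g' gg' g'g]] := T_isom Gg; exists g'; right; split; first exact: TV Gg gg' g'g.
  by apply: uniq; rewrite kE; apply: twist_cancel => //; rewrite sqrN1.
Qed.

Definition twisted : isom_group R m.+1 := IsomGroup twisted_isometry twisted_closed.

Lemma twisted_displaces : displaces twisted d.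
Proof.
move=> _ [g [[Gg ->]|[Tg ->]]] ne w; apply: le_trans (ed_base _ _); rewrite base_pt.
  by apply: dG => // gid; apply: ne; rewrite gid twist_id.
exact: dT.
Qed.

Lemma twisted_ht g w : isoms twisted g -> `|ht (g w)| = `|ht w|.
Proof.
by move=> [h [[_ ->]|[_ ->]]]; rewrite /twist ht_pt ?mul1r// mulN1r normrN.
Qed.

(* The boundary of the quotient of R^m x [-1, 1] by the twisted group is the
   quotient of R^m x {-1, 1}, which is R^m / G since T exchanges the two sides. *)
Theorem coset_tg_boundary : is_tg_boundary G.
Proof.
have dp := d0.
pose M : metricType R := slab_quotient d0 twisted_displaces.
pose P := slab_proj d0 twisted_displaces twisted_ht.
have one t (x : 'rV[R]_m) : `|t| = 1 -> `|ht (pt x t)| <= 1 :> R by move=> t1; rewrite ht_pt t1.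
have n1 : `|1 : R| = 1 by rewrite normr1.
have nN1 : `|-1 : R| = 1 by rewrite normrN normr1.
exists M; split.
  split.
  - apply: (@slab_compact _ _ _ _ d0 twisted_displaces twisted_ht (Num.max 1 B)).
      by rewrite le_max lexx.
    move=> w; have [g Gg gB] := B_cover (base w); exists (twist g 1); first by exists g; left.
    move=> j; rewrite /twist !mxE; case: unliftP => [k|] _; rewrite !le_max.
      by rewrite gB !orbT.
    by rewrite mul1r lexx !orbT.
  - exact: (slab_connected twisted_ht).
  - exact: (@slab_length_space _ _ _ _ d0 twisted_displaces twisted_ht).
  - move=> p; have [w w1 <-] := @slab_proj_surj _ _ _ _ d0 twisted_displaces twisted_ht p.
    have [r [c [h _]]] := slab_chart d0 twisted_displaces twisted_ht w1.
    by exists r, c.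
pose f (u : quotient_space G) : M := P (pt (repr u) 1).
have fE x : f (proj G x) = P (pt x 1).
  have : proj G (repr (proj G x)) = proj G x by rewrite /proj reprK.
  move=> /projP[g Gg gx]; apply/slab_projP; [exact: one|exact: one|].
  exists (twist g 1); first by exists g; left.
  by rewrite /twist base_pt ht_pt mul1r gx.
exists f; split.
- move=> u v; have [x <-] := proj_surj u; have [y <-] := proj_surj v; rewrite !fE.
  move=> /(slab_projP d0 twisted_displaces twisted_ht (one _ _ n1) (one _ _ n1)).
  move=> [_ [g [[Gg ->]|[Tg ->]]]]; rewrite /twist base_pt ht_pt => e.
    by apply/projP; exists g => //; have := congr1 (@base _ _) e; rewrite !base_pt.
  by have := congr1 (@ht _ _) e; rewrite !ht_pt => h; exfalso; lra.
- apply/seteqP; split=> [_ [u _ <-]|p].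
    have [x <-] := proj_surj u; rewrite fE.
    by apply/slab_boundaryP; [exact: one | rewrite ht_pt].
  have [w w1 <-] := @slab_proj_surj _ _ _ _ d0 twisted_displaces twisted_ht p.
  move=> /(slab_boundaryP d0 twisted_displaces twisted_ht w1) hw.
  have [h|h] : ht w = 1 \/ ht w = -1.
    have : (ht w - 1) * (ht w + 1) = 0.
      by rewrite -subr_sqr_1 -real_normK ?num_real// hw expr1n subrr.
    by move/eqP; rewrite mulf_eq0 => /orP[/eqP h|/eqP h]; [left|right]; lra.
    exists (proj G (base w)) => //; rewrite fE.
    by rewrite -h pt_eta.
  have [t Tt] := T0; exists (proj G (t (base w))) => //; rewrite fE.
  apply/esym/slab_projP => //; first exact: one.
  exists (twist t (-1)); first by exists t; right.
  by rewrite /twist h sqrN1.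
- move=> p; exists (d / 4); first by rewrite divr_gt0.
  have [x <-] := proj_surj p => u v.
  have [y0 <-] := proj_surj u; have [z0 <-] := proj_surj v.
  move=> /qd_lt[g Gg xy] /qd_lt[h Gh xz].
  rewrite -(proj_group y0 Gg) -(proj_group z0 Gh) !fE.
  have yz : ed (g y0) (h z0) < d / 2.
    by have := ed_triangle x (g y0) (h z0); rewrite (ed_sym (g y0) x); lra.
  rewrite (qd_small d0 dG)// slab_dist_small//; try exact: one; rewrite ed_pt//.
Qed.

End Coset.

(** * The groups whose quotients bound *)

Section HWBoundary.
Variables (R : realType) (a b c d : R).
Hypotheses (a0 : 0 < a) (b0 : 0 < b) (c0 : 0 < c) (d0 : 0 < d).
Local Notation p := (period a b c d).

(* The half-translation T_y or T_z whose class acts freely on H-W_i. *)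
Definition HW_shift (i : nat) : elt :=
  if i \in [:: 8; 10]%N then (nseq 4 false, [:: false; true; false; false])
  else (nseq 4 false, [:: false; false; true; false]).

Definition eshift (t : elt) (W : seq elt) : seq elt := map (exor t) W.

Definition ecoset (W T : seq elt) :=
  [&& all (fun e => all (fun f => (exor e f \in T) && (exor f e \in T)) T) W,
      all (fun e => all (fun f => exor e f \in W) T) T &
      all (fun e => has (fun j => ~~ chi e j && vee e j) (iota 0 4)) T].

Lemma half_lattice_comp (W1 W2 W3 : seq elt) g h :
  (forall e f, e \in W1 -> f \in W2 -> exor e f \in W3) ->
  half_lattice p W1 g -> half_lattice p W2 h -> half_lattice p W3 (g \o h).
Proof.
move=> H [e We [k ->]] [f Wf [l ->]]; exists (exor e f); first exact: H.
by exists (hl_compk e f k l); rewrite hl_map_comp.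
Qed.

Lemma HW_boundary i : (5 <= i <= 12)%N -> is_tg_boundary (HW_group a b c d i).
Proof.
move=> i5; have i12 : (1 <= i <= 12)%N by case/andP: i5 => h ->; rewrite (leq_trans _ h).
have p0 := period_gt0 a0 b0 c0 d0.
have : all (fun i => ecoset (HW_elts i) (eshift (HW_shift i) (HW_elts i))) (iota 5 8).
  by vm_compute.
move=> /allP/(_ i); rewrite mem_iota => /(_ i5).
set T := eshift _ _; set W := HW_elts i => /and3P[/allP WT /allP TT /allP fT].
have gE : isoms (HW_group a b c d i) = half_lattice p W by rewrite HW_isoms.
apply: (@coset_tg_boundary R 4 _ (half_lattice p T) (min_half_period p) (a + b + c + d)).
- exact: half_lattice_isometry.
- move=> g t; rewrite gE; apply: half_lattice_comp => e f We Tf.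
  by have /allP/(_ _ Tf)/andP[] := WT _ We.
- move=> g t; rewrite gE => gg tt; apply: half_lattice_comp tt gg => e f Te Wf.
  by have /allP/(_ _ Te)/andP[] := WT _ Wf.
- move=> t t'; rewrite gE; apply: half_lattice_comp => e f Te Tf.
  by have /allP/(_ _ Tf) := TT _ Te.
- move=> _ h [e Te [k ->]] gh hg; exists e => //; exists (hl_invk e k).
  apply/funext => x; rewrite -{2}(hg x); apply/esym; exact: hl_map_inv.
- exact: min_half_period_gt0.
- exact: HW_displaces.
- move=> _ x [e Te [k ->]].
  have fe : efree [:: e].
    by apply/allP => f; rewrite inE => /eqP ->; apply/orP; right; exact: fT.
  apply: (hl_displaces p0 x fe); first exact: mem_head.
  (* At the origin the identity has translation 0, which is not an odd number of half-periods on
     axis j. *)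
  move=> eid; have /hasP[j' j4 /andP[_ vj]] := fT _ Te.
  rewrite mem_iota /= add0n in j4; pose j := Ordinal j4.
  have := hl_mapE p e k 0 j; rewrite eid !mxE mulr0 add0r /= vj => h.
  suff : true = false by [].
  apply: (@half_int_parity _ false true false (k 0 j) 0 _ (p0 j)).
  by rewrite expr0 mul1r -h mulr0n mul0r mulr0z addr0 mul0r.
- have W0 : ezero \in W by have /andP[/andP[]] := HW_good i12.
  exists (hl_map p (exor (HW_shift i) ezero) 0); exists (exor (HW_shift i) ezero); first exact: map_f.
  by exists 0.
- move=> x; have [g Gg gB] := HW_cover a0 b0 c0 d0 i12 x; exists g => // j.
  have := gB j; rewrite /= in_itv /= => /andP[h1 h2]; rewrite ger0_norm// (le_trans h2)//.
  have [ap bp cp dp] : [/\ 0 < a, 0 < b, 0 < c & 0 < d] by split.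
  by case: (j) => [[|[|[|[|k]]]] hj] //; rewrite /period /=; lra.
Qed.

End HWBoundary.

(** * First Betti number *)

Local Open Scope quotient_scope.

Section EuclidTopology.
Variables (R : realType) (n : nat).
Local Notation ed := (@euclid_dist R n.+1).

Lemma nbhs_ed (x : 'rV[R]_n.+1) (A : set 'rV[R]_n.+1) :
  nbhs x A <-> exists2 e, 0 < e & forall y, ed x y < e -> A y.
Proof.
split=> [/nbhs_ballP[e /= e0 eA]|[e e0 eA]].
  exists e => // y xy; apply: eA; split => // i j; rewrite (ord1 i).
  by rewrite /ball /=; apply: le_lt_trans xy; exact: ed_coord.
(* The sup-norm comparison costs a factor n + 1; dividing by n + 2 makes the inequality strict. *)
apply/nbhs_ballP; have s0 : 0 < e / n.+2%:R by rewrite divr_gt0.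
exists (e / n.+2%:R) => //= y xy; apply: eA; apply: le_lt_trans (ed_sup_ball s0 xy) _.
by rewrite mulrCA gtr_pMr// ltr_pdivrMr// mul1r ltr_nat.
Qed.

Lemma continuous_ed (T : topologicalType) (f : T -> 'rV[R]_n.+1) x :
  (forall e, 0 < e -> \forall y \near x, ed (f x) (f y) < e) -> {for x, continuous f}.
Proof.
move=> h A /nbhs_ed[e e0 eA]; have := h e e0.
by rewrite /nbhs /=; apply: filterS => y /eA.
Qed.

Lemma isometry_continuous (g : 'rV[R]_n.+1 -> 'rV[R]_n.+1) :
  (forall x y, ed (g x) (g y) = ed x y) -> continuous g.
Proof.
move=> gI x; apply: continuous_ed => e e0; apply/nbhs_ed; exists e => // y.
by rewrite gI.
Qed.

Lemma seg_continuous x y : continuous (@seg R n.+1 x y).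
Proof.
move=> t; apply: continuous_ed => e e0; apply/nbhs_ballP.
have l0 : 0 < 1 + ed x y by rewrite ltr_wpDr ?ed_ge0.
exists (e / (1 + ed x y)); first by rewrite /= divr_gt0.
move=> s /=; rewrite /ball /= ltr_pdivlMr// => ts; rewrite ed_seg.
by apply: le_lt_trans ts; rewrite ler_wpM2l// lerDr.
Qed.

End EuclidTopology.

Lemma clamp_continuous (R : realType) (a b : R) : a <= b -> continuous (clamp a b).
Proof.
move=> ab t; apply/cvgrPdist_lt => e e0; near=> s.
apply: le_lt_trans (clamp_lip ab t s) _; near: s.
exact: (@cvgr_dist_lt _ _ _ _ _ id _ cvg_id).
Unshelve. all: by end_near. Qed.

Section Betti.
Variables (R : realType) (n : nat) (G : isom_group R n.+1) (d : R).
Hypotheses (d0 : 0 < d) (dG : displaces G d).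
Local Notation ed := (@euclid_dist R n.+1).
Local Notation X := (quotient_space G).
Local Notation pr := (proj G).

Lemma proj_continuous : continuous (pr : 'rV[R]_n.+1 -> X).
Proof. exact: pi_continuous. Qed.

Lemma nbhs_proj_ball y e : 0 < e -> nbhs (pr y : X) [set u | exists2 z, ed y z < e & pr z = u].
Proof.
move=> e0; apply: (@open_nbhs_nbhs X); split; last by exists y => //; rewrite edxx.
change (open (pr @^-1` [set u : X | exists2 z, ed y z < e & pr z = u])).
rewrite openE => x [z yz /projP[g Gg gz]]; apply/nbhs_ed.
exists (e - ed y z); first by rewrite subr_gt0.
move=> x' xx'; have [h [Gh gh hg]] := group_inv Gg.
exists (h x'); last exact: proj_group.
apply: (le_lt_trans (ed_triangle z _ _)).
by rewrite -ltrBrDl -(group_ed _ _ Gg) hg gz.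
Qed.

(** Lifts chosen independently within d/4 of [y] already form a continuous function, because
    discreteness leaves only one lift of each point so close to [y]. *)
Lemma local_lift (c : R -> X) (t : R) : continuous c -> exists e l, [/\ 0 < e,
  forall s, `|t - s| < e -> pr (l s) = c s &
  forall s, `|t - s| < e -> {for s, continuous (l : R -> 'rV[R]_n.+1)}].
Proof.
have dp := d0.
move=> cc; have [y yt] := proj_surj (c t).
have near s z r : 0 < r -> pr z = c s -> exists2 e, 0 < e & forall s', `|s - s'| < e ->
    exists2 z', ed z z' < r & pr z' = c s'.
  move=> r0 zs; have := cc s [set u | exists2 z', ed z z' < r & pr z' = u].
  rewrite -zs => /(_ (nbhs_proj_ball z r0))/nbhs_ballP[e /= e0 h].
  by exists e => // s' ss'; exact: h.
have [|e e0 He] := near t y (d / 4) _ yt; first by rewrite divr_gt0.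
have /choice[l Pl] : forall s, exists z, `|t - s| < e -> ed y z < d / 4 /\ pr z = c s.
  move=> s; have [/He[z yz zs]|_] := ltP `|t - s| e; first by exists z.
  by exists y.
exists e, l; split=> // [s /Pl[]//|s ts].
have [yl ls] := Pl s ts.
apply: continuous_ed => r r0.
have [|e' e'0 He'] := near s (l s) (Num.min r (d / 4)) _ ls.
  by rewrite lt_min r0 divr_gt0.
apply/nbhs_ballP; exists (Num.min e' (e - `|t - s|)).
  by rewrite /= lt_min e'0 subr_gt0.
move=> s' /=; rewrite /ball /= lt_min => /andP[/He'[z + zs'] ss'].
rewrite lt_min => /andP[lz lzd].
have ts' : `|t - s'| < e.
  by have := ler_normD (t - s) (s - s'); rewrite addrA subrK; lra.
have [yl' ls'] := Pl s' ts'.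
have : pr z = pr (l s') by rewrite zs' ls'.
move=> /projP[g Gg gz].
suff gid : g = id by rewrite -gz gid.
apply: (displaces_inj dG (x := z)) => //; first exact: group_id.
rewrite gz /=.
have := ed_triangle y (l s') z; have := ed_triangle (l s) y z.
by rewrite (ed_sym (l s') y); lra.
Qed.

Variable phi : (R -> X) -> R.
Hypothesis phi_cocycle : cocycle1 phi.

Let phi_ext (c c' : R -> X) : (forall t, 0 <= t <= 1 -> c t = c' t) -> phi c = phi c'.
Proof. by case: phi_cocycle => h _; exact: h. Qed.

Let phi_simplex (sigma : R * R -> X) : continuous sigma ->
  phi (fun t => sigma (0, t)) + phi (fun t => sigma (t, 1)) = phi (fun t => sigma (t, t)).
Proof.
by move=> cs; case: phi_cocycle => _; apply; exact: continuous_subspaceT.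
Qed.

(** The integral of [phi] along the projected ray from the origin: a candidate primitive of the
    lifted cocycle. *)
Definition cone_value (x : 'rV[R]_n.+1) := phi (fun t => pr (t *: x)).

(* Coning a path off to the origin gives a 2-simplex; the formula needs no
   case distinction since s / 0 = 0. *)
Lemma phi_path (c : R -> 'rV[R]_n.+1) : continuous c ->
  phi (fun t => pr (c t)) = cone_value (c 1) - cone_value (c 0).
Proof.
move=> cc.
have z01 : (0 : R) <= 1 := ler01.
pose c' t := c (clamp 0 1 t).
have cc' : continuous c'.
  by move=> t; apply: continuous_comp; [exact: clamp_continuous | exact: cc].
pose sigma (z : R * R) := z.2 *: c' (z.1 / z.2).
have csig : continuous sigma.
  move=> [s t]; have [t_0|t0] := eqVneq t 0; last first.
    apply: cvgZ; first exact: cvg_snd.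
    apply: (@continuous_comp _ _ _ (fun z : R * R => z.1 / z.2) c'); last exact: cc'.
    apply: cvgM; first exact: cvg_fst.
    by apply: cvgV => //; exact: cvg_snd.
  (* At t = 0 the quotient of the coordinates has no limit; continuity comes from the boundedness of
     [c'], which is why the path was clamped. *)
  have /compact_bounded[B [_ HB]] : compact (c @` `[0, 1]%classic).
    apply: continuous_compact; last exact: segment_compact.
    exact: continuous_subspaceT.
  pose C := `|B| + 1.
  have C0 : 0 < C by rewrite ltr_wpDl.
  have bC u : `|c' u| <= C.
    apply: HB; first by rewrite (le_lt_trans (ler_norm B))// ltrDl.
    exists (clamp 0 1 u) => //; rewrite /= in_itv /=; exact: clamp_bound.
  rewrite t_0; apply/cvgrPdist_lt => e e0; rewrite /sigma /= scale0r.
  have : \forall z \near (s, 0 : R), `|0 - (z : R * R).2| < e / C.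
    have /cvgrPdist_lt/(_ (e / C)) : (z : R * R).2 @[z --> (s, 0 : R)] --> (0 : R).
      exact: cvg_snd.
    by apply; rewrite divr_gt0.
  apply: filterS => z; rewrite !sub0r !normrN normrZ ltr_pdivlMr//.
  by apply: le_lt_trans; rewrite ler_wpM2l.
have := @phi_simplex (fun z => pr (sigma z)).
move=> /(_ _)E; have {}E := E (fun z => continuous_comp (csig z) (@proj_continuous _)).
have e1 : phi (fun t => pr (sigma (0, t))) = cone_value (c 0).
  by congr phi; apply/funext => t; rewrite /sigma /= mul0r /c' clamp_id// lexx.
have e2 : phi (fun t => pr (sigma (t, 1))) = phi (fun t => pr (c t)).
  by apply: phi_ext => t t01; rewrite /sigma /= divr1 scale1r /c' clamp_id.
have e3 : phi (fun t => pr (sigma (t, t))) = cone_value (c 1).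
  congr phi; apply/funext => t; rewrite /sigma /=; have [->|t0] := eqVneq t 0.
    by rewrite !scale0r.
  by rewrite divff// /c' clamp_id// ler01 lexx.
by rewrite e1 e2 e3 in E; rewrite -E addrC addKr.
Qed.

(** The period of [phi] on the loop represented by [g]; it defines a homomorphism from [G] to the
    reals. *)
Definition monodromy (g : 'rV[R]_n.+1 -> 'rV[R]_n.+1) := cone_value (g 0) - cone_value 0.

Lemma cone_value_group g x : isoms G g -> cone_value (g x) = cone_value x + monodromy g.
Proof.
move=> Gg.
have := @phi_path (fun t => g (seg 0 x t)) _; rewrite seg0 seg1 => h.
have {}h := h (fun t => continuous_comp (@seg_continuous _ _ _ _ t)
   (@isometry_continuous _ _ g (fun x y => group_ed x y Gg) _)).
have h' := @phi_path (seg 0 x) (@seg_continuous _ _ _ _); rewrite seg0 seg1 in h'.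
have E : phi (fun t => pr (g (seg 0 x t))) = phi (fun t => pr (seg 0 x t)).
  by congr phi; apply/funext => t; rewrite proj_group.
rewrite /monodromy; move: h; rewrite E h'; lra.
Qed.

Lemma monodromy_comp g h : isoms G g -> isoms G h ->
  monodromy (g \o h) = monodromy g + monodromy h.
Proof.
by move=> Gg Gh; rewrite {1}/monodromy /= cone_value_group// /monodromy; ring.
Qed.

Hypothesis no_monodromy : forall g, isoms G g -> monodromy g = 0.

Let f (u : X) := cone_value (repr u).

Let fE x : f (pr x) = cone_value x.
Proof.
have : pr (repr (pr x)) = pr x by rewrite /proj reprK.
by move=> /projP[g Gg gx]; rewrite -[in RHS]gx cone_value_group// no_monodromy// addr0.
Qed.

(* Subdivide the path into pieces that lift to R^n. *)
Lemma phi_exact (c : R -> X) : continuous c -> phi c = f (c 1) - f (c 0).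
Proof.
move=> cc; have z01 : (0 : R) <= 1 := ler01.
pose sub a b (s : R) := c (a + s * (b - a)).
suff H : forall t, 0 <= t <= 1 -> phi (sub 0 t) = f (c t) - f (c 0).
  rewrite -(H 1) ?ler01 ?lexx//; congr phi; apply/funext => s.
  by rewrite /sub subr0 mulr1 add0r.
apply: real_ind => t /andP[t0 t1] IH.
have [e [l [e0 lc lcont]]] := local_lift t cc.
have small a b : a <= b -> `|t - a| < e -> `|t - b| < e -> phi (sub a b) = f (c b) - f (c a).
  move=> ab ta tb.
  have inside s : `|t - (a + clamp 0 1 s * (b - a))| < e.
    have /andP[s0 s1] := clamp_bound z01 s.
    move: ta tb; rewrite !ltr_norml => /andP[h1 h2] /andP[h3 h4].
    by apply/andP; split; nra.
  pose mu s := l (a + clamp 0 1 s * (b - a)).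
  have cmu : continuous mu.
    move=> s; apply: (@continuous_comp _ _ _ (fun s => a + clamp 0 1 s * (b - a)) l).
      apply: cvgD; first exact: cvg_cst.
      by apply: cvgM; [exact: clamp_continuous | exact: cvg_cst].
    exact: lcont.
  have -> : phi (sub a b) = phi (fun s => pr (mu s)).
    by apply: phi_ext => s s01; rewrite /mu lc ?clamp_id// -{1}(clamp_id s01) inside.
  have m0 : pr (mu 0) = c a.
    by rewrite /mu lc ?inside// clamp_id ?lexx// mul0r addr0.
  have m1 : pr (mu 1) = c b.
    by rewrite /mu lc ?inside// clamp_id ?ler01 ?lexx// mul1r addrC subrK.
  by rewrite phi_path// -!fE m0 m1.
have [t_0|tn0] := eqVneq t 0.
  exists e => // u /andP[tu ue] u1; rewrite t_0 add0r in ue; rewrite t_0 in tu small.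
  by apply: small; rewrite // ?subrr ?normr0// sub0r normrN ger0_norm.
have tp : 0 < t by rewrite lt_neqAle eq_sym tn0.
pose k := Num.min t e / 2.
have k0 : 0 < k by rewrite divr_gt0// lt_min tp.
have kt : k <= t / 2 by rewrite ler_pM2r// ge_min lexx.
have ke : k <= e / 2 by rewrite ler_pM2r// ge_min lexx orbT.
exists e => // u /andP[tu ue] u1; pose b := t - k.
have hb : phi (sub 0 b) = f (c b) - f (c 0) by apply: IH; rewrite /b; apply/andP; split; lra.
have hbu : phi (sub b u) = f (c u) - f (c b).
  apply: small; first by rewrite /b; lra.
    by rewrite /b opprB addrC subrK gtr0_norm; lra.
  by rewrite distrC ger0_norm; lra.
(* The affine 2-simplex with vertices 0, b and u, composed with [c]: its faces express the
   additivity of [phi] under subdivision. *)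
pose alpha (z : R * R) := b * z.2 + (u - b) * z.1.
have calpha : continuous alpha.
  move=> z; apply: cvgD; apply: cvgM; try exact: cvg_cst; [exact: cvg_snd | exact: cvg_fst].
have := @phi_simplex (fun z => c (alpha z)) (fun z => continuous_comp (calpha z) (cc _)).
have -> : (fun s => c (alpha (0, s))) = sub 0 b.
  by apply/funext => s; rewrite /sub /alpha /=; congr c; ring.
have -> : (fun s => c (alpha (s, 1))) = sub b u.
  by apply/funext => s; rewrite /sub /alpha /=; congr c; ring.
have -> : (fun s => c (alpha (s, s))) = sub 0 u.
  by apply/funext => s; rewrite /sub /alpha /=; congr c; ring.
by rewrite hb hbu => <-; ring.
Qed.

Lemma phi_coboundary : coboundary1 phi.
Proof.
exists f => g pg; have z01 : (0 : R) <= 1 := ler01.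
(* Clamping makes the path continuous on the whole line without changing it on [0, 1]. *)
pose c t := g (clamp 0 1 t).
have cc : continuous c.
  move=> t A nA; have ct := clamp_bound z01 t.
  have /subspace_continuousP/(_ (clamp 0 1 t)) := pg.
  rewrite /= in_itv /= => /(_ ct A nA); rewrite /nbhs /= /within /= => h.
  have hh : nbhs t (clamp 0 1 @^-1` [set s | `[0, 1]%classic s -> A (g s)]).
    exact: (clamp_continuous z01 h).
  change (nbhs t (c @^-1` A)); apply: filterS hh => s /= hs; apply: hs.
  by rewrite in_itv /=; exact: clamp_bound.
have -> : phi g = phi c by apply: phi_ext => t t01; rewrite /c clamp_id.
by rewrite phi_exact// /c !clamp_id// ?ler01 ?lexx.
Qed.

End Betti.

Lemma first_betti_zero (R : realType) n (G : isom_group R n.+1) (d : R) :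
  0 < d -> displaces G d ->
  (forall h : ('rV[R]_n.+1 -> 'rV[R]_n.+1) -> R,
     (forall g g', isoms G g -> isoms G g' -> h (g \o g') = h g + h g') ->
     forall g, isoms G g -> h g = 0) ->
  first_betti_eq R (quotient_space G) 0.
Proof.
move=> d0 dG hom0; exists (fun _ _ => 0); split; first by case.
move=> phi cphi; exists 0; split; last by move=> u _; apply/rowP => -[].
have -> : (fun g => phi g - \sum_(i < 0) (0 : 'rV[R]_0) 0 i * 0) = phi.
  by apply/funext => g; rewrite big_ord0 subr0.
apply: (phi_coboundary d0 dG cphi) => g; apply: hom0 => g1 g2.
exact: monodromy_comp.
Qed.

(** * Homomorphisms to the reals for the first two groups *)

Section HWBetti.
Variables (R : realType) (a b c d : R).
Hypotheses (a0 : 0 < a) (b0 : 0 < b) (c0 : 0 < c) (d0 : 0 < d).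
Local Notation p := (period a b c d).

(* Every coordinate is reversed by some element, so translations are conjugate to
   their inverses; squares are translations. *)
Lemma HW_hom_zero i (h : ('rV[R]_4 -> 'rV[R]_4) -> R) : i \in [:: 1; 2]%N ->
  (forall g g', isoms (HW_group a b c d i) g -> isoms (HW_group a b c d i) g' ->
     h (g \o g') = h g + h g') ->
  forall g, isoms (HW_group a b c d i) g -> h g = 0.
Proof.
move=> i2; have i12 : (1 <= i <= 12)%N by move: i2; rewrite !inE => /orP[] /eqP ->.
rewrite HW_isoms//; set W := HW_elts i => hM.
have W0 : ezero \in W by have /andP[/andP[]] := HW_good i12.
have WD e f : e \in W -> f \in W -> exor e f \in W.
  have /andP[/andP[_ /allP WD] _] := HW_good i12.
  by move=> We Wf; have /allP/(_ _ Wf) := WD _ We.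
have Wf : all (fun j => has (fun e => chi e j) W) (iota 0 4).
  have : all (fun i => all (fun j => has (fun e => chi e j) (HW_elts i)) (iota 0 4)) [:: 1; 2]%N.
    by vm_compute.
  by move=> /allP; apply.
pose H e k := h (hl_map p e k).
have HM e f k l : e \in W -> f \in W ->
    H (exor e f) (hl_compk e f k l) = H e k + H f l.
  by move=> We Wf'; rewrite /H -hl_map_comp hM//; [exists e|exists f]; rewrite //; [exists k|exists l].
have exorxx e : exor e e = ezero by rewrite /exor /bxor /mkseq /= !addbb.
have exor0 e : e \in W -> exor ezero e = e.
  have : all (fun i => all (fun e => exor ezero e == e) (HW_elts i)) [:: 1; 2]%N by vm_compute.
  by move=> /allP/(_ _ i2)/allP h0 /h0/eqP.
have HT k l : H ezero (k + l) = H ezero k + H ezero l.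
  rewrite -HM//; congr H.
  by apply/rowP => j; rewrite !mxE !nth_ezero addr0.
have H0 : H ezero 0 = 0 by have := HT 0 0; rewrite addr0; lra.
have HN k : H ezero (- k) = - H ezero k.
  by have := HT k (- k); rewrite subrr H0; lra.
have HTj j z : H ezero (z *: delta_mx 0 j) = 0.
  have : (j : nat) \in iota 0 4 by rewrite mem_iota /=.
  move=> /(allP Wf)/hasP[e We ej].
  have E1 := HM e ezero 0 (z *: delta_mx 0 j) We W0.
  have E2 := HM ezero e (- (z *: delta_mx 0 j)) 0 W0 We.
  have : H (exor e ezero) (hl_compk e ezero 0 (z *: delta_mx 0 j)) =
         H (exor ezero e) (hl_compk ezero e (- (z *: delta_mx 0 j)) 0).
    rewrite /H; congr h; rewrite -!hl_map_comp; apply/funext => x; apply/rowP => j'.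
    rewrite /= !hl_mapE !nth_ezero !mxE expr0 !mulr0n !mul0r !add0r !mulr0z !eqxx /=.
    case: (eqVneq j' j) => [->|ne]; rewrite ?mulr1n ?mulr0n ?mulr1 ?mulr0.
      by rewrite ej expr1 rmorphN /=; lra.
    by rewrite oppr0 !mulr0z; ring.
  rewrite E1 E2 HN; lra.
have HT0 k : H ezero k = 0.
  rewrite [k]row_sum_delta; elim/big_rec: _ => // j x _ Hx.
  by rewrite HT HTj Hx addr0.
move=> _ [e We [k ->]]; have := HM e e k k We We; rewrite exorxx HT0 -/(H e k); lra.
Qed.

Lemma HW_betti i : i \in [:: 1; 2]%N ->
  first_betti_eq R (quotient_space (HW_group a b c d i)) 0.
Proof.
move=> i2; have i12 : (1 <= i <= 12)%N by move: i2; rewrite !inE => /orP[] /eqP ->.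
apply: (first_betti_zero (min_half_period_gt0 (period_gt0 a0 b0 c0 d0))
  (HW_displaces a0 b0 c0 d0 i12)) => h; exact: HW_hom_zero.
Qed.

End HWBetti.

Theorem theorem5p1 (R : realType) (a b c d : R)
    (ha : 0 < a) (hb : 0 < b) (hc : 0 < c) (hd : 0 < d)
    (i : nat) (hi : (1 <= i <= 12)%N) :
  (is_tg_boundary (HW_group a b c d i) <-> i \notin [:: 1; 2; 3; 4]%N) /\
  (i \in [:: 1; 2; 3; 4]%N ->
     ~ orientable (quotient_dist (G := HW_group a b c d i)) 4) /\
  (i \in [:: 1; 2]%N ->
     first_betti_eq R (quotient_space (HW_group a b c d i)) 0).
Proof.
split; first (split; last first).
- by move=> i4; apply: HW_boundary => //; case: i hi i4 => [|[|[|[|[|i]]]]] // /andP[_ ->].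
- move=> bG; apply/negP => i4; exact: HW_not_boundary ha hb hc hd i4 bG.
split; [exact: HW_not_orientable | exact: HW_betti].
Qed.
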